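(* Let $f\in\mathfrak g^{\mathcal M}$ and let $\mathcal B_f(\alpha)$ be a Lie--Butcher series method for the differential equation $y'=f(y)\cdot y$. Then there is a modified vector field $\tilde f$, given by a Lie--Butcher series $\tilde f=\mathcal B_f(\beta)$, such that $$\mathcal B_{\tilde f}(\gamma_{\mathrm{Exact}})=\mathcal B_f(\alpha).$$ Moreover, $$\beta\star\gamma_{\mathrm{Exact}}=\alpha .$$ Here $\gamma_{\mathrm{Exact}}$ denotes the coefficients of the Lie--Butcher series of the exact solution (in the ''Lie type'' representation described in the context), and $\star$ is the substitution law.
   Context: **Trees and forests.** $OT$ is the set of ordered (planar) rooted trees; $OF$ is the set of ordered forests, i.e. all finite words (including the empty word $\mathbb I$) in the alphabet $OT$. $\bullet$ is the one-vertex tree, $B^+:OF\to OT$ adds a common root to the trees of a word (so $B^+(\mathbb I)=\bullet$), and $|\omega|$ is the number of vertices of $\omega$. $N=\mathbb R\langle OT\rangle$ is the vector space with basis $OF$, with concatenation as associative product and unit $\mathbb I$. $N^*=\mathbb R\langle\langle OT\rangle\rangle$ is the space of infinite linear combinations $\alpha=\sum_{\omega\in OF}\alpha(\omega)\omega$. Linear operations on $N$ below are extended to $N^*$ by means of the grading $|\cdot|$. **Grafting.** $\curvearrowright:N\otimes N\to N$ is the bilinear product determined, for $\tau\in OT$, $\omega,\omega_1,\omega_2\in OF$, by $\mathbb I\curvearrowright\omega=\omega$, $\tau\curvearrowright\mathbb I=0$, $\omega\curvearrowright\bullet=B^+(\omega)$, $\tau\curvearrowright(\omega_1\omega_2)=(\tau\curvearrowright\omega_1)\omega_2+\omega_1(\tau\curvearrowright\omega_2)$,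 $(\tau\omega)\curvearrowright\omega_1=\tau\curvearrowright(\omega\curvearrowright\omega_1)-(\tau\curvearrowright\omega)\curvearrowright\omega_1$. **Lie series and substitution.** Lie polynomials form the smallest subspace of $N$ containing $OT$ and closed under $[x,y]=xy-yx$ (concatenation commutator). A Lie series is an element of $N^*$ all of whose homogeneous components are Lie polynomials; equivalently, it is an infinitesimal character for the shuffle product of words in the alphabet $OT$. For a Lie series $\beta$, $\beta$-substitution $\beta\star:N^*\to N^*$ is the unique D-algebra homomorphism sending $\bullet$ to $\beta$, i.e. the linear map (compatible with infinite sums) determined by $\beta\star\mathbb I=\mathbb I$, $\beta\star(\omega_1\omega_2)=(\beta\star\omega_1)(\beta\star\omega_2)$, $\beta\star B^+(\omega)=(\beta\star\omega)\curvearrowright\beta$. **Differential operators.** $\mathcal M$ is a manifold with a frame, i.e. finitely many vector fields spanning the tangent space at every point; $\mathfrak g$ is the Lie algebra of vector fields generated by the frame, $U(\mathfrak g)$ its universal enveloping algebra, $\mathfrak g^{\mathcal M}=C^\infty(\mathcal M,\mathfrak g)\subset U(\mathfrak g)^{\mathcal M}=C^\infty(\mathcal M,U(\mathfrak g))$. For $V\in\mathfrak g$ and $\Psi\in U(\mathfrak g)^{\mathcal M}$, $V[\Psi](p)=\frac{d}{dt}\big|_{t=0}\Psi(\exp(tV)(p))$; this is extended to an action of $U(\mathfrak g)$ by $(VW)[\Psi]=V[W[\Psi]]$ and $\mathbb I[\Psi]=\Psi$. For $g,k\in U(\mathfrak g)^{\mathcal M}$ set $g[k](p)=(g(p)[k])(p)$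 and $(gk)(p)=g(p)k(p)$. An element $f\in\mathfrak g^{\mathcal M}$ is called a vector field and represents the differential equation $y'=f(y)\cdot y$ on $\mathcal M$, where $f(y)\cdot y$ is the value at $y$ of the vector field $f(y)\in\mathfrak g$. **Elementary differentials and Lie--Butcher series.** For $f\in\mathfrak g^{\mathcal M}$, $\mathcal F_f:N\to U(\mathfrak g)^{\mathcal M}$ is the linear map with $\mathcal F_f(\mathbb I)=\mathbb I$, $\mathcal F_f(B^+(\omega))=\mathcal F_f(\omega)[f]$, $\mathcal F_f(\omega_1\omega_2)=\mathcal F_f(\omega_1)\mathcal F_f(\omega_2)$. The Lie--Butcher series of $\alpha\in N^*$ is the formal series $\mathcal B_f(\alpha)=\sum_{\omega\in OF}\alpha(\omega)\mathcal F_f(\omega)$. All series are formal, graded by $|\omega|$, and no convergence is considered; the step size is absorbed into $f$, and we write $\mathcal B_{f,t}(\alpha)=\sum_\omega t^{|\omega|}\alpha(\omega)\mathcal F_f(\omega)$ when it is to be displayed. For a Lie series $\beta$, $\tilde f=\mathcal B_f(\beta)$ is a formal vector field, and $\mathcal F_{\tilde f}$, $\mathcal B_{\tilde f}$ are defined by the same formulas. **Methods.** A Lie--Butcher series method $\mathcal B_f(\alpha)$ is a numerical solution of $y'=f(y)\cdot y$ written in terms of a Lie--Butcher series; the numerical solution is to be interpreted as the exact solution of a modified equation $y'=\tilde f(y)\cdot y$. The representation used is the ''Lie type'' one: a flow $y_0\mapsto y(t)$ has coefficients $\gamma$ (a Lie series) if $y(t)$ solves the non-autonomous equation with frozen vector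 field $$y'(t)=\Big(\tfrac{\partial}{\partial t}\mathcal B_{f,t}(\gamma)(y_0)\Big)\cdot y(t),\qquad y(0)=y_0 .$$ Thus $\alpha$ is the Lie series of coefficients of the method in this representation (for example, the exponential Euler method $y_{n+1}=\exp(f(y_n))y_n$ has coefficients $\bullet$). **The exact solution.** $\gamma_{\mathrm{Exact}}$ is the Lie series of coefficients of the exact solution of $y'=f(y)\cdot y$ in the same representation. It is the unique solution of $$\gamma_{\mathrm{Exact}}=Y^{-1}\circ B^+\big(Q(\gamma_{\mathrm{Exact}})\big),$$ where $Y(\omega)=|\omega|\,\omega$ and $Q$ is defined as follows. On the free associative algebra on letters $d_1,d_2,\dots$ let $\partial$ be the derivation with $\partial d_i=d_{i+1}$, and let $B_0=\mathbb I$, $B_n=(d_1+\partial)B_{n-1}$ (non-commutative Bell polynomials), $Q_0=\mathbb I$, $Q_n(d_1,\dots,d_n)=\frac1{n!}B_n(1!\,d_1,\dots,n!\,d_n)$. For a Lie series $\gamma$ with degree-$i$ components $\gamma_i$, $Q(\gamma)=\sum_{n\ge0}Q_n(\gamma_1,\dots,\gamma_n)$, with products being concatenation. The first terms are $$\gamma_{\mathrm{Exact}}=\bullet+\tfrac1{2!}B^+(\bullet)+\tfrac1{3!}\big(B^+(\bullet\bullet)+B^+(B^+(\bullet))\big)+\cdots,$$ an infinite combination of trees only. *)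

(* Defs.v *)
From HB Require Import structures.
From mathcomp Require Import all_boot all_order all_algebra.
From mathcomp Require Import all_classical all_reals all_analysis.

Set Implicit Arguments.
Unset Strict Implicit.
Unset Printing Implicit Defensive.

Import Order.TTheory GRing.Theory Num.Theory.
Import numFieldNormedType.Exports.

Local Open Scope classical_set_scope.
Local Open Scope ring_scope.

(** * Ordered trees and forests *)

(* [Node] is B^+ and the one-vertex tree is [Node [::]]. *)
Inductive otree := Node of seq otree.
Notation forest := (seq otree).

HB.instance Definition _ := gen_eqMixin otree.
HB.instance Definition _ := gen_choiceMixin otree.

Definition bullet : otree := Node [::].

Fixpoint tsize (t : otree) : nat := let: Node w := t in (sumn (map tsize w)).+1.
Definition fsize (w : forest) : nat := sumn (map tsize w).

(* The forests with m vertices; the fuel k is enough as soon as m <= k. *)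
Fixpoint forests_rec (k m : nat) : seq forest :=
  match m, k with
  | 0, _ => [:: [::]]
  | _.+1, 0 => [::]
  | m'.+1, k'.+1 =>
      [seq Node p.1 :: p.2 | i <- iota 0 m,
         p <- [seq (w1, w2) | w1 <- forests_rec k' i,
                              w2 <- forests_rec k' (m' - i)]]
  end.
Definition forests (m : nat) : seq forest := forests_rec m m.

Lemma fsize_cons w1 w2 : fsize (Node w1 :: w2) = (fsize w1 + fsize w2).+1.
Proof. by []. Qed.

Lemma mem_forests_rec k m w : (m <= k)%N ->
  (w \in forests_rec k m) = (fsize w == m).
Proof.
elim: k m w => [|k IHk] [|m] [|[w1] w2] // lemk; rewrite ?fsize_cons.
- by apply/negbTE/allpairsPdep => -[i [p []]].
apply/allpairsPdep/eqP => [[i [p []]]|[szw]].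
  rewrite mem_iota add0n => /andP[_ lti] /allpairsP[[u v] /= [uin vin ->]] /= [-> ->].
  move: uin vin; rewrite !IHk; first last.
  - exact: leq_trans lti lemk.
  - by apply: leq_trans (leq_subr _ _) _.
  by move=> /eqP -> /eqP ->; rewrite subnKC // -ltnS.
exists (fsize w1), (w1, w2); split => //.
  by rewrite mem_iota add0n ltnS -szw leq_addr.
apply/allpairsP; exists (w1, w2); split => //=.
  by rewrite IHk // (leq_trans _ (lemk : (m <= k)%N)) // -szw leq_addr.
by rewrite IHk -szw ?addKn // (leq_trans _ (lemk : (m <= k)%N)) // -szw leq_addl.
Qed.

Lemma mem_forests m w : (w \in forests m) = (fsize w == m).
Proof. exact: mem_forests_rec. Qed.

Lemma forests_rec_uniq k m : (m <= k)%N -> uniq (forests_rec k m).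
Proof.
elim: k m => [|k IHk] [|m] // lemk.
have ler i : (m - i <= k)%N by rewrite (leq_trans (leq_subr _ _)).
have lei i : i \in iota 0 m.+1 -> (i <= k)%N.
  by rewrite mem_iota add0n ltnS => /andP[_ /leq_trans]; apply.
apply: allpairs_uniq_dep; first exact: iota_uniq.
- by move=> i /lei li; apply: allpairs_uniq; rewrite ?IHk // => -[? ?] [? ?] _ _ /= [-> ->].
- move=> x y /allpairsPdep[i1 [p1 [/lei l1 q1 ->]]].
  move=> /allpairsPdep[i2 [p2 [/lei l2 q2 ->]]] /= [e1 e2].
  move: q1 q2 => /allpairsP[[u1 v1] /= [m1 _ d1]] /allpairsP[[u2 v2] /= [m2 _ d2]].
  move: e1 e2 m1 m2; rewrite d1 d2 /= => -> ->.
  by rewrite !mem_forests_rec // => /eqP <- /eqP <-.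
Qed.

Lemma forests_uniq m : uniq (forests m).
Proof. exact: forests_rec_uniq. Qed.

(** * The spaces N and N^* *)

(* N^* is [forest -> R], and N is the subspace of finitely supported series. The
   library's pointwise product on functions plays no role here: the product is [concat]. *)
Notation fseries R := (forest -> R).

(* The smallest linear subspace containing G and closed under br. *)
Definition lie_subspace (R : realType) (W : lmodType R) (br : W -> W -> W) : set (set W) :=
  [set L | [/\ L 0, forall (c : R) x y, L x -> L y -> L (c *: x + y)
             & forall x y, L x -> L y -> L (br x y)]].
Definition lie_span (R : realType) (W : lmodType R) (br : W -> W -> W) (G : set W) : set W :=
  smallest (lie_subspace br) G.

Section Series.
Variable R : realType.
Implicit Types (a b : fseries R) (w : forest) (tau : otree).

Definition delta w : fseries R := fun w' => (w' == w)%:R.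
Definition component (m : nat) a : fseries R := fun w => if fsize w == m then a w else 0.

Definition concat a b : fseries R :=
  fun w => \sum_(i < (size w).+1) a (take i w) * b (drop i w).
Definition Bplus a : fseries R := fun w => if w is [:: Node w'] then a w' else 0.
Definition Yinv a : fseries R := fun w => (fsize w)%:R^-1 * a w.

Lemma concat_nil a b : concat a b [::] = a [::] * b [::].
Proof. by rewrite /concat big_ord_recl big_ord0 addr0. Qed.

Lemma concat_cons a b t w :
  concat a b (t :: w) = a [::] * b (t :: w) + concat (fun w' => a (t :: w')) b w.
Proof. by rewrite /concat big_ord_recl. Qed.

Lemma concatDr a b c : concat a (b + c) = concat a b + concat a c.
Proof.
apply/funext => w; rewrite -[RHS]/(concat a b w + concat a c w) /concat -big_split.
by apply: eq_bigr => i _ /=; exact: mulrDr.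
Qed.

Lemma concatDl a b c : concat (a + b) c = concat a c + concat b c.
Proof.
apply/funext => w; rewrite -[RHS]/(concat a c w + concat b c w) /concat -big_split.
by apply: eq_bigr => i _ /=; exact: mulrDl.
Qed.

Lemma concatZl (x : R) a b : concat (x *: a) b = x *: concat a b.
Proof.
apply/funext => w; rewrite -[RHS]/(x * concat a b w) /concat mulr_sumr.
by apply: eq_bigr => i _ /=; exact/esym/mulrA.
Qed.

Lemma concat0l a : concat 0 a = 0.
Proof. by apply/funext => w; apply: big1 => i _; rewrite mul0r. Qed.

Lemma concat0r a : concat a 0 = 0.
Proof. by apply/funext => w; apply: big1 => i _; rewrite mulr0. Qed.

Lemma concat1r a : concat a (delta [::]) = a.
Proof.
apply/funext => w; elim: w a => [|t w IHw] a; first by rewrite concat_nil /delta eqxx mulr1.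
by rewrite concat_cons /delta mulr0 add0r IHw.
Qed.

Lemma concatA a b c : concat a (concat b c) = concat (concat a b) c.
Proof.
apply/funext => w; elim: w a b => [|t w IHw] a b; first by rewrite !concat_nil mulrA.
rewrite !concat_cons IHw mulrDr mulrA concat_nil -addrA; congr (_ + _).
have -> : (fun w' => concat a b (t :: w')) =
    a [::] *: (fun w' => b (t :: w')) + concat (fun w' => a (t :: w')) b.
  by apply/funext => w'; rewrite concat_cons.
by rewrite concatDl concatZl.
Qed.

Lemma concat1l a : concat (delta [::]) a = a.
Proof.
apply/funext => -[|t w]; first by rewrite concat_nil /delta eqxx mul1r.
rewrite concat_cons /delta eqxx mul1r -[X in concat X](_ : 0 = _) ?concat0l ?addr0 //.
Qed.

Lemma concat_delta w1 w2 : concat (delta w1) (delta w2) = delta (w1 ++ w2).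
Proof.
elim: w1 => [|t1 w1 IHw]; first exact: concat1l.
apply/funext => -[|t w]; first by rewrite concat_nil /delta mul0r.
rewrite concat_cons /delta mul0r add0r cat_cons eqseq_cons.
have [->|nt] := eqVneq t t1.
  rewrite -[RHS]/(delta (w1 ++ w2) w) -IHw; congr (concat _ _ w).
  by apply/funext => w'; rewrite eqseq_cons eqxx.
rewrite -[X in concat X](_ : 0 = _) ?concat0l //.
by apply/funext => w'; rewrite eqseq_cons (negbTE nt).
Qed.

Definition concat_bracket a b : fseries R := concat a b - concat b a.
Definition lie_polynomial : set (fseries R) :=
  lie_span concat_bracket (range (fun tau => delta [:: tau])).
Definition lie_series a : Prop := forall m, lie_polynomial (component m a).

(** * Grafting *)

(* The derivation of the concatenation product with given values on the letters. *)
Definition derivation (D : otree -> fseries R) : forest -> fseries R :=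
  fix dw w := match w with
  | [::] => 0
  | t :: w' => concat (D t) (delta w') + concat (delta [:: t]) (dw w')
  end.

(* For a tree tau, the axioms force
   tau ↷ B^+(w) = tau ↷ (w ↷ •) = (tau w) ↷ • + (tau ↷ w) ↷ • = B^+(tau w) + B^+(tau ↷ w). *)
Fixpoint graft_tree tau (t : otree) : fseries R :=
  let: Node w := t in Bplus (delta (tau :: w) + derivation (graft_tree tau) w).
Definition graft1 tau w : fseries R := derivation (graft_tree tau) w.

(* Extension to N^* of the linear operation on N that is given on forests by T and raises
   the number of vertices by d. *)
Definition extend (d : nat) (T : forest -> fseries R) a : fseries R :=
  fun w => if (d <= fsize w)%N
           then \sum_(w' <- forests (fsize w - d)) a w' * T w' w else 0.

(* (tau w) ↷ w1 = tau ↷ (w ↷ w1) - (tau ↷ w) ↷ w1, by recursion on the number of letters of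
   the left-hand word, which is the same in tau ↷ w as in w. *)
Fixpoint graft_rec (k : nat) w w1 : fseries R :=
  match w, k with
  | [::], _ => delta w1
  | _ :: _, 0 => 0
  | tau :: w', k'.+1 =>
      extend (tsize tau) (graft1 tau) (graft_rec k' w' w1)
      - extend (fsize w1) (fun w'' => graft_rec k' w'' w1) (graft1 tau w')
  end.
Definition graft_forest w w1 : fseries R := graft_rec (size w) w w1.

Definition graft a b : fseries R := fun w =>
  \sum_(i < (fsize w).+1) \sum_(w1 <- forests i) \sum_(w2 <- forests (fsize w - i))
    a w1 * b w2 * graft_forest w1 w2 w.

Lemma graft1_cat tau w1 w2 :
  graft1 tau (w1 ++ w2) =
  concat (graft1 tau w1) (delta w2) + concat (delta w1) (graft1 tau w2).
Proof.
elim: w1 => [|t w1 IHw]; first by rewrite concat0l concat1l add0r.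
rewrite cat_cons [LHS]/= -/(graft1 tau (w1 ++ w2)) IHw [graft1 tau (t :: w1)]/=.
rewrite -/(graft1 tau w1) concatDl concatDr -!concat_delta !concatA addrA.
by rewrite concat_delta.
Qed.

(* All the forests occurring in a have n vertices and m trees. *)
Definition supported (n m : nat) a : Prop := forall w, a w != 0 -> fsize w = n /\ size w = m.

Lemma supported_delta w : supported (fsize w) (size w) (delta w).
Proof. by move=> w'; rewrite /delta; have [->|] := eqVneq w' w; rewrite ?eqxx. Qed.

Lemma supportedD n m a b : supported n m a -> supported n m b -> supported n m (a + b).
Proof.
move=> sa sb w; rewrite -[(a + b) w]/(a w + b w).
by have [->|/sa//] := eqVneq (a w) 0; rewrite add0r => /sb.
Qed.

Lemma supportedN n m a : supported n m a -> supported n m (- a).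
Proof. by move=> sa w; rewrite -[(- a) w]/(- a w) oppr_eq0 => /sa. Qed.

Lemma sum_neq0 (I : Type) (r : seq I) (P : pred I) (F : I -> R) (Q : Prop) :
  \sum_(i <- r | P i) F i != 0 -> (forall i, F i != 0 -> Q) -> Q.
Proof.
move=> s0 FQ; apply: contrapT => nQ; case/eqP: s0; apply: big1 => i _.
by apply/eqP; apply: contrapT => /negP /FQ.
Qed.

Lemma supported_concat n1 m1 n2 m2 a b : supported n1 m1 a -> supported n2 m2 b ->
  supported (n1 + n2) (m1 + m2) (concat a b).
Proof.
move=> sa sb w /sum_neq0; apply=> i.
rewrite mulf_eq0 negb_or => /andP[/sa[<- <-] /sb[<- <-]].
by rewrite -size_cat /fsize -sumn_cat -map_cat cat_take_drop.
Qed.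

Lemma supported_graft1 tau w : supported (tsize tau + fsize w) (size w) (graft1 tau w).
Proof.
have [n] := ubnP (fsize w); elim: n w => // n IHn [|[u] w]; first by move=> _ w'; rewrite eqxx.
rewrite fsize_cons ltnS => lt_n /=; rewrite -/(graft1 tau w) -/(graft1 tau u).
have su : supported (tsize tau + fsize u) (size u) (graft1 tau u).
  by apply: IHn; apply: leq_ltn_trans lt_n; rewrite leq_addr.
have sw : supported (tsize tau + fsize w) (size w) (graft1 tau w).
  by apply: IHn; apply: leq_ltn_trans lt_n; rewrite leq_addl.
rewrite -[(size w).+1]add1n; apply: supportedD; last first.
  rewrite -addSn addnCA; apply: supported_concat sw => //.
  by have := @supported_delta [:: Node u]; rewrite fsize_cons addn0.
rewrite -addSn addnA; apply: supported_concat; last exact: supported_delta.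
move=> [|[v] [|//]]; rewrite /= ?eqxx // => nz.
rewrite fsize_cons addn0 addnS; split => //; congr _.+1; move: nz.
rewrite -[(_ + _) v]/(delta (tau :: u) v + graft1 tau u v).
have [->|/supported_delta[-> _]//] := eqVneq (delta (tau :: u) v) 0.
by rewrite add0r => /su[].
Qed.

Lemma supported_extend d T a n m l :
    (forall w, size w = l -> supported (d + fsize w) m (T w)) -> supported n l a ->
  supported (d + n) m (extend d T a).
Proof.
move=> sT sa w; rewrite /extend; case: ifP; rewrite ?eqxx // => _ /sum_neq0; apply=> w'.
by rewrite mulf_eq0 negb_or => /andP[/sa[<- sz] /(sT _ sz)].
Qed.

Lemma supported_graft_rec k w w1 : size w = k ->
  supported (fsize w + fsize w1) (size w1) (graft_rec k w w1).
Proof.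
elim: k w => [|k IHk] [|tau w] //= => [_|[szw]]; first exact: supported_delta.
apply: supportedD.
  rewrite -[fsize (tau :: w)]/(tsize tau + fsize w)%N -addnA.
  by apply: supported_extend (IHk _ szw) => w' <-; apply: supported_graft1.
apply: supportedN; rewrite addnC; apply: supported_extend (@supported_graft1 tau w).
by move=> w' sz; rewrite addnC; apply: IHk; rewrite sz.
Qed.

Lemma sum_delta m w (F : forest -> R) :
  \sum_(w' <- forests m) delta w w' * F w' = if fsize w == m then F w else 0.
Proof.
have [wm|nwm] := boolP (w \in forests m); rewrite -mem_forests ?wm ?(negbTE nwm).
  rewrite (bigD1_seq w) ?forests_uniq //= /delta eqxx mul1r big1 ?addr0 // => w' /negbTE ->.
  by rewrite mul0r.
rewrite big_seq big1 // => w' w'm; rewrite /delta; have [e|] := eqVneq w' w; rewrite ?mul0r //.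
by rewrite -e w'm in nwm.
Qed.

Lemma extend_delta d T w m : supported (d + fsize w) m (T w) -> extend d T (delta w) = T w.
Proof.
move=> sT; apply/funext => w'; rewrite /extend sum_delta.
have [nz|/sT[-> _]] := eqVneq (T w w') 0; first by rewrite nz !if_same.
by rewrite leq_addr addKn eqxx.
Qed.

Lemma graft_forest1 tau w : graft_forest [:: tau] w = graft1 tau w.
Proof.
rewrite /graft_forest /= (extend_delta (@supported_graft1 tau w)) -[RHS]subr0; congr (_ - _).
apply/funext => w'; rewrite /extend; case: ifP => // _.
by apply: big1 => w'' _; rewrite mul0r.
Qed.

Lemma graft_l w a : graft (delta w) a = extend (fsize w) (graft_forest w) a.
Proof.
apply/funext => w'; rewrite /graft /extend.
under eq_bigr => i _.
  under eq_bigr => w1 _.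
    under eq_bigr => w2 _ do rewrite -mulrA.
    rewrite -mulr_sumr; over.
  rewrite sum_delta; over.
case: leqP => [le|lt].
  rewrite (bigD1 (Ordinal (le : fsize w < (fsize w').+1)%N)) //= eqxx [X in _ + X]big1 ?addr0 //.
  by move=> i; rewrite -val_eqE eq_sym /= => /negbTE ->.
by apply: big1 => i _; case: eqP => // e; have := ltn_ord i; rewrite -e ltnS leqNgt lt.
Qed.

Lemma graft_r w a : graft a (delta w) = extend (fsize w) (graft_forest^~ w) a.
Proof.
apply/funext => w'; rewrite /graft /extend.
under eq_bigr => i _.
  under eq_bigr => w1 _.
    under eq_bigr => w2 _ do rewrite -mulrA mulrCA.
    rewrite sum_delta; over.
  over.
case: leqP => [le|lt].
  have lt' : (fsize w' - fsize w < (fsize w').+1)%N by rewrite ltnS leq_subr.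
  rewrite (bigD1 (Ordinal lt')) //= subKn // eqxx [X in _ + X]big1 ?addr0 // => i ni.
  apply: big1 => w1 _; case: eqP => // e; case/eqP: ni; apply/val_inj => /=.
  by rewrite e subKn // -ltnS.
apply: big1 => i _; apply: big1 => w1 _; case: eqP => // e.
by move: lt; rewrite e ltnNge leq_subr.
Qed.

(* On forests, the grafting product satisfies the equations that determine it. *)

Lemma graft_delta w1 w2 : graft (delta w1) (delta w2) = graft_forest w1 w2.
Proof. by rewrite graft_l; apply: extend_delta; apply: supported_graft_rec. Qed.

Lemma graft_nil_l w : graft (delta [::]) (delta w) = delta w.
Proof. exact: graft_delta. Qed.

Lemma graft_nil_r tau : graft (delta [:: tau]) (delta [::]) = 0.
Proof. by rewrite graft_delta graft_forest1. Qed.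

Lemma graft_cat tau w1 w2 :
  graft (delta [:: tau]) (delta (w1 ++ w2)) =
  concat (graft (delta [:: tau]) (delta w1)) (delta w2)
  + concat (delta w1) (graft (delta [:: tau]) (delta w2)).
Proof. by rewrite !graft_delta !graft_forest1 graft1_cat. Qed.

Lemma graft_cons tau w w1 :
  graft (delta (tau :: w)) (delta w1) =
  graft (delta [:: tau]) (graft (delta w) (delta w1))
  - graft (graft (delta [:: tau]) (delta w)) (delta w1).
Proof.
rewrite !graft_delta graft_l graft_r graft_forest1 /graft_forest /=.
congr (extend _ _ _ - _).
- by rewrite /fsize /= addn0.
- by apply/funext => w'; apply/esym/graft_forest1.
apply/funext => w'; rewrite /extend; case: ifP => // _; apply: eq_bigr => w'' _.
have [->|/supported_graft1[_ ->] //] := eqVneq (graft1 tau w w'') 0.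
by rewrite !mul0r.
Qed.

Lemma extend_bullet a : extend 1 (fun w => delta [:: Node w]) a = Bplus a.
Proof.
apply/funext => v; rewrite /extend; case: v => [//|[u] v].
rewrite fsize_cons /= subSS subn0; case: v => [|t v]; last first.
  by rewrite big1 // => w _; rewrite /delta eqseq_cons andbF mulr0.
rewrite addn0; have := sum_delta (fsize u) u a; rewrite eqxx => <-; apply: eq_bigr => w _.
rewrite mulrC /delta; congr (_%:R * _); congr nat_of_bool.
by apply/eqP/eqP => [[->]|->].
Qed.

Lemma graft_bullet w : graft (delta w) (delta [:: bullet]) = delta [:: Node w].
Proof.
have [n] := ubnP (size w); elim: n w => // n IHn [|tau w] /= lt_n; first exact: graft_nil_l.
rewrite graft_cons IHn // graft_delta graft_forest1 graft_r.
have -> : extend (fsize [:: bullet]) (graft_forest^~ [:: bullet])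
            (graft (delta [:: tau]) (delta w)) = Bplus (graft1 tau w).
  rewrite graft_delta graft_forest1 -extend_bullet; apply/funext => v; rewrite /extend.
  case: ifP => // _; apply: eq_bigr => u _.
  have [->|/supported_graft1[_ su]] := eqVneq (graft1 tau w u) 0; first by rewrite !mul0r.
  by rewrite -graft_delta IHn ?su.
rewrite /graft1 /= concat1r concat0r addr0 -/(graft1 tau w); apply/funext => v.
rewrite -[LHS]/(Bplus (delta (tau :: w) + graft1 tau w) v - Bplus (graft1 tau w) v).
case: v => [|[u] [|t v]]; rewrite /delta /= ?subrr //.
- rewrite -[(_ + _) u]/(delta (tau :: w) u + graft1 tau w u) addrK /delta.
  by congr (nat_of_bool _)%:R; apply/eqP/eqP => [->|[->]].
- by rewrite eqseq_cons andbF.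
Qed.

End Series.

(** * D-algebra homomorphisms out of N *)

(* The map F with F(I) = one, F(w1 w2) = F(w1) F(w2) and F(B^+(w)) = F(w)[x]. *)
Section DAlgebraEval.
Variables (A : Type) (one : A) (mul act : A -> A -> A) (x : A).

Fixpoint dalg_tree (t : otree) : A :=
  let: Node w := t in act (foldr (fun t' y => mul (dalg_tree t') y) one w) x.
Definition dalg_eval (w : forest) : A := foldr (fun t y => mul (dalg_tree t) y) one w.

Lemma dalg_eval_cons w1 w2 :
  dalg_eval (Node w1 :: w2) = mul (act (dalg_eval w1) x) (dalg_eval w2).
Proof. by []. Qed.
End DAlgebraEval.

Section Substitution.
Variable R : realType.
Implicit Types (beta gamma : fseries R).

Definition subst_forest beta : forest -> fseries R :=
  dalg_eval (delta R [::]) (@concat R) (@graft R) beta.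

(* A Lie series has no component of degree 0, so [subst_forest beta w'] starts in degree
   [fsize w'] and the sum can be truncated. *)
Definition subst beta gamma : fseries R := fun w =>
  \sum_(i < (fsize w).+1) \sum_(w' <- forests i) gamma w' * subst_forest beta w' w.
End Substitution.

(** * The exact solution *)

(* A word in the letters d_1, d_2, ... is the list of its indices; a polynomial with
   coefficients in nat is the list of its monomials, with repetitions. *)
Fixpoint dword (u : seq nat) : seq (seq nat) :=
  if u is i :: u' then (i.+1 :: u') :: [seq i :: v | v <- dword u'] else [::].
Fixpoint bell (n : nat) : seq (seq nat) :=
  if n is n'.+1 then [seq v | u <- bell n', v <- (1%N :: u) :: dword u] else [:: [::]].

Section Exact.
Variable R : realType.
Implicit Types (gamma : fseries R).

Definition Qn (n : nat) gamma : fseries R :=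
  (n`!%:R)^-1 *: \sum_(u <- bell n)
    \big[@concat R/delta R [::]]_(i <- u) (i`!%:R *: component i gamma).

(* [Qn n gamma] is homogeneous of degree n, so the terms with n > fsize w vanish at w. *)
Definition Qseries gamma : fseries R := fun w => \sum_(n < (fsize w).+1) Qn n gamma w.

Definition exact_step gamma : fseries R := Yinv (Bplus (Qseries gamma)).

(* The values of [exact_step gamma] in degree m only depend on gamma in degrees < m. *)
Definition gamma_exact : fseries R := fun w => iter (fsize w) exact_step 0 w.

Lemma exact_step_agree m a b : (forall w, (fsize w < m)%N -> a w = b w) ->
  forall w, (fsize w <= m)%N -> exact_step a w = exact_step b w.
Proof.
move=> ab w le_m; rewrite /exact_step /Yinv; congr (_ * _).
case: w le_m => [|[u] [|//]] //=; rewrite fsize_cons addn0 => le_m.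
rewrite /Qseries; apply: eq_bigr => n _; congr (_ * _); rewrite !fct_sumE.
apply: eq_bigr => s _.
elim: s u {n} le_m => [|i s IHs] u le_m; first by rewrite !big_nil.
rewrite !big_cons /concat; apply: eq_bigr => j _.
have fu : fsize u = (fsize (take j u) + fsize (drop j u))%N.
  by rewrite /fsize -sumn_cat -map_cat cat_take_drop.
congr (_ * _); last first.
  by apply: IHs; apply: leq_ltn_trans le_m; rewrite fu leq_addl.
congr (_ * _); rewrite /component; case: ifP => // _; apply: ab.
by apply: leq_ltn_trans le_m; rewrite fu leq_addr.
Qed.

Lemma exact_step_nil a : exact_step a [::] = 0.
Proof. by rewrite /exact_step /Yinv mulr0. Qed.

Lemma iter_exact_step_agree k a b : a [::] = b [::] ->
  forall w, (fsize w <= k)%N -> iter k exact_step a w = iter k exact_step b w.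
Proof.
move=> ab; elim: k => [|k IHk] w; first by case: w => [|[u] w] //; rewrite fsize_cons.
by apply: exact_step_agree => v; rewrite ltnS; apply: IHk.
Qed.

(* gamma_exact is the unique solution of gamma = Y^{-1} (B^+ (Q gamma)). *)
Lemma gamma_exact_fixpoint : gamma_exact = exact_step gamma_exact.
Proof.
have gE k w : (fsize w <= k)%N -> gamma_exact w = iter k exact_step 0 w.
  move=> le_k; rewrite /gamma_exact -(subnKC le_k) iterD.
  apply: iter_exact_step_agree => //.
  by case: (k - _)%N => // j; rewrite iterS exact_step_nil.
apply/funext => w; rewrite (gE _ _ (leqnSn _)) iterS.
by apply: exact_step_agree (leqnn _) => v lt; rewrite -gE // ltnW.
Qed.

Lemma gamma_exact_unique gamma : gamma = exact_step gamma -> gamma = gamma_exact.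
Proof.
move=> gE; apply/funext => w; rewrite /gamma_exact.
have {1}-> : gamma = iter (fsize w) exact_step gamma.
  by elim: (fsize w) => // k IHk; rewrite iterS -IHk.
by apply: iter_exact_step_agree; rewrite // gE exact_step_nil.
Qed.
End Exact.

(** * Manifolds and vector fields *)

Section SmoothEuclidean.
Variables (R : realType) (n : nat).

(* [Ck k A f]: f is of class C^k on the open set A. *)
Fixpoint Ck (k : nat) (A : set 'rV[R]_n) (f : 'rV[R]_n -> R) : Prop :=
  (forall x, A x -> {for x, continuous f}) /\
  if k is k'.+1 then
    forall j : 'I_n, (forall x, A x -> derivable f x (delta_mx 0 j)) /\
                     Ck k' A (fun x => 'D_(delta_mx 0 j) f x)
  else True.
Definition smooth_euclid (A : set 'rV[R]_n) (f : 'rV[R]_n -> R) := forall k, Ck k A f.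
End SmoothEuclidean.

(* A smooth manifold of dimension n. The atlas is indexed by the points of the manifold: every
   point p comes with a chart [chart p], with domain [chart_dom p] containing p and inverse
   [chart_inv p]. Any atlas yields one of this form by choosing a chart around each point. *)
Record manifold (R : realType) (n : nat) := Manifold {
  mcarrier :> topologicalType;
  mhausdorff : hausdorff_space mcarrier;
  msecond_countable : @second_countable mcarrier;
  chart_dom : mcarrier -> set mcarrier;
  chart : mcarrier -> mcarrier -> 'rV[R]_n;
  chart_inv : mcarrier -> 'rV[R]_n -> mcarrier;
  chart_dom_open : forall p, open (chart_dom p);
  chart_dom_center : forall p, chart_dom p p;
  chart_open : forall p, open (chart p @` chart_dom p);
  chartK : forall p q, chart_dom p q -> chart_inv p (chart p q) = q;
  chart_continuous : forall p q, chart_dom p q -> {for q, continuous (chart p)};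
  chart_inv_continuous : forall p x,
    (chart p @` chart_dom p) x -> {for x, continuous (chart_inv p)};
  transition_smooth : forall p q (j : 'I_n),
    smooth_euclid (chart p @` (chart_dom p `&` chart_dom q))
                  (fun x => chart q (chart_inv p x) 0 j)
}.

(* The tangent space at p is identified with R^n by means of the chart at p, so that a vector
   field is a function M -> R^n; its components in the chart at another point q are the
   derivatives [vderive V (chart_fun q j)] defined below. *)
Section VectorFields.
Variables (R : realType) (n : nat) (M : manifold R n).
Implicit Types (V W : M -> 'rV[R]_n) (p q : M) (c : R -> M).

(* Smoothness of a real function on an open subset of M. *)
Definition smooth_on (A : set M) (phi : M -> R) : Prop :=
  forall p, smooth_euclid (chart p @` (A `&` chart_dom p)) (phi \o chart_inv p).

(* C^infty(M, L) for a subspace L of a vector space W, possibly of infinite dimension: locally,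
   the function takes its values in a finite-dimensional subspace of L and is smooth there. *)
Definition smooth_into (W : lmodType R) (L : set W) (F : M -> W) : Prop :=
  forall p, exists A : set M, [/\ open A, A p &
    exists m (phi : 'I_m -> M -> R) (w : 'I_m -> W),
      [/\ forall i, smooth_on A (phi i), forall i, L (w i)
        & forall q, A q -> F q = \sum_i phi i q *: w i]].

(* The derivative of a real function along a vector field. *)
Definition vderive V (phi : M -> R) : M -> R :=
  fun p => 'D_(V p) (phi \o chart_inv p) (chart p p).

Definition chart_fun p (j : 'I_n) : M -> R := fun q => chart p q 0 j.

Definition smooth_vfield V : Prop :=
  forall p j, smooth_on (chart_dom p) (vderive V (chart_fun p j)).

(* The Jacobi bracket, in the coordinates of the chart at each point. *)
Definition jacobi V W : M -> 'rV[R]_n := fun p =>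
  \row_j (vderive V (vderive W (chart_fun p j)) p
          - vderive W (vderive V (chart_fun p j)) p).

Definition integral_curve V p c : Prop := c 0 = p /\
  exists2 e : R, 0 < e & forall t, `|t| < e ->
    {for t, continuous c} /\ is_derive t 1 (fun s => chart (c t) (c s)) (V (c t)).

(* [flow V p t] is exp(tV)(p) for t close to 0: the choice of the integral curve is
   irrelevant there. *)
Definition flow V p : R -> M := xget (fun=> p) [set c | integral_curve V p c].

(* The derivative at t of a curve in a vector space W, possibly of infinite dimension, that
   stays in a finite-dimensional subspace near t. *)
Definition is_vec_derive (W : lmodType R) (c : R -> W) (t : R) (w : W) : Prop :=
  exists m (x : 'I_m -> R -> R) (v : 'I_m -> W),
    [/\ \forall s \near t, c s = \sum_i x i s *: v i,
        forall i, derivable (x i) t 1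
      & w = \sum_i 'D_1 (x i) t *: v i].

(* V[Psi](p) = d/dt Psi(exp(tV)(p)) at t = 0. *)
Definition lie_derive (W : lmodType R) V (Psi : M -> W) : M -> W :=
  fun p => xget 0 [set w | is_vec_derive (fun t => Psi (flow V p t)) 0 w].

Section Frame.
Variables (d : nat) (E : 'I_d -> M -> 'rV[R]_n).

Definition is_frame : Prop :=
  (forall i, smooth_vfield (E i)) /\ (forall p, row_full (\matrix_i E i p)).

(* The Lie algebra of vector fields generated by the frame. *)
Definition frame_lie : set (M -> 'rV[R]_n) := lie_span jacobi (range E).
End Frame.
End VectorFields.

(** * The universal enveloping algebra and its action *)

Section Enveloping.
Variables (R : realType) (n : nat) (M : manifold R n).
Variable g : set (M -> 'rV[R]_n).

Definition lie_morphism (A : algType R) (h : (M -> 'rV[R]_n) -> A) : Prop :=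
  (forall (c : R) V W, g V -> g W -> h (c *: V + W) = c *: h V + h W) /\
  (forall V W, g V -> g W -> h (jacobi V W) = h V * h W - h W * h V).

(* U(g) is characterized by its universal property. *)
Definition is_enveloping (U : algType R) (iota : (M -> 'rV[R]_n) -> U) : Prop :=
  lie_morphism iota /\
  forall (A : algType R) (h : (M -> 'rV[R]_n) -> A), lie_morphism h ->
    exists H : {lrmorphism U -> A}, (forall V, g V -> H (iota V) = h V) /\
      forall H' : {lrmorphism U -> A}, (forall V, g V -> H' (iota V) = h V) -> H' =1 H.

Variables (U : algType R) (iota : (M -> 'rV[R]_n) -> U).

Definition is_action (act : U -> (M -> U) -> (M -> U)) : Prop :=
  forall Psi : M -> U, smooth_into setT Psi ->
    [/\ forall (c : R) u v, act (c *: u + v) Psi = c *: act u Psi + act v Psi,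
        act 1 Psi = Psi,
        forall u v, act (u * v) Psi = act u (act v Psi)
      & forall V, g V -> act (iota V) Psi = lie_derive V Psi].

(* The action of U(g) on C^infty(M, U(g)); it is unique there. *)
Definition Uact : U -> (M -> U) -> (M -> U) :=
  xget (fun (_ : U) (Psi : M -> U) => Psi) [set a | is_action a].

Definition frozen_act (h k : M -> U) : M -> U := fun p => Uact (h p) k p.

(** * Elementary differentials and Lie-Butcher series *)

(* F_f; the unit and the product of M -> U are the pointwise ones. *)
Definition elem_diff (f : M -> (M -> 'rV[R]_n)) : forest -> (M -> U) :=
  dalg_eval 1 *%R frozen_act (iota \o f).

(* The coefficient of t^m in B_{f,t}(alpha). *)
Definition LB_series (f : M -> (M -> 'rV[R]_n)) (alpha : fseries R) : nat -> (M -> U) :=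
  fun m => \sum_(w <- forests m) alpha w *: elem_diff f w.

(* Formal series with coefficients in U(g)^M, with the operations extended by the grading. *)
Definition formal_one : nat -> (M -> U) := fun m => if m == 0%N then 1 else 0.
Definition formal_mul (h k : nat -> (M -> U)) : nat -> (M -> U) :=
  fun m => \sum_(i < m.+1) h i * k (m - i)%N.
Definition formal_act (h k : nat -> (M -> U)) : nat -> (M -> U) :=
  fun m => \sum_(i < m.+1) frozen_act (h i) (k (m - i)%N).

(* A formal vector field: a formal series, without constant term, of elements of g^M. *)
Definition formal_vfield (ft : nat -> M -> (M -> 'rV[R]_n)) : Prop :=
  (forall p, ft 0%N p = 0) /\ (forall m, smooth_into g (ft m)).

Definition formal_elem_diff (ft : nat -> M -> (M -> 'rV[R]_n)) : forest -> nat -> (M -> U) :=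
  dalg_eval formal_one formal_mul formal_act (fun m => iota \o ft m).

(* As ft has no constant term, [formal_elem_diff ft w] starts in degree [fsize w] and the sum
   over the forests can be truncated. *)
Definition formal_LB_series (ft : nat -> M -> (M -> 'rV[R]_n)) (gamma : fseries R) :
    nat -> (M -> U) :=
  fun m => \sum_(i < m.+1) \sum_(w <- forests i) gamma w *: formal_elem_diff ft w m.
End Enveloping.

(* Main.v *)
From HB Require Import structures.
From mathcomp Require Import all_boot all_order all_algebra.
From mathcomp Require Import all_classical all_reals all_analysis.
From mathcomp Require Import ring lra.
Require Import Defs.

Set Implicit Arguments.
Unset Strict Implicit.
Unset Printing Implicit Defensive.

Import Order.TTheory GRing.Theory Num.Theory.
Import numFieldNormedType.Exports.

Local Open Scope classical_set_scope.
Local Open Scope ring_scope.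

(** The coefficients of the modified vector field come from an equation in the space of series.
    Since gamma_exact = bullet + c, where c combines trees with at least two vertices, and since
    beta-substitution sends bullet to beta, the equation subst beta gamma_exact = alpha reads
    beta + subst beta c = alpha. A component of subst beta c only involves components of beta of
    lower degree, so the equation has a solution (subst_fixpoint). The solution is a Lie series
    because subst beta c is built by grafting onto beta, and grafting any series onto a Lie
    series gives a Lie series (lie_series_graft): grafting a tree is a derivation of the
    concatenation bracket, and grafting a word reduces to grafting trees.

    The identity of Lie-Butcher series then says that evaluation at f tilde = B_f(beta) is
    substitution of beta followed by evaluation at f (formal_LB_subst). It holds because B_f is a
    homomorphism of D-algebras: it turns concatenation into the pointwise product (LB_concat) and
    grafting into the frozen action of U(g)-valued functions (LB_graft). On the side of functions
    this rests on three identities for a vector field X with values in g and U(g)-valued h and k: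
    X[1] = 0, X[h k] = X[h] k + h X[k] and X[h[k]] = (X h)[k] + X[h][k] (frozen_act_one,
    frozen_act_mul, frozen_act_assoc). Finally B_f(beta) is a formal vector field: the frozen
    action maps vector fields to vector fields (frozen_act_vfield), so trees evaluate to vector
    fields, and brackets of trees to pointwise Jacobi brackets (LB_lie_polynomial).

    These identities presuppose that U(g) acts on smooth functions at all, which is where
    analysis enters. The derivative along V is defined by means of the flow, so integral curves
    have to exist; they are obtained by Picard iteration in a chart (picard_local_existence,
    integral_curve_exists). By the chain rule the derivative along the flow is then a derivation
    that can be computed in charts (vderive_chain, lie_derive_rep), and by the symmetry of second
    derivatives these derivations satisfy the relation of the Jacobi bracket (vderive_jacobi).
    The universal property of U(g), applied to an algebra of endomorphisms, extends them to an
    action (enveloping_action), and its uniqueness part shows that U(g) is generated by g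
    (enveloping_generated), so that properties of the action can be checked on g. *)

Local Notation ebase j := (delta_mx 0 j).

(** * Continuously differentiable functions of several variables *)

Definition partial (R : realType) (n : nat) (j : 'I_n) (f : 'rV[R]_n -> R) : 'rV[R]_n -> R :=
  fun x => 'D_(delta_mx 0 j) f x.

Section PartialDerivatives.
Variables (R : realType) (n : nat).
Implicit Types (f : 'rV[R]_n -> R) (x a b : 'rV[R]_n).

Lemma norm_coord x j : `|x 0 j| <= `|x|.
Proof.
rewrite [leRHS]/Num.Def.normr/= mx_normrE.
by apply: (le_trans _ (le_bigmax _ _ (0, j))).
Qed.

Lemma norm_rV_le x (e : R) : 0 <= e -> (forall j, `|x 0 j| <= e) -> `|x| <= e.
Proof.
move=> e0 xe; rewrite [leLHS]/Num.Def.normr/= mx_normrE.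
by apply: bigmax_le => // -[i j] _; rewrite (ord1 i).
Qed.

Lemma norm_delta_mx (j : 'I_n) : `|ebase j : 'rV[R]_n| <= 1.
Proof.
apply: norm_rV_le => // i; rewrite mxE eqxx /=.
by case: eqP => _; rewrite ?normr1 ?normr0.
Qed.

Lemma is_derive_line f x (v : 'rV[R]_n) (t : R) :
  derivable f (x + t *: v) v ->
  is_derive t 1 (fun s => f (x + s *: v)) ('D_v f (x + t *: v)).
Proof.
move=> df.
have E : (fun h : R => h^-1 *: (((fun s => f (x + s *: v)) \o shift t) (h *: 1) - f (x + t *: v)))
   = (fun h => h^-1 *: ((f \o shift (x + t *: v)) (h *: v) - f (x + t *: v))).
  apply/funext => h /=; congr (_ *: (f _ - _)).
  by rewrite [h *: 1]mulr1 scalerDl addrCA.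
by split; rewrite /derivable /derive /= E.
Qed.

(** Since h may be negative, the intermediate point is located by its absolute value. *)
Lemma MVT_line f x (v : 'rV[R]_n) (h : R) :
  (forall t : R, `|t| <= `|h| -> derivable f (x + t *: v) v) ->
  exists2 t, `|t| <= `|h| & f (x + h *: v) - f x = h * 'D_v f (x + t *: v).
Proof.
move=> df.
have dg (t : R) : `|t| <= `|h| ->
    is_derive t 1 (fun s => f (x + s *: v)) ('D_v f (x + t *: v)).
  by move=> /df; exact: is_derive_line.
have cont (a b : R) : `|a| <= `|h| -> `|b| <= `|h| ->
    {within `[a, b], continuous (fun s => f (x + s *: v))}.
  move=> ah bh; apply: derivable_within_continuous => t.
  rewrite in_itv /= => /andP[at_ tb]; suff /dg [] : `|t| <= `|h| by [].
  rewrite ler_norml; move: ah bh; rewrite !ler_norml => /andP[? _] /andP[_ ?].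
  by apply/andP; split; [exact: le_trans at_|exact: le_trans tb _].
have [h0|h0] := leP 0 h.
  have [||t] := @MVT_segment R (fun s => f (x + s *: v)) (fun t => 'D_v f (x + t *: v)) 0 h h0.
  - move=> t; rewrite in_itv /= => /andP[t0 th]; apply: dg.
    by rewrite (ger0_norm (ltW t0)) (ger0_norm h0) ltW.
  - by apply: cont => //; rewrite normr0.
  rewrite in_itv /= => /andP[t0 th] e; exists t; first by rewrite !ger0_norm.
  by move: e; rewrite scale0r addr0 subr0 mulrC.
have [||t] := @MVT_segment R (fun s => f (x + s *: v)) (fun t => 'D_v f (x + t *: v)) h 0 (ltW h0).
- move=> t; rewrite in_itv /= => /andP[t0 th]; apply: dg.
  by rewrite !ltr0_norm // lerN2 ltW.
- by apply: cont => //; rewrite normr0.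
rewrite in_itv /= => /andP[t0 th] e; exists t.
  by rewrite (ltr0_norm h0) (ler0_norm th) lerN2.
by move: e; rewrite scale0r addr0 sub0r mulrN -mulNr [h * _]mulrC => e; lra.
Qed.

(** Consecutive interpolations between a and b differ in one coordinate, so that an increment
    of f is a sum of increments parallel to the axes. *)
Definition hybrid a b (k : nat) : 'rV[R]_n := \row_(j < n) (if (j < k)%N then b 0 j else a 0 j).

Lemma hybrid0 a b : hybrid a b 0 = a.
Proof. by apply/rowP => j; rewrite mxE. Qed.

Lemma hybridn a b : hybrid a b n = b.
Proof. by apply/rowP => j; rewrite mxE ltn_ord. Qed.

Lemma hybridS a b (k : 'I_n) : hybrid a b k.+1 = hybrid a b k + (b 0 k - a 0 k) *: ebase k.
Proof.
apply/rowP => j; rewrite !mxE eqxx ltnS leq_eqVlt /=.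
have [->|nk] := eqVneq j k; first by rewrite eqxx ltnn mulr1 addrC subrK.
by rewrite -val_eqE in nk; rewrite (negbTE nk) mulr0 addr0.
Qed.

Lemma hybrid_close a b x0 (d : R) k : `|a - x0| < d -> `|b - x0| < d -> `|hybrid a b k - x0| < d.
Proof.
move=> ad bd; have d0 : 0 < d by exact: le_lt_trans ad.
pose m := Num.max `|a - x0| `|b - x0|.
apply: (@le_lt_trans _ _ m); last by rewrite gt_max ad bd.
apply: norm_rV_le => [|j]; first by rewrite le_max normr_ge0.
rewrite !mxE le_max; case: ifP => _; apply/orP; [right|left].
  by have := norm_coord (b - x0) j; rewrite !mxE.
by have := norm_coord (a - x0) j; rewrite !mxE.
Qed.

(** The mean value theorem is applied to each step of the telescoping sum over the
    interpolations of a and b. As both a and b vary, the estimate yields differentiability at x0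
    as well as a Lipschitz bound near x0. *)
Lemma C1_strict_diff (A : set 'rV[R]_n) f x0 : open A -> A x0 ->
  (forall j x, A x -> derivable f x (ebase j)) -> (forall j, {for x0, continuous (partial j f)}) ->
  forall e : R, 0 < e -> exists2 d : R, 0 < d & forall a b, `|a - x0| < d -> `|b - x0| < d ->
    `|f b - f a - \sum_j (b 0 j - a 0 j) * partial j f x0| <= e * (\sum_j (`|b 0 j - a 0 j| : R)).
Proof.
move=> oA Ax0 df cf e e0.
have : \forall x \near x0, A x /\ forall j, `|partial j f x0 - partial j f x| <= e.
  near=> x; split; first by near: x; exact: open_nbhs_nbhs.
  move=> j; move: j; near: x; apply: filter_forall => j.
  exact: ((cvgrPdist_le _ _).1 (cf j)).
move=> /nbhs_ballP[d0 /= d0_gt0 Hd0]; exists (d0 / 3) => [|a b ax bx]; first by rewrite divr_gt0.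
have -> : f b - f a = \sum_(k < n) (f (hybrid a b k.+1) - f (hybrid a b k)).
  rewrite -(big_mkord xpredT (fun k => f (hybrid a b k.+1) - f (hybrid a b k))).
  by rewrite telescope_sumr // hybrid0 hybridn.
rewrite -sumrB mulr_sumr; apply: le_trans (ler_norm_sum _ _ _) _; apply: ler_sum => k _.
rewrite hybridS; set h := b 0 k - a 0 k; set z := hybrid a b k.
have hd : `|h| < d0 / 3 + d0 / 3.
  have -> : h = (b - x0) 0 k - (a - x0) 0 k by rewrite !mxE opprB addrA subrK.
  apply: le_lt_trans (ler_normB _ _) _; apply: ltrD.
  - exact: le_lt_trans (norm_coord _ _) bx.
  - exact: le_lt_trans (norm_coord _ _) ax.
have near_z (t : R) : `|t| <= `|h| -> ball x0 d0 (z + t *: ebase k).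
  move=> th; rewrite -ball_normE /= distrC addrAC; apply: le_lt_trans (ler_normD _ _) _.
  have := hybrid_close k ax bx; rewrite -/z.
  have : `|t *: ebase k : 'rV[R]_n| <= `|h|.
    rewrite normrZ; apply: le_trans th; rewrite ler_piMr //; exact: norm_delta_mx.
  by move: hd; move: `|h| `|z - x0| `|_| => *; lra.
have [|t th ->] := @MVT_line f z (ebase k) h.
  by move=> t /near_z/Hd0[At _]; exact: df.
rewrite -mulrBr normrM mulrC; apply: ler_wpM2r => //.
by rewrite distrC; have [_] := Hd0 _ (near_z _ th); exact.
Unshelve. all: by end_near. Qed.

End PartialDerivatives.

Lemma cvg_sum_seq (R : realType) (T : Type) (F : set_system T) (I : Type) (r : seq I)
    (f : I -> T -> R) (l : I -> R) : Filter F -> (forall i, f i @ F --> l i) ->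
  (fun x => \sum_(i <- r) f i x) @ F --> \sum_(i <- r) l i.
Proof.
move=> FF fl; elim: r => [|i r IHr].
  rewrite big_nil (_ : (fun _ => _) = cst 0); first exact: cvg_cst.
  by apply/funext => x; rewrite big_nil.
rewrite big_cons (_ : (fun _ => _) = (f i \+ fun x => \sum_(i <- r) f i x)).
  exact: cvgD.
by apply/funext => x; rewrite big_cons.
Qed.

Lemma is_derive_cvg (R : realType) (V W : normedModType R) (f : V -> W) a v l :
  (fun h => h^-1 *: ((f \o shift a) (h *: v) - f a)) @ 0^' --> l <-> is_derive a v f l.
Proof.
split=> [fl|[df <-]]; last exact: df.
by split; [apply/cvg_ex; exists l|exact: cvg_lim].
Qed.

Section C1Functions.
Variables (R : realType) (n : nat).
Implicit Types (f g : 'rV[R]_n -> R) (x v : 'rV[R]_n) (A : set 'rV[R]_n).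

Lemma is_derive_lineP f x v (l : R) :
  is_derive x v f l <-> is_derive (0 : R) 1 (fun h => f (h *: v + x)) l.
Proof.
rewrite -!is_derive_cvg; set F := fun h => _; set G := fun h => _.
suff -> : F = G by [].
by apply/funext => h; rewrite /F /G /= addr0 scale0r add0r [_%:A]mulr1.
Qed.

Lemma is_derive_coord (c : R -> 'rV[R]_n) (t : R) v :
  is_derive t 1 c v <-> forall j, is_derive t 1 (fun s => c s 0 j) (v 0 j).
Proof.
split=> [[dc <-] j|dc].
  split; first by move/derivable_mxP: dc; exact.
  by rewrite derive_mx // mxE.
have dc' : derivable c t 1 by apply/derivable_mxP => i j; rewrite (ord1 i); case: (dc j).
split=> //; apply/rowP => j; rewrite derive_mx // mxE; case: (dc j) => _ <-.
by [].
Qed.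

(** Differentiation along the axes takes place throughout A, for the mean value theorem, while
    the estimates only compare the partial derivatives with their values at x. *)
Definition C1_at A f x : Prop := [/\ open A, A x,
  forall j y, A y -> derivable f y (ebase j) & forall j, {for x, continuous (partial j f)}].

(** After division by h, the remainder in the strict estimate is at most a small multiple of the
    difference quotients of the coordinates of c, which stay bounded. *)
Lemma is_derive_comp_C1 A f (c : R -> 'rV[R]_n) (t : R) v : C1_at A f (c t) ->
  is_derive t 1 c v -> is_derive t 1 (fun s => f (c s)) (\sum_j v 0 j * partial j f (c t)).
Proof.
move=> [oA Ac df cf] /[dup] dc /is_derive_coord dcj.
have cvgj j : (fun h : R => h^-1 * (c (h *: 1 + t) 0 j - c t 0 j)) @ 0^' --> v 0 j.
  exact: (is_derive_cvg _ _ _ _).2 (dcj j).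
have ct : c (h *: 1 + t) @[h --> 0^'] --> c t.
  have cct : {for t, continuous c}.
    by apply: differentiable_continuous; apply/derivable1_diffP; case: dc.
  have -> : c t = c ((0 : R) *: 1 + t) by rewrite scale0r add0r.
  apply/(continuous_withinNx (fun h : R => c (h *: 1 + t)) 0).
  apply: (@continuous_comp _ _ _ (fun h : R => h *: 1 + t) c); last by rewrite /= scale0r add0r.
  by apply: continuousD; [exact: scalel_continuous|exact: cst_continuous].
apply/is_derive_cvg; apply/cvgrPdist_le => /= e e0.
(* A bound, near t, for the sum of the difference quotients of the coordinates of c. *)
pose K : R := \sum_j (`|v 0 j| + 1).
have K0 : 0 <= K by apply: sumr_ge0 => j _; rewrite addr_ge0.
have eK : 0 < e / 2 / (K + 1) by rewrite !divr_gt0 // ltr_wpDl.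
have [d d0 Hd] := C1_strict_diff oA Ac df cf eK.
have cvgS : (fun h : R => \sum_j (h^-1 * (c (h *: 1 + t) 0 j - c t 0 j)) * partial j f (c t)) @ 0^'
     --> \sum_j v 0 j * partial j f (c t).
  apply: cvg_sum_seq => j; apply: cvgM; [exact: cvgj|exact: cvg_cst].
near=> h.
have h0 : h != 0 by near: h; exact: nbhs_dnbhs_neq.
have cd : `|c (h *: 1 + t) - c t| < d.
  by rewrite distrC; near: h; exact: ((cvgrPdist_lt _ _).1 ct).
have Dv j : `|v 0 j - h^-1 * (c (h *: 1 + t) 0 j - c t 0 j)| <= 1.
  by move: j; near: h; apply: filter_forall => j; exact: ((cvgrPdist_le _ _).1 (cvgj j) _ ltr01).
have Sv : `|\sum_j v 0 j * partial j f (c t)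
    - \sum_j (h^-1 * (c (h *: 1 + t) 0 j - c t 0 j)) * partial j f (c t)| <= e / 2.
  by near: h; exact: ((cvgrPdist_le _ _).1 cvgS _ (divr_gt0 e0 (ltr0Sn _ 1))).
pose D (j : 'I_n) := h^-1 * (c (h *: 1 + t) 0 j - c t 0 j).
have DK : (\sum_j (`|D j| : R) : R) <= K.
  apply: ler_sum => j _.
  have -> : D j = v 0 j - (v 0 j - D j) by rewrite opprB addrC subrK.
  apply: le_trans (ler_normB _ _) _; apply: lerD => //; exact: Dv.
have key := Hd (c t) (c (h *: 1 + t)).
rewrite subrr normr0 in key; have {key} := key d0 cd.
set S := \sum_j _ => key.
set T := \sum_j _ in key.
have T0 : 0 <= T by apply: sumr_ge0.
have hT : (`|h^-1| : R) * T = (\sum_j (`|D j| : R) : R).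
  by rewrite mulr_sumr; apply: eq_bigr => j _; rewrite normrM.
have hS : h^-1 * S = \sum_j D j * partial j f (c t).
  by rewrite mulr_sumr; apply: eq_bigr => j _; rewrite mulrA.
apply: le_trans (ler_distD (h^-1 * S) _ _) _; rewrite (splitr e); apply: lerD.
  by rewrite hS; exact: Sv.
rewrite -[h^-1 *: _]/(h^-1 * _) -mulrBr normrM distrC.
apply: le_trans (ler_wpM2l (normr_ge0 _) key) _.
rewrite mulrCA hT; move: (e / 2) (divr_gt0 e0 (ltr0Sn _ 1)) => e' e'0; rewrite -mulrA -[leRHS]mulr1.
apply: ler_wpM2l; first by rewrite ltW.
rewrite ler_pdivrMl ?ltr_wpDl // mulr1.
by apply: le_trans DK _; rewrite lerDl.
Unshelve. all: by end_near. Qed.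

Lemma is_derive_C1 A f x v : C1_at A f x -> is_derive x v f (\sum_j v 0 j * partial j f x).
Proof.
move=> fC1; apply/is_derive_lineP.
have := @is_derive_comp_C1 A f (fun h : R => h *: v + x) 0 v.
rewrite scale0r add0r => /(_ fC1); apply.
apply/is_derive_coord => j.
have -> : (fun s : R => (s *: v + x) 0 j) = (fun s => v 0 j * s + x 0 j).
  by apply/funext => s; rewrite !mxE mulrC.
apply: is_derive_eq; rewrite addr0; exact: mulr1.
Qed.

Lemma Lipschitz_C1 A f x : C1_at A f x ->
  exists L d : R, [/\ 0 < L, 0 < d & forall a b, `|a - x| < d -> `|b - x| < d ->
    `|f b - f a| <= L * `|b - a|].
Proof.
move=> [oA Ax df cf]; have [d d0 Hd] := C1_strict_diff oA Ax df cf (@ltr01 R).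
exists (1 + \sum_(j < n) (1 + `|partial j f x|)), d.
have sum0 : 0 <= \sum_(j < n) (1 + `|partial j f x|).
  by apply: sumr_ge0 => j _; rewrite addr_ge0.
split=> // [|a b ad bd]; first by rewrite ltr_pwDl.
have := Hd a b ad bd; rewrite mul1r; set S := \sum_j _ => key.
have -> : f b - f a = (f b - f a - S) + S by rewrite subrK.
apply: le_trans (ler_normD _ _) _; apply: le_trans (lerD key (ler_norm_sum _ _ _)) _.
rewrite -big_split mulrDl mul1r /= ler_wpDl // mulr_suml; apply: ler_sum => j _.
rewrite normrM -[X in X + _]mulr1 -mulrDr mulrC ler_wpM2l ?addr_ge0 //.
by have := norm_coord (b - a) j; rewrite !mxE.
Qed.

(** The mean value theorem is applied to a difference in the direction j, moved along the
    direction i, and then to the resulting difference of partial derivatives. The left-hand side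
    is symmetric in i and j. *)
Lemma second_difference A f x (i j : 'I_n) (h d : R) : 0 < h -> h + h < d ->
  (forall y, `|y - x| < d -> A y) ->
  (forall y, A y -> derivable f y (ebase i)) ->
  (forall y, A y -> derivable (partial i f) y (ebase j)) ->
  exists2 y, `|y - x| < d &
    f (x + h *: ebase i + h *: ebase j) - f (x + h *: ebase i)
    - (f (x + h *: ebase j) - f x) = h * (h * partial j (partial i f) y).
Proof.
move=> h0 hd xA df ddf.
have near_x (s t : R) : `|s| <= `|h| -> `|t| <= `|h| ->
    `|x + s *: (ebase i : 'rV[R]_n) + t *: ebase j - x| < d.
  rewrite (gtr0_norm h0) => sh th.
  rewrite addrAC [x + _]addrC addrK; apply: le_lt_trans (ler_normD _ _) _.
  apply: le_lt_trans hd; apply: lerD; rewrite normrZ.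
    by apply: le_trans sh; rewrite ler_piMr // norm_delta_mx.
  by apply: le_trans th; rewrite ler_piMr // norm_delta_mx.
pose g y := f (y + h *: ebase j) - f y.
have dfh y : derivable f (y + h *: ebase j) (ebase i) ->
    is_derive y (ebase i) (fun y => f (y + h *: ebase j)) (partial i f (y + h *: ebase j)).
  move=> /derivableP/is_derive_lineP H; apply/is_derive_lineP.
  by under eq_fun => s do rewrite -addrA.
have [|t th] := @MVT_line R n g x (ebase i) h.
  move=> t th; apply: derivableB; last first.
    by apply/df/xA; rewrite -[x + _]addr0 -(scale0r (ebase j)); apply: near_x; rewrite ?normr0.
  by have [] := dfh _ (df _ (xA _ (near_x _ _ th (lexx _)))).
rewrite {1 2}/g => ->.
have [|s sh] := @MVT_line R n (partial i f) (x + t *: ebase i) (ebase j) h.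
  by move=> s sh; apply/ddf/xA/near_x.
move=> E; exists (x + t *: ebase i + s *: ebase j); first exact: near_x.
rewrite -E; congr (h * _).
have dft : derivable f (x + t *: ebase i) (ebase i).
  by apply/df/xA; rewrite -[x + _]addr0 -(scale0r (ebase j)); apply: near_x; rewrite ?normr0.
have [d1 e1] := dfh _ (df _ (xA _ (near_x _ _ th (lexx _)))).
by rewrite /partial (deriveB d1 dft) e1.
Qed.

(** Divided by h ^+ 2, one and the same second difference is a value of either mixed derivative,
    at two points that both tend to x with h. *)
Lemma partialC A f x (i j : 'I_n) : open A -> A x ->
  (forall k y, A y -> derivable f y (ebase k)) ->
  (forall k l y, A y -> derivable (partial k f) y (ebase l)) ->
  (forall k l, {for x, continuous (partial l (partial k f))}) ->
  partial j (partial i f) x = partial i (partial j f) x.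
Proof.
move=> oA Ax df ddf cf; apply/eqP; rewrite -subr_eq0 -normr_le0.
apply/ler_addgt0Pr => e e0; rewrite add0r.
have : \forall y \near x, [/\ A y,
    `|partial j (partial i f) x - partial j (partial i f) y| <= e / 2 &
    `|partial i (partial j f) x - partial i (partial j f) y| <= e / 2].
  have e2 : 0 < e / 2 by rewrite divr_gt0.
  have near_cont k l : \forall y \near x,
      `|partial l (partial k f) x - partial l (partial k f) y| <= e / 2.
    exact: ((cvgrPdist_le _ _).1 (cf k l) _ e2).
  have near_A : \forall y \near x, A y by exact: open_nbhs_nbhs.
  apply: filterS (filterI near_A (filterI (near_cont i j) (near_cont j i))).
  by move=> y [Ay [le_ij le_ji]]; split; [exact: Ay|exact: le_ij|exact: le_ji].
move=> /nbhs_ballP[d /= d0 Hd].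
have {}Hd y : `|y - x| < d -> [/\ A y,
    `|partial j (partial i f) x - partial j (partial i f) y| <= e / 2 &
    `|partial i (partial j f) x - partial i (partial j f) y| <= e / 2].
  by move=> yx; apply: Hd; rewrite -ball_normE /= distrC.
(* With this h all corners of the second differences lie within d of x. *)
pose h := d / 3; have h0 : 0 < h by rewrite divr_gt0.
have hd : h + h < d by rewrite /h; lra.
have xA y : `|y - x| < d -> A y by move=> /Hd[].
have [y1 /Hd[_ + _]] := second_difference h0 hd xA (df i) (ddf i j).
have [y2 /Hd[_ _ +]] := second_difference h0 hd xA (df j) (ddf j i).
rewrite [x + h *: ebase j + _]addrAC.
generalize (partial j (partial i f) y1) (partial i (partial j f) y2) => p1 p2.
generalize (partial j (partial i f) x) (partial i (partial j f) x) => q1 q2.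
generalize (f (x + h *: ebase i + h *: ebase j)) (f (x + h *: ebase i)).
generalize (f (x + h *: ebase j)) (f x) => f1 f2 f3 f4 le2 E2 le1 E1.
have E : p1 = p2.
  apply: (mulfI (lt0r_neq0 h0)); apply: (mulfI (lt0r_neq0 h0)).
  by rewrite -E1 -E2; ring.
rewrite E in le1; apply: le_trans (ler_distD p2 _ _) _; rewrite (splitr e).
by apply: lerD => //; rewrite distrC.
Qed.

End C1Functions.

(** * Functions of class C^k *)

Section CkClosure.
Variables (R : realType) (n : nat).
Implicit Types (f g : 'rV[R]_n -> R) (A B : set 'rV[R]_n).

Lemma CkS k A f : Ck k.+1 A f -> Ck k A f.
Proof.
elim: k f => [|k IHk] f /= [cf df]; split=> // j.
by have [dfj Cf] := df j; split=> //; exact: IHk.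
Qed.

Lemma Ck_sub k A B f : B `<=` A -> Ck k A f -> Ck k B f.
Proof.
move=> BA; elim: k f => [|k IHk] f /= [cf df]; (split; first by move=> x /BA/cf) => // j.
by have [dfj Cf] := df j; split=> [x /BA/dfj|] //; exact: IHk.
Qed.

Lemma Ck_eq k A f g : open A -> {in A, f =1 g} -> Ck k A f -> Ck k A g.
Proof.
move=> oA.
have nearA f' g' x : {in A, f' =1 g'} -> A x -> {near x, f' =1 g'}.
  move=> fg Ax; have := open_nbhs_nbhs (conj oA Ax); apply: filterS => y Ay.
  by apply: fg; rewrite inE.
have contA f' g' x : {in A, f' =1 g'} -> A x -> {for x, continuous f'} ->
    {for x, continuous g'}.
  move=> fg Ax; rewrite /prop_for /continuous_at -(fg x) ?inE //.
  by move=> cf; apply: cvg_trans cf; exact: (near_eq_cvg (nearA _ _ _ fg Ax)).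
elim: k f g => [|k IHk] f g fg /= [cf df].
  by split=> // x Ax; exact: contA (cf x Ax).
split=> [x Ax|j]; first exact: contA (cf x Ax).
have [dfj Cf] := df j; split=> [x Ax|].
  by apply: near_eq_derivable (dfj x Ax); exact: nearA.
by apply: IHk Cf => x; rewrite inE => Ax; apply: near_eq_derive; exact: nearA.
Qed.

Lemma Ck_cst k A (c : R) : Ck k A (cst c).
Proof.
elim: k c => [|k IHk] c /=; (split; first by move=> x _; exact: cst_continuous) => // j.
split=> [x _|]; first exact: derivable_cst.
by under eq_fun => x do rewrite derive_cst; exact: IHk.
Qed.

Lemma CkD k A f g : open A -> Ck k A f -> Ck k A g -> Ck k A (f \+ g).
Proof.
move=> oA; elim: k f g => [|k IHk] f g /= [cf df] [cg dg];
  (split; first by move=> x Ax; apply: continuousD; [exact: cf|exact: cg]) => // j.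
have [[dfj Cf] [dgj Cg]] := (df j, dg j).
split=> [x Ax|]; first by apply: derivableD; [exact: dfj|exact: dgj].
apply: Ck_eq (IHk _ _ Cf Cg) => // x; rewrite inE => Ax /=.
by rewrite deriveD //; [exact: dfj|exact: dgj].
Qed.

Lemma CkM k A f g : open A -> Ck k A f -> Ck k A g -> Ck k A (f \* g).
Proof.
move=> oA; elim: k f g => [|k IHk] f g Cf Cg.
  by split=> // x Ax; apply: continuousM; [exact: Cf.1|exact: Cg.1].
move: (Cf) (Cg) => /= [cf df] [cg dg]; split=> [x Ax|j].
  by apply: continuousM; [exact: cf|exact: cg].
have [[dfj Cfj] [dgj Cgj]] := (df j, dg j).
split=> [x Ax|]; first by apply: derivableM; [exact: dfj|exact: dgj].
apply: (@Ck_eq _ _ (f \* (fun x => 'D_(ebase j) g x) \+ g \* (fun x => 'D_(ebase j) f x))) => //.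
  by move=> x; rewrite inE => Ax /=; rewrite deriveM //; [exact: dfj|exact: dgj].
by apply: CkD => //; apply: IHk => //; exact: CkS.
Qed.

Lemma smooth_euclid_sub A B f : B `<=` A -> smooth_euclid A f -> smooth_euclid B f.
Proof. by move=> BA sf k; exact: Ck_sub (sf k). Qed.

Lemma smooth_euclid_eq A f g : open A -> {in A, f =1 g} -> smooth_euclid A f ->
  smooth_euclid A g.
Proof. by move=> oA fg sf k; exact: Ck_eq (sf k). Qed.

Lemma smooth_euclid_cst A (c : R) : smooth_euclid A (cst c).
Proof. by move=> k; exact: Ck_cst. Qed.

Lemma smooth_euclidD A f g : open A -> smooth_euclid A f -> smooth_euclid A g ->
  smooth_euclid A (f \+ g).
Proof. by move=> oA sf sg k; exact: CkD. Qed.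

Lemma smooth_euclidM A f g : open A -> smooth_euclid A f -> smooth_euclid A g ->
  smooth_euclid A (f \* g).
Proof. by move=> oA sf sg k; exact: CkM. Qed.

Lemma smooth_euclid_sum (I : Type) (r : seq I) A (F : I -> 'rV[R]_n -> R) : open A ->
  (forall i, smooth_euclid A (F i)) -> smooth_euclid A (fun x => \sum_(i <- r) F i x).
Proof.
move=> oA sF; elim: r => [|i r IHr].
  by under eq_fun do rewrite big_nil; exact: smooth_euclid_cst.
by under eq_fun do rewrite big_cons; exact: smooth_euclidD.
Qed.

Lemma smooth_partial A f j : smooth_euclid A f -> smooth_euclid A (partial j f).
Proof. by move=> sf k; have [_ /(_ j)[]] := sf k.+1. Qed.

Lemma smooth_derivable A f j x : smooth_euclid A f -> A x -> derivable f x (ebase j).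
Proof. by move=> sf Ax; have [_ /(_ j)[df _]] := sf 1%N; exact: df. Qed.

Lemma smooth_continuous A f x : smooth_euclid A f -> A x -> {for x, continuous f}.
Proof. by move=> sf Ax; have [cf _] := sf 0%N; exact: cf. Qed.

Lemma smooth_C1 A f x : open A -> A x -> smooth_euclid A f -> C1_at A f x.
Proof.
move=> oA Ax sf; split=> // j; first by move=> y; exact: smooth_derivable.
by apply: (smooth_continuous (A := A)) => //; exact: smooth_partial.
Qed.

Lemma smooth_partialC A f x i j : open A -> A x -> smooth_euclid A f ->
  partial j (partial i f) x = partial i (partial j f) x.
Proof.
move=> oA Ax sf; apply: (partialC (A := A)) => // [k y|k l y|k l].
- exact: smooth_derivable.
- by apply: smooth_derivable; exact: smooth_partial.
- by apply: (smooth_continuous (A := A)) => //; do 2!apply: smooth_partial.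
Qed.

End CkClosure.

(** * Local solutions of differential equations *)

Section Antiderivative.
Variable R : realType.

(** The integral starts at - (a + 1), so that the closed interval from - a to a consists of
    interior points of the domain of integration. *)
Lemma antiderivative_exists (g : R -> R) (a : R) : continuous g ->
  exists2 H : R -> R, H 0 = 0 & forall t : R, `|t| <= a -> is_derive t 1 H (g t).
Proof.
move=> cg; pose mu := @lebesgue_measure R.
pose H t := (\int[mu]_(s in `[- (a + 1), t]) g s)%R.
exists (fun t => H t - H 0) => [|t]; first by rewrite subrr.
rewrite ler_norml => /andP[at_ ta].
have gi : mu.-integrable `[- (a + 1), a + 1] (EFin \o g).
  apply: continuous_compact_integrable; first exact: segment_compact.
  exact: continuous_subspaceT.
have [||dH eH] := continuous_FTC1_closed (x := t) _ gi _ (cg t).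
- by rewrite (le_lt_trans ta) // ltrDl.
- by rewrite (lt_le_trans _ at_) // ltrN2 ltrDl.
have dHt : is_derive t 1 H (g t) by split; [exact: dH|rewrite -derive1E; exact: eH].
by rewrite -[g t]subr0; exact: is_deriveB.
Qed.

Lemma MVT_between (h dh : R -> R) (e s t : R) : `|s| <= e -> `|t| <= e ->
  (forall u : R, `|u| <= e -> is_derive u 1 h (dh u)) ->
  exists u, [/\ `|u| <= e, `|u - s| <= `|t - s| & h t - h s = dh u * (t - s)].
Proof.
move=> se te dhu.
have itv_e (a b u : R) : `|a| <= e -> `|b| <= e -> a <= u <= b -> `|u| <= e.
  rewrite !ler_norml => /andP[? _] /andP[_ ?] /andP[? ?].
  by apply/andP; split; [exact: (@le_trans _ _ a)|exact: (@le_trans _ _ b)].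
have cont (a b : R) : `|a| <= e -> `|b| <= e -> {within `[a, b], continuous h}.
  move=> ae be; apply: derivable_within_continuous => u; rewrite in_itv /= => uab.
  by have [] := dhu u (itv_e _ _ _ ae be uab).
have deriv (a b u : R) : `|a| <= e -> `|b| <= e -> u \in `]a, b[ -> is_derive u 1 h (dh u).
  move=> ae be; rewrite in_itv /= => /andP[/ltW au /ltW ub].
  by apply/dhu/(itv_e a b) => //; rewrite au.
have [st|ts] := leP s t.
  have [u|u|u] := @MVT_segment R h dh s t st; [exact: deriv|exact: cont|].
  rewrite in_itv /= => /[dup] uab /andP[su ut] E; exists u; split=> //.
    exact: itv_e uab.
  by rewrite !ger0_norm ?subr_ge0 // lerB.
have [u|u|u] := @MVT_segment R h dh t s (ltW ts); [exact: deriv|exact: cont|].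
rewrite in_itv /= => /[dup] uab /andP[tu us] E; exists u; split=> //.
- exact: itv_e uab.
- by rewrite !ler0_norm ?subr_le0 ?lerN2 ?lerB // ltW.
- by rewrite -opprB E -mulrN opprB.
Qed.

(** Unlike differentiability, a quadratic bound on the remainder passes to pointwise limits;
    this is how the limit of the Picard iterates is differentiated. *)
Lemma is_derive_quadratic (h : R -> R) (s l C e : R) : 0 < e -> 0 <= C ->
  (forall t, `|t - s| < e -> `|h t - h s - (t - s) * l| <= C * `|t - s| ^+ 2) ->
  is_derive s 1 h l.
Proof.
move=> e0 C0 hq; apply/is_derive_cvg; apply/cvgrPdist_le => d d0.
near=> u.
have u0 : u != 0 by near: u; exact: nbhs_dnbhs_neq.
have ue : `|u| < e by near: u; exact: dnbhs0_lt.
have ud : `|u| <= d / (C + 1) by near: u; apply: dnbhs0_le; rewrite divr_gt0 // ltr_wpDl.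
have := hq (u + s); rewrite addrK => /(_ ue) {}hq.
rewrite /= [u *: 1]mulr1 -[_ *: _]/(u^-1 * _) distrC.
have -> : u^-1 * (h (u + s) - h s) - l = u^-1 * (h (u + s) - h s - u * l).
  by rewrite [RHS]mulrBr mulKf.
rewrite normrM normfV ler_pdivrMl ?normr_gt0 //; apply: (le_trans hq).
rewrite expr2 mulrCA; apply: ler_wpM2l => //.
apply: (@le_trans _ _ ((C + 1) * `|u|)); first by rewrite ler_wpM2r // lerDl.
by rewrite mulrC -ler_pdivlMr // ltr_wpDl.
Unshelve. all: by end_near. Qed.

Lemma lipschitz_continuous (T : normedModType R) (g : R -> T) (C : R) :
  (forall s t, `|g t - g s| <= C * `|t - s|) -> continuous g.
Proof.
move=> gC s; apply/cvgrPdist_le => /= d d0.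
have C0 : 0 <= C by have := gC 0 1; rewrite subr0 normr1 mulr1; apply: le_trans.
near=> u; rewrite distrC; apply: le_trans (gC s u) _.
have : `|s - u| <= d / (C + 1).
  near: u; apply: (@cvgr_dist_le _ _ _ (nbhs s) _ id s cvg_id).
  by rewrite divr_gt0 // ltr_wpDl.
rewrite distrC => us; apply: (@le_trans _ _ ((C + 1) * `|u - s|)).
  by rewrite ler_wpM2r // lerDl.
by rewrite mulrC -ler_pdivlMr // ltr_wpDl.
Unshelve. all: by end_near. Qed.

End Antiderivative.

Section LocalExistence.
Variables (R : realType) (n : nat).

Lemma cvg_coord (T : Type) (H : set_system T) (f : T -> 'rV[R]_n) (l : 'rV[R]_n) : Filter H ->
  (forall j, (fun t => f t 0 j) @ H --> l 0 j) -> f @ H --> l.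
Proof.
move=> FH fl; apply/cvgrPdist_le => e e0; near=> t.
apply: norm_rV_le; first exact: ltW.
move=> j; rewrite !mxE; move: j; near: t; apply: filter_forall => j.
exact: ((cvgrPdist_le _ _).1 (fl j) _ e0).
Unshelve. all: by end_near. Qed.

Lemma cvg_geometric_telescope (u : nat -> R) (D : R) :
  (forall k, `|u k.+1 - u k| <= D * 2^-1 ^+ k) -> cvgn u.
Proof.
move=> uD; have -> : u = cst (u 0%N) \+ series (telescope u).
  by apply/funext => k; exact: eq_sum_telescope.
apply: is_cvgD; first exact: is_cvg_cst.
apply: normed_cvg; apply: (@series_le_cvg R _ (geometric D 2^-1)).
- by move=> k; exact: normr_ge0.
- by move=> k; exact: le_trans (uD k).
- exact: uD.
- by apply: is_cvg_geometric_series; rewrite ger0_norm ?invr_ge0 // invf_lt1 ?ltr1n.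
Qed.

Variables (F : 'rV[R]_n -> 'rV[R]_n) (x0 : 'rV[R]_n) (L r : R).
Hypotheses (L_ge0 : 0 <= L) (r_gt0 : 0 < r).
Hypothesis FL : forall a b, `|a - x0| <= r -> `|b - x0| <= r -> `|F b - F a| <= L * `|b - a|.

(** B bounds F on the ball of radius r, and e is short enough both for the iterates to remain in
    the ball (eB) and for the Picard operator to halve the distances (eL). *)
Let B := `|F x0| + L * r.
Let e := (1 + 2 * L + B / r)^-1.

Let B_ge0 : 0 <= B. Proof. by rewrite addr_ge0 // mulr_ge0 // ltW. Qed.

Let den_gt0 : 0 < 1 + 2 * L + B / r.
Proof. by rewrite -addrA ltr_pwDl // addr_ge0 ?mulr_ge0 // invr_ge0 ltW. Qed.

Let e_gt0 : 0 < e. Proof. by rewrite invr_gt0. Qed.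

Let eL : e * (2 * L) <= 1.
Proof.
rewrite mulrC ler_pdivrMr // mul1r addrAC lerDr addr_ge0 // divr_ge0 //; exact: ltW.
Qed.

Let eB : B * e <= r.
Proof.
rewrite ler_pdivrMr // mulrDr mulrCA divff ?gt_eqF // mulr1 lerDr.
by rewrite mulr_ge0 ?addr_ge0 ?mulr_ge0 // ltW.
Qed.

(** Time is clamped so that the integrands are defined and continuous on the whole line. *)
Let clamp (t : R) := Num.max (- e) (Num.min e t).

Let clamp_id t : `|t| <= e -> clamp t = t.
Proof. by rewrite ler_norml => /andP[et te]; rewrite /clamp min_r // max_r. Qed.

Let clamp_le t : `|clamp t| <= e.
Proof.
rewrite ler_norml /clamp le_max lexx /= ge_max ge_min lexx /= andbT.
by rewrite (le_trans _ (ltW e_gt0)) // oppr_le0 ltW.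
Qed.

Let clamp_lip s t : `|clamp t - clamp s| <= `|t - s|.
Proof.
have := e_gt0; rewrite /clamp.
have absE (z : R) : `|z| = Num.max z (- z) by rewrite maxrN.
rewrite !absE !maxEge !minEge.
by do ! case: ifP; lra.
Qed.

Let admissible (y : R -> 'rV[R]_n) := (forall t, `|t| <= e -> `|y t - x0| <= r) /\
  forall s t, `|s| <= e -> `|t| <= e -> `|y t - y s| <= B * `|t - s|.

Let F_bound a : `|a - x0| <= r -> `|F a| <= B.
Proof.
move=> ar; have -> : F a = F x0 + (F a - F x0) by rewrite addrC subrK.
apply: le_trans (ler_normD _ _) _; rewrite lerD2l.
apply: le_trans (FL _ ar) _; first by rewrite subrr normr0 ltW.
by rewrite ler_wpM2l.
Qed.

(** The integrand is F along the clamped curve, which is Lipschitz on the whole line. *)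
Let picard_step y : admissible y -> exists z : R -> 'rV[R]_n, [/\ admissible z, z 0 = x0 &
  forall j (t : R), `|t| <= e -> is_derive t 1 (fun t => z t 0 j) (F (y t) 0 j)].
Proof.
move=> [yr yB].
have cg j : continuous (fun t => F (y (clamp t)) 0 j).
  apply: (@lipschitz_continuous _ _ _ (L * B)) => s t.
  apply: (@le_trans _ _ `|F (y (clamp t)) - F (y (clamp s))|).
    by have := norm_coord (F (y (clamp t)) - F (y (clamp s))) j; rewrite !mxE.
  apply: le_trans (FL (yr _ (clamp_le _)) (yr _ (clamp_le _))) _.
  rewrite -mulrA ler_wpM2l //; apply: le_trans (yB _ _ (clamp_le _) (clamp_le _)) _.
  by rewrite ler_wpM2l.
have Hex j := @antiderivative_exists R _ e (cg j).
pose H j := s2val (cid2 (Hex j)).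
have H0 j : H j 0 = 0 by exact: (s2valP (cid2 (Hex j))).
have dH j (t : R) : `|t| <= e -> is_derive t 1 (H j) (F (y (clamp t)) 0 j).
  exact: (s2valP' (cid2 (Hex j))).
pose z t := x0 + \row_j H j t.
have zE t j : z t 0 j = x0 0 j + H j t by rewrite !mxE.
have z0 : z 0 = x0 by apply/rowP => j; rewrite zE H0 addr0.
have dz j (t : R) : `|t| <= e -> is_derive t 1 (fun t => z t 0 j) (F (y t) 0 j).
  move=> te; under eq_fun do rewrite zE.
  rewrite -[F _ _ _]add0r -{2}(clamp_id te).
  by apply: is_deriveD; exact: dH.
have zB s t : `|s| <= e -> `|t| <= e -> `|z t - z s| <= B * `|t - s|.
  move=> se te; apply: norm_rV_le => [|j]; first by rewrite mulr_ge0.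
  have [u [ue _ E]] := MVT_between se te (dz j).
  have -> : (z t - z s) 0 j = z t 0 j - z s 0 j by rewrite !mxE.
  rewrite E normrM ler_wpM2r //.
  by apply: le_trans (norm_coord _ _) _; apply/F_bound/yr.
exists z; split=> //; split=> // t te.
rewrite -{1}z0; apply: le_trans (zB _ _ _ te) _; first by rewrite normr0 ltW.
by rewrite subr0; apply: le_trans eB; rewrite ler_wpM2l.
Qed.

(** The iterates converge geometrically. For s and t in the interval, the (k+1)st iterate has the
    derivative F (X k s) at s up to a remainder of at most L * B * |t - s| ^+ 2, a bound that does
    not depend on k; hence the limit has the derivative F (x s) at s. *)
Lemma picard_local_existence : exists (a : R) (x : R -> 'rV[R]_n), [/\ 0 < a, x 0 = x0 &
  forall t : R, `|t| < a -> `|x t - x0| <= r /\ is_derive t 1 x (F (x t))].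
Proof.
have adm0 : admissible (cst x0).
  by split=> [t _|s t _ _]; rewrite subrr normr0 ?mulr_ge0 // ltW.
pose step (y : {y | admissible y}) : {y | admissible y} :=
  let z := cid (picard_step (svalP y)) in
  exist _ (sval z) (let: And3 adm _ _ := svalP z in adm).
pose X k := sval (iter k step (exist _ _ adm0)).
have X_adm k : admissible (X k) by exact: svalP.
have X_step k : X k.+1 0 = x0 /\
    forall j (t : R), `|t| <= e -> is_derive t 1 (fun t => X k.+1 t 0 j) (F (X k t) 0 j).
  by rewrite /X /=; case: cid => /= z [].
have X0 k : X k 0 = x0 by case: k => [//|k]; exact: (X_step k).1.
have X_contract k t : `|t| <= e -> `|X k.+1 t - X k t| <= r * 2^-1 ^+ k.
  elim: k t => [|k IHk] t te; first by rewrite mulr1; exact: (X_adm 1%N).1.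
  apply: norm_rV_le => [|j]; first by rewrite mulr_ge0 ?exprn_ge0 ?ltW.
  have d (u : R) : `|u| <= e -> is_derive u 1 (fun u => X k.+2 u 0 j - X k.+1 u 0 j)
      (F (X k.+1 u) 0 j - F (X k u) 0 j).
    by move=> ue; apply: is_deriveB; [exact: (X_step k.+1).2|exact: (X_step k).2].
  have e0 : `|0 : R| <= e by rewrite normr0 ltW.
  have [u [ue _]] := MVT_between e0 te d.
  rewrite !X0 subrr !subr0 !mxE => ->; rewrite normrM.
  apply: (@le_trans _ _ (L * (r * 2^-1 ^+ k) * e)); last first.
    rewrite exprS [leRHS]mulrCA; set q := r * 2^-1 ^+ k.
    have q0 : 0 <= q by rewrite mulr_ge0 ?exprn_ge0 ?ltW.
    rewrite ler_pdivlMl //; have := ler_wpM2r q0 eL; rewrite mul1r; apply: le_trans.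
    by rewrite le_eqVlt; apply/orP; left; apply/eqP; ring.
  apply: ler_pM => //; apply: le_trans (_ : `|F (X k.+1 u) - F (X k u)| <= _).
    by have := norm_coord (F (X k.+1 u) - F (X k u)) j; rewrite !mxE.
  apply: le_trans (FL ((X_adm _).1 _ ue) ((X_adm _).1 _ ue)) _.
  by rewrite ler_wpM2l // IHk.
pose x t := \row_j limn (fun k => X k t 0 j).
have cvgX t : `|t| <= e -> X k t @[k --> \oo] --> x t.
  move=> te; apply: cvg_coord => j; rewrite mxE.
  apply: (cvg_geometric_telescope (D := r)) => k; apply: le_trans (X_contract k t te).
  by have := norm_coord (X k.+1 t - X k t) j; rewrite !mxE.
have x_ball t : `|t| <= e -> `|x t - x0| <= r.
  move=> te; apply: (@cvgr_to_le _ \oo _ _ (fun k => `|X k t - x0|)).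
    by apply: cvg_norm; apply: cvgB; [exact: cvgX|exact: cvg_cst].
  by apply: nearW => k; exact: (X_adm k).1.
have cvgFX t : `|t| <= e -> F (X k t) @[k --> \oo] --> F (x t).
  move=> te; apply/cvgrPdist_le => d d0; near=> k.
  rewrite distrC; apply: le_trans (FL (x_ball _ te) ((X_adm k).1 _ te)) _.
  apply: (@le_trans _ _ ((L + 1) * `|X k t - x t|)).
    by rewrite ler_wpM2r // lerDl.
  rewrite mulrC -ler_pdivlMr ?ltr_wpDl // distrC; near: k.
  have dL : 0 < d / (L + 1) by rewrite divr_gt0 // ltr_wpDl.
  exact: ((cvgrPdist_le _ _).1 (cvgX t te) _ dL).
exists e, x; split=> // [|t te].
  by apply/rowP => j; rewrite mxE; under eq_fun do rewrite X0; exact: lim_cst.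
split; first by apply: x_ball; exact: ltW.
apply/is_derive_coord => j.
apply: (@is_derive_quadratic _ _ _ _ (L * B) (e - `|t|)); rewrite ?subr_gt0 ?mulr_ge0 // => s st.
have se : `|s| <= e.
  rewrite -(subrK t s); apply: le_trans (ler_normD _ _) _.
  by rewrite -lerBrDr ltW.
apply: (@cvgr_to_le _ \oo _ _
  (fun k => `|X k.+1 s 0 j - X k.+1 t 0 j - (s - t) * F (X k t) 0 j|)).
  have cvgXj u : `|u| <= e -> X k.+1 u 0 j @[k --> \oo] --> x u 0 j.
    move=> ue.
    apply: (@cvg_comp _ _ _ (fun k => X k.+1 u) (fun M : 'rV[R]_n => M 0 j) _ (nbhs (x u))).
      by rewrite (cvg_shiftS (fun k => X k u)); exact: cvgX.
    exact: coord_continuous.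
  apply: cvg_norm; apply: cvgB; first by apply: cvgB; apply: cvgXj; rewrite // ltW.
  apply: cvgM; first exact: cvg_cst.
  apply: (@cvg_comp _ _ _ (fun k => F (X k t)) (fun M : 'rV[R]_n => M 0 j) _ (nbhs (F (x t)))).
    by apply: cvgFX; exact: ltW.
  exact: coord_continuous.
apply: nearW => k.
have [u [ue ut ->]] := MVT_between (ltW te) se ((X_step k).2 j).
rewrite [_ * (s - t)]mulrC -mulrBr normrM expr2 mulrCA ler_wpM2l //.
apply: le_trans (_ : `|F (X k u) - F (X k t)| <= _).
  by have := norm_coord (F (X k u) - F (X k t)) j; rewrite !mxE.
apply: le_trans (FL ((X_adm k).1 _ (ltW te)) ((X_adm k).1 _ ue)) _.
rewrite -mulrA ler_wpM2l //; apply: le_trans ((X_adm k).2 _ _ (ltW te) ue) _.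
by rewrite ler_wpM2l.
Unshelve. all: by end_near. Qed.

End LocalExistence.

Lemma C1_local_existence (R : realType) (n : nat) (A : set 'rV[R]_n)
    (F : 'rV[R]_n -> 'rV[R]_n) (x0 : 'rV[R]_n) : open A -> A x0 ->
  (forall j, C1_at A (fun x => F x 0 j) x0) ->
  exists (a : R) (x : R -> 'rV[R]_n), [/\ 0 < a, x 0 = x0 &
    forall t : R, `|t| < a -> A (x t) /\ is_derive t 1 x (F (x t))].
Proof.
move=> oA Ax FC1.
have [d0 /= d0_gt0 d0A] : nbhs_ball x0 A by apply/nbhs_ballP; exact: open_nbhs_nbhs.
have Lip j := cid (Lipschitz_C1 (FC1 j)).
pose L j := sval (Lip j).
pose d j := sval (cid (svalP (Lip j))).
have Ld j : [/\ 0 < L j, 0 < d j & forall a b, `|a - x0| < d j -> `|b - x0| < d j ->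
    `|F b 0 j - F a 0 j| <= L j * `|b - a|] by exact: (svalP (cid (svalP (Lip j)))).
(* A ball on which the Lipschitz bounds of all coordinates hold and which lies in A. *)
pose r := \big[Num.min/d0]_j d j / 2.
have min_gt0 : 0 < \big[Num.min/d0]_j d j.
  by apply/bigmin_gtP; split=> // j _; case: (Ld j).
have r0 : 0 < r by rewrite divr_gt0.
have r_min : r < \big[Num.min/d0]_j d j by rewrite ltr_pdivrMr // ltr_pMr // ltr1n.
have rd j : r < d j by apply: lt_le_trans r_min _; exact: bigmin_le_cond.
have rd0 : r < d0 by apply: lt_le_trans r_min _; exact: bigmin_le_id.
have L0 : 0 <= \sum_j L j by apply: sumr_ge0 => j _; case: (Ld j) => /ltW.
have FL a b : `|a - x0| <= r -> `|b - x0| <= r -> `|F b - F a| <= (\sum_j L j) * `|b - a|.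
  move=> ar br; apply: norm_rV_le => [|j]; first by rewrite mulr_ge0.
  have [_ _ lip] := Ld j; rewrite !mxE.
  apply: le_trans (lip a b (le_lt_trans ar (rd j)) (le_lt_trans br (rd j))) _.
  rewrite ler_wpM2r // (bigD1 j) //= lerDl; apply: sumr_ge0 => i _.
  by case: (Ld i) => /ltW.
have [a [x [a0 xx0 xd]]] := picard_local_existence L0 r0 FL.
exists a, x; split=> // t /xd[xr dx]; split=> //; apply: d0A.
by rewrite -ball_normE /= distrC; exact: le_lt_trans rd0.
Qed.

(** * Vector fields as derivations of smooth functions *)

Section Charts.
Variables (R : realType) (n : nat) (M : manifold R n).
Implicit Types (p q : M) (A B : set M) (phi psi : M -> R) (V W : M -> 'rV[R]_n).

Lemma chart_image_open p A : open A -> open (chart p @` (A `&` chart_dom p)).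
Proof.
move=> oA; rewrite openE => _ [q [Aq dq] <-].
have xO : (chart p @` chart_dom p) (chart p q) by exists q.
have nA : nbhs (chart p q) (chart_inv p @^-1` (A `&` chart_dom p)).
  apply: (chart_inv_continuous xO); rewrite chartK //.
  by apply: open_nbhs_nbhs; split=> //; apply: openI => //; exact: chart_dom_open.
have nO : nbhs (chart p q) (chart p @` chart_dom p).
  by apply: open_nbhs_nbhs; split=> //; exact: chart_open.
apply: filterS (filterI nA nO) => x [/= Ax [q' dq' xq]].
by rewrite -xq chartK // in Ax; exists q'.
Qed.

Lemma smooth_on_sub A B phi : B `<=` A -> smooth_on A phi -> smooth_on B phi.
Proof.
move=> BA sphi p; apply: smooth_euclid_sub (sphi p) => _ [q [Bq dq] <-].
by exists q => //; split=> //; exact: BA.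
Qed.

Lemma smooth_on_eq A phi psi : open A -> {in A, phi =1 psi} -> smooth_on A phi ->
  smooth_on A psi.
Proof.
move=> oA e sphi p; apply: smooth_euclid_eq (sphi p); first exact: chart_image_open.
by move=> _ /[!inE] -[q [Aq dq] <-] /=; rewrite chartK // e // inE.
Qed.

Lemma smooth_on_cst A (c : R) : smooth_on A (cst c).
Proof. by move=> p; exact: smooth_euclid_cst. Qed.

Lemma smooth_onD A phi psi : open A -> smooth_on A phi -> smooth_on A psi ->
  smooth_on A (phi \+ psi).
Proof. by move=> oA sphi spsi p; apply: smooth_euclidD => //; exact: chart_image_open. Qed.

Lemma smooth_onM A phi psi : open A -> smooth_on A phi -> smooth_on A psi ->
  smooth_on A (phi \* psi).
Proof. by move=> oA sphi spsi p; apply: smooth_euclidM => //; exact: chart_image_open. Qed.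

Lemma smooth_onZ A (c : R) phi : open A -> smooth_on A phi ->
  smooth_on A (fun q => c * phi q).
Proof. by move=> oA; apply: smooth_onM => //; exact: smooth_on_cst. Qed.

Lemma smooth_chart_fun p j : smooth_on (chart_dom p) (chart_fun p j).
Proof. by move=> q; have := transition_smooth (m := M) q p j; rewrite setIC. Qed.

Lemma chart_C1 A phi p q : open A -> A q -> chart_dom p q -> smooth_on A phi ->
  C1_at (chart p @` (A `&` chart_dom p)) (phi \o chart_inv p) (chart p q).
Proof. by move=> oA Aq dq sphi; apply: smooth_C1 => //; [exact: chart_image_open|exists q]. Qed.

(** The chart need not be the one at c t; this is what relates derivatives in different charts. *)
Lemma is_derive_curve A phi p (c : R -> M) (t : R) (v : 'rV[R]_n) : open A -> A (c t) ->
  smooth_on A phi -> chart_dom p (c t) -> {for t, continuous c} ->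
  is_derive t 1 (fun s => chart p (c s)) v ->
  is_derive t 1 (phi \o c) (\sum_j v 0 j * partial j (phi \o chart_inv p) (chart p (c t))).
Proof.
move=> oA Act sphi dct cc dc.
have near_dom : \forall s \near t, chart_dom p (c s).
  by apply: cc; apply: open_nbhs_nbhs; split=> //; exact: chart_dom_open.
apply: (@near_eq_is_derive _ _ _ (fun s => (phi \o chart_inv p) (chart p (c s)))).
  by apply: filterS near_dom => s ds /=; rewrite chartK.
exact: is_derive_comp_C1 (chart_C1 oA Act dct sphi) dc.
Qed.

Lemma vderive_partial V A phi q : open A -> A q -> smooth_on A phi ->
  is_derive (chart q q) (V q) (phi \o chart_inv q) (vderive V phi q) /\
  vderive V phi q = \sum_j V q 0 j * partial j (phi \o chart_inv q) (chart q q).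
Proof.
move=> oA Aq sphi.
have d := is_derive_C1 (V q) (chart_C1 oA Aq (chart_dom_center q) sphi).
by split; [apply: derivableP; case: d|case: d].
Qed.

Lemma vderive_eq V A phi psi q : open A -> A q -> {in A, phi =1 psi} ->
  vderive V phi q = vderive V psi q.
Proof.
move=> oA Aq e; apply: near_eq_derive.
have nA : nbhs (chart q q) (chart q @` (A `&` chart_dom q)).
  apply: open_nbhs_nbhs; split; first exact: chart_image_open.
  by exists q => //; split=> //; exact: chart_dom_center.
apply: filterS nA => _ [q' [Aq' dq'] <-] /=.
by rewrite chartK // e // inE.
Qed.

Lemma vderive_chart_fun V q j : vderive V (chart_fun q j) q = V q 0 j.
Proof.
rewrite /vderive.
have d : is_derive (chart q q) (V q) (fun x : 'rV[R]_n => x 0 j) (V q 0 j).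
  apply/is_derive_lineP.
  have -> : (fun h : R => (h *: V q + chart q q) 0 j)
      = (fun h => V q 0 j * h + chart q q 0 j).
    by apply/funext => h; rewrite !mxE mulrC.
  by apply: is_derive_eq; rewrite addr0; exact: mulr1.
have nO : nbhs (chart q q) (chart q @` chart_dom q).
  apply: open_nbhs_nbhs; split; first exact: chart_open.
  by exists q => //; exact: chart_dom_center.
have [_ <-] := d; apply: near_eq_derive.
by apply: filterS nO => _ [q' dq' <-] /=; rewrite /chart_fun chartK.
Qed.

(** The value of vderive V phi at q is defined in the chart at q, a different chart for every
    point. This formula expresses it on a whole chart domain in one chart, with the derivatives
    of the coordinate functions as the components of V. *)
Lemma vderive_chain V A phi p q : open A -> A q -> chart_dom p q -> smooth_on A phi ->
  vderive V phi q =
  \sum_j vderive V (chart_fun p j) q * partial j (phi \o chart_inv p) (chart p q).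
Proof.
move=> oA Aq dq sphi.
pose c (h : R) := chart_inv q (h *: V q + chart q q).
have c0 : c 0 = q by rewrite /c scale0r add0r chartK //; exact: chart_dom_center.
have cc : {for (0 : R), continuous c}.
  apply: (@continuous_comp _ _ _ (fun h : R => h *: V q + chart q q) (chart_inv q)).
    by apply: continuousD; [exact: scalel_continuous|exact: cst_continuous].
  rewrite /= scale0r add0r; apply: chart_inv_continuous.
  by exists q => //; exact: chart_dom_center.
have dc psi B : open B -> B q -> smooth_on B psi ->
    is_derive (0 : R) 1 (psi \o c) (vderive V psi q).
  by move=> oB Bq spsi; exact: ((is_derive_lineP _ _ _ _).1 (vderive_partial _ oB Bq spsi).1).
have dcp : is_derive (0 : R) 1 (fun s => chart p (c s)) (\row_j vderive V (chart_fun p j) q).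
  apply/is_derive_coord => j; rewrite mxE.
  exact: dc (chart_dom_open p) dq (smooth_chart_fun _ _).
have := @is_derive_curve A phi p c 0; rewrite c0 => /(_ _ oA Aq sphi dq cc dcp)[_ d1].
have [_ <-] := dc _ _ oA Aq sphi; rewrite d1.
by apply: eq_bigr => j _; rewrite mxE.
Qed.

(** In the chart at p the derivative is given by the previous formula, and its coefficients are
    smooth by the definition of a smooth vector field. *)
Lemma smooth_vderive V A phi : open A -> smooth_vfield V -> smooth_on A phi ->
  smooth_on A (vderive V phi).
Proof.
move=> oA sV sphi p.
have oI : open (chart p @` (A `&` chart_dom p)) by exact: chart_image_open.
apply: (@smooth_euclid_eq _ _ _ (fun x => \sum_j (vderive V (chart_fun p j) \o chart_inv p) x
    * partial j (phi \o chart_inv p) x)) => //.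
  by move=> _ /[!inE] -[q [Aq dq] <-] /=; rewrite chartK // (vderive_chain V oA Aq dq sphi).
apply: smooth_euclid_sum => // j; apply: smooth_euclidM => //; last first.
  exact: smooth_partial.
apply: smooth_euclid_sub (sV p j p) => _ [q [Aq dq] <-].
by exists q.
Qed.

Lemma vderive_cst V (c : R) q : vderive V (cst c) q = 0.
Proof. exact: derive_cst. Qed.

Lemma vderiveD V A phi psi q : open A -> A q -> smooth_on A phi -> smooth_on A psi ->
  vderive V (phi \+ psi) q = vderive V phi q + vderive V psi q.
Proof.
move=> oA Aq sphi spsi; have [[dphi _] _] := vderive_partial V oA Aq sphi.
by have [[dpsi _] _] := vderive_partial V oA Aq spsi; exact: deriveD.
Qed.

Lemma vderiveM V A phi psi q : open A -> A q -> smooth_on A phi -> smooth_on A psi ->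
  vderive V (phi \* psi) q = phi q * vderive V psi q + psi q * vderive V phi q.
Proof.
move=> oA Aq sphi spsi; have [[dphi _] _] := vderive_partial V oA Aq sphi.
have [[dpsi _] _] := vderive_partial V oA Aq spsi.
have dq := chart_dom_center q.
rewrite -{2 4}(chartK dq); exact: deriveM.
Qed.

Lemma vderiveZ V A (c : R) phi q : open A -> A q -> smooth_on A phi ->
  vderive V (fun q => c * phi q) q = c * vderive V phi q.
Proof.
move=> oA Aq sphi; rewrite (vderiveM V oA Aq (smooth_on_cst A c)) // vderive_cst.
by rewrite mulr0 addr0.
Qed.

Lemma vderive_vfield_linear V W (c : R) A phi q : open A -> A q -> smooth_on A phi ->
  vderive (c *: V + W) phi q = c * vderive V phi q + vderive W phi q.
Proof.
move=> oA Aq sphi; rewrite !(vderive_partial _ oA Aq sphi).2 mulr_sumr -big_split /=.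
by apply: eq_bigr => j _; rewrite !mxE mulrDl mulrA.
Qed.

End Charts.

Section VectorFieldCalculus.
Variables (R : realType) (n : nat) (M : manifold R n).
Implicit Types (p q : M) (A B : set M) (phi psi : M -> R) (V W : M -> 'rV[R]_n).

(** In the chart at q the second-order terms of V W and of W V agree, by the symmetry of second
    derivatives, and the first-order terms are the components of the bracket. *)
Lemma vderive_jacobi V W A phi q : open A -> A q -> smooth_vfield V -> smooth_vfield W ->
  smooth_on A phi ->
  vderive (jacobi V W) phi q = vderive V (vderive W phi) q - vderive W (vderive V phi) q.
Proof.
move=> oA Aq sV sW sphi; have dq := chart_dom_center q.
have oI : open (chart q @` (A `&` chart_dom q)) by exact: chart_image_open.
have Ix : (chart q @` (A `&` chart_dom q)) (chart q q) by exists q.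
pose Phi := phi \o chart_inv q.
have sPhi : smooth_euclid (chart q @` (A `&` chart_dom q)) Phi by exact: sphi.
have oB := openI oA (chart_dom_open q).
have second X Y : smooth_vfield X -> smooth_vfield Y -> vderive X (vderive Y phi) q =
    \sum_j (vderive X (vderive Y (chart_fun q j)) q * partial j Phi (chart q q)
            + Y q 0 j * \sum_i X q 0 i * partial i (partial j Phi) (chart q q)).
  move=> sX sY.
  have dY j := vderive_partial X (chart_dom_open q) dq (sY q j).
  have dP j := is_derive_C1 (X q) (smooth_C1 oI Ix (smooth_partial j sPhi)).
  have near_E : \forall x \near chart q q, (\sum_j (vderive Y (chart_fun q j) \o chart_inv q)
      \* partial j Phi) x = (vderive Y phi \o chart_inv q) x.
    have := open_nbhs_nbhs (conj oI Ix); apply: filterS => _ [q' [Aq' dq'] <-].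
    by rewrite fct_sumE /= (chartK dq') (vderive_chain Y oA Aq' dq' sphi).
  rewrite {1}/vderive -(near_eq_derive _ near_E) derive_sum; last first.
    by move=> j; apply: derivableM; [case: (dY j) => [[]]|case: (dP j)].
  apply: eq_bigr => j _; rewrite deriveM; first last.
  - by case: (dP j).
  - by case: (dY j) => [[]].
  have [_ ->] := dP j; rewrite /= chartK // vderive_chart_fun addrC; congr (_ + _).
  exact: mulrC.
rewrite (vderive_partial _ oA Aq sphi).2 !second // !big_split opprD addrACA.
rewrite [X in _ + X](_ : _ = 0) /= ?addr0.
  by rewrite -sumrB; apply: eq_bigr => j _; rewrite mxE mulrBl.
apply/eqP; rewrite subr_eq0; apply/eqP.
under eq_bigr => j _ do rewrite mulr_sumr.
rewrite exchange_big /=; apply: eq_bigr => i _; rewrite mulr_sumr.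
apply: eq_bigr => j _; rewrite mulrCA (smooth_partialC _ _ oI Ix sPhi) //.
Qed.

Lemma smooth_vfield0 : smooth_vfield (0 : M -> 'rV[R]_n).
Proof.
move=> p j; apply: (@smooth_on_eq _ _ _ _ (cst 0)); [exact: chart_dom_open| |exact: smooth_on_cst].
move=> q; rewrite inE => dq.
rewrite (vderive_partial _ (chart_dom_open p) dq (@smooth_chart_fun _ _ _ p j)).2 big1 // => i _.
by rewrite mxE mul0r.
Qed.

Lemma smooth_vfield_linear (c : R) V W : smooth_vfield V -> smooth_vfield W ->
  smooth_vfield (c *: V + W).
Proof.
move=> sV sW p j; have oD := chart_dom_open p.
apply: (@smooth_on_eq _ _ _ _
  ((fun q => c * vderive V (chart_fun p j) q) \+ vderive W (chart_fun p j))) => //.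
  move=> q; rewrite inE => dq.
  by rewrite (vderive_vfield_linear V W c oD dq (@smooth_chart_fun _ _ _ p j)).
by apply: smooth_onD => //; apply: smooth_onZ.
Qed.

Lemma smooth_jacobi V W : smooth_vfield V -> smooth_vfield W -> smooth_vfield (jacobi V W).
Proof.
move=> sV sW p j; have oD := chart_dom_open p.
have sx : smooth_on (chart_dom p) (chart_fun p j) by exact: smooth_chart_fun.
apply: (@smooth_on_eq _ _ _ _ (vderive V (vderive W (chart_fun p j))
   \+ (fun q => -1 * vderive W (vderive V (chart_fun p j)) q))) => //.
  by move=> q; rewrite inE => dq; rewrite (vderive_jacobi oD dq) //= mulN1r.
apply: smooth_onD => //; last apply: smooth_onZ => //.
  by apply: smooth_vderive => //; exact: smooth_vderive.
by apply: smooth_vderive => //; exact: smooth_vderive.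
Qed.

Lemma frame_lie_smooth (d : nat) (E : 'I_d -> M -> 'rV[R]_n) V : is_frame E ->
  frame_lie E V -> smooth_vfield V.
Proof.
move=> [sE _]; apply; split; last by move=> _ [i _ <-]; exact: sE.
split; [exact: smooth_vfield0|exact: smooth_vfield_linear|exact: smooth_jacobi].
Qed.

Lemma jacobiE V W p j : jacobi V W p 0 j =
  vderive V (vderive W (chart_fun p j)) p - vderive W (vderive V (chart_fun p j)) p.
Proof. exact: mxE. Qed.

Lemma jacobi_linearl (c : R) V V' W : smooth_vfield V -> smooth_vfield V' ->
  smooth_vfield W -> jacobi (c *: V + V') W = c *: jacobi V W + jacobi V' W.
Proof.
move=> sV sV' sW; apply/funext => p; apply/rowP => j.
have -> : (c *: jacobi V W + jacobi V' W) p 0 j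
    = c * jacobi V W p 0 j + jacobi V' W p 0 j.
  by rewrite -[(_ + _) p]/(c *: jacobi V W p + jacobi V' W p) mxE [X in X + _]mxE.
apply: etrans (jacobiE _ _ _ _) _.
apply: etrans (esym (congr2 +%R (congr1 ( *%R c) (jacobiE V W p j)) (jacobiE V' W p j))).
have [oD dp] := (chart_dom_open p, chart_dom_center p).
have sx : smooth_on (chart_dom p) (chart_fun p j) by exact: smooth_chart_fun.
have sd X : smooth_vfield X -> smooth_on (chart_dom p) (vderive X (chart_fun p j)).
  by move=> sX; exact: smooth_vderive.
rewrite (vderive_vfield_linear _ _ _ oD dp (sd W sW)).
rewrite (@vderive_eq _ _ _ W (chart_dom p) (vderive (c *: V + V') (chart_fun p j))
  ((fun q => c * vderive V (chart_fun p j) q) \+ vderive V' (chart_fun p j))) //; last first.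
  by move=> q; rewrite inE => dq; rewrite (vderive_vfield_linear _ _ _ oD dq sx).
rewrite (vderiveD W oD dp (smooth_onZ c oD (sd V sV)) (sd V' sV')).
rewrite (vderiveZ W c oD dp (sd V sV)).
move: (vderive V _ p) (vderive V' _ p) (vderive W _ p) (vderive W _ p).
by move=> a b x y; rewrite mulrBr opprD addrACA.
Qed.

Lemma jacobiC V W : jacobi V W = - jacobi W V.
Proof.
apply/funext => p; apply/rowP => j.
rewrite -[(- _) p]/(- jacobi W V p) [RHS]mxE.
apply: etrans (jacobiE _ _ _ _) _.
apply: etrans (esym (congr1 -%R (jacobiE W V p j))).
by move: (vderive V _ p) (vderive W _ p) => a b; rewrite opprB.
Qed.

Lemma jacobi_linearr (c : R) V W W' : smooth_vfield V -> smooth_vfield W ->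
  smooth_vfield W' -> jacobi V (c *: W + W') = c *: jacobi V W + jacobi V W'.
Proof.
move=> sV sW sW'; rewrite jacobiC (jacobi_linearl _ sW sW' sV) opprD -scalerN.
by congr (c *: _ + _); apply/esym; exact: jacobiC.
Qed.

(** An integral curve is the inverse image, under the chart at p, of a solution of the
    differential equation for the components of V in that chart. *)
Lemma integral_curve_exists V p : smooth_vfield V -> exists c : R -> M, integral_curve V p c.
Proof.
move=> sV; have [oD dp] := (chart_dom_open p, chart_dom_center p).
pose F (x : 'rV[R]_n) := \row_j (vderive V (chart_fun p j) \o chart_inv p) x.
have Dp : (chart p @` chart_dom p) (chart p p) by exists p.
have [|a [x [a0 x0 xd]]] := C1_local_existence (F := F) (chart_open (p := p)) Dp.
  move=> j; under [fun x => F x 0 j]eq_fun do rewrite mxE.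
  by rewrite -{1}[chart_dom p]setIid; apply: chart_C1 => //; exact: sV.
exists (chart_inv p \o x); split; first by rewrite /= x0 chartK.
exists a => // t ta; have [[q dq xq] dx] := xd t ta.
have xO : (chart p @` chart_dom p) (x t) by rewrite -xq; exists q.
have cE : chart_inv p (x t) = q by rewrite -xq chartK.
have cc : {for t, continuous (chart_inv p \o x)}.
  apply: continuous_comp; last exact: chart_inv_continuous.
  by apply: differentiable_continuous; apply/derivable1_diffP; case: dx.
split=> //; rewrite /= cE.
have dpx : is_derive t 1 (fun s => chart p ((chart_inv p \o x) s)) (F (x t)).
  apply: near_eq_is_derive dx; near=> s.
  have sa : `|s| < a.
    near: s; apply: open_nbhs_nbhs; split=> //.
    apply: (open_comp (D := [set z : R | z < a])); last exact: open_lt.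
    by move=> *; exact: norm_continuous.
  by rewrite /=; have [[q' dq' <-] _] := xd s sa; rewrite chartK.
apply/is_derive_coord => j.
have := @is_derive_curve _ _ _ (chart_dom q) (chart_fun q j) p (chart_inv p \o x) t (F (x t)).
have sq : smooth_on (chart_dom q) (chart_fun q j) by exact: smooth_chart_fun.
rewrite /= cE => /(_ (chart_dom_open q) (chart_dom_center q) sq dq cc dpx).
move=> H; apply: is_derive_eq H _.
rewrite -(vderive_chart_fun V q j).
rewrite (vderive_chain V (chart_dom_open q) (chart_dom_center q) dq sq).
by apply: eq_bigr => i _; rewrite mxE /= cE xq.
Unshelve. all: by end_near. Qed.

(** The curve chosen by flow is an integral curve because there is one. *)
Lemma is_derive_flow V A phi p : smooth_vfield V -> open A -> A p -> smooth_on A phi ->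
  (\forall t \near (0 : R), A (flow V p t)) /\
  is_derive (0 : R) 1 (phi \o flow V p) (vderive V phi p).
Proof.
move=> sV oA Ap sphi.
have : integral_curve V p (flow V p).
  by apply: xgetPex; exact: integral_curve_exists.
move=> [f0 [e e0 /(_ 0)]]; rewrite normr0 => /(_ e0)[cf]; rewrite f0 => df.
split; first by apply: cf; rewrite f0; exact: open_nbhs_nbhs.
have := @is_derive_curve _ _ _ A phi p (flow V p) 0 (V p).
rewrite f0 => /(_ oA Ap sphi (chart_dom_center p) cf df).
by rewrite -(vderive_partial V oA Ap sphi).2.
Qed.

End VectorFieldCalculus.

(** * Smooth functions with values in a vector space *)

Lemma sum_enum_val (W : nmodType) (I : finType) (F : I -> W) :
  \sum_i F i = \sum_(k < #|I|) F (enum_val k).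
Proof. by rewrite -big_enum_val. Qed.

Section VectorValuedCurves.
Variables (R : realType) (W : lmodType R).

(** If the last coefficient is not identically zero near t, then the last vector is a
    combination of the others and can be eliminated. *)
Lemma derive_relation (m : nat) (z : 'I_m -> R -> R) (u : 'I_m -> W) (t : R) :
  (forall i, derivable (z i) t 1) -> (\forall s \near t, \sum_i z i s *: u i = 0) ->
  \sum_i 'D_1 (z i) t *: u i = 0.
Proof.
elim: m z u => [|m IHm] z u dz near0; first by rewrite big_ord0.
have [zl0|] := pselect (\forall s \near t, z ord_max s = 0).
  rewrite big_ord_recr /= (near_eq_derive (g := cst 0) _ zl0) derive_cst scale0r addr0.
  apply: (IHm (fun i => z (widen_ord (leqnSn m) i)) (fun i => u (widen_ord (leqnSn m) i))) => //.
  apply: filterS (filterI zl0 near0) => s [zs].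
  by rewrite big_ord_recr /= zs scale0r addr0.
move=> nzl.
have [s0 [zs0 sum0]] : exists s0, z ord_max s0 != 0 /\ \sum_i z i s0 *: u i = 0.
  apply: contrapT => no; apply: nzl; apply: filterS near0 => s sum0.
  by apply/eqP; apply: contrapT => /negP nz; apply: no; exists s.
pose c i := - (z ord_max s0)^-1 * z (widen_ord (leqnSn m) i) s0.
have ul : u ord_max = \sum_i c i *: u (widen_ord (leqnSn m) i).
  move: sum0; rewrite big_ord_recr /= => /eqP; rewrite addrC addr_eq0 => /eqP e.
  apply: (scalerI zs0); rewrite e scaler_sumr -sumrN; apply: eq_bigr => i _.
  by rewrite scalerA /c mulrA mulrN divff // mulN1r scaleNr.
have split_sum (x : 'I_m.+1 -> R) : \sum_i x i *: u i =
    \sum_i (x (widen_ord (leqnSn m) i) + c i * x ord_max) *: u (widen_ord (leqnSn m) i).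
  rewrite big_ord_recr /= ul scaler_sumr -big_split /=; apply: eq_bigr => i _.
  by rewrite scalerDl scalerA [c i * _]mulrC.
rewrite split_sum.
have dcz i : is_derive t 1 (fun s => z (widen_ord (leqnSn m) i) s + c i * z ord_max s)
   ('D_1 (z (widen_ord (leqnSn m) i)) t + c i * 'D_1 (z ord_max) t).
  apply: is_deriveD; first exact: derivableP.
  exact: (@is_deriveZ _ _ _ (z ord_max) (c i) t 1 _ (derivableP (dz ord_max))).
under eq_bigr => i _ do rewrite -(@derive_val _ _ _ _ _ _ _ (dcz i)).
apply: IHm => [i|]; first by case: (dcz i).
by apply: filterS near0 => s; rewrite split_sum.
Qed.

Lemma derive_relation_fin (I : finType) (z : I -> R -> R) (u : I -> W) (t : R) :
  (forall i, derivable (z i) t 1) -> (\forall s \near t, \sum_i z i s *: u i = 0) ->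
  \sum_i 'D_1 (z i) t *: u i = 0.
Proof.
move=> dz near0; rewrite sum_enum_val.
apply: (@derive_relation _ (fun k => z (enum_val k)) (fun k => u (enum_val k))) => //.
by apply: filterS near0 => s; rewrite sum_enum_val.
Qed.

(** The difference of two representations of the curve is a relation between the vectors of
    both, and relations can be differentiated. *)
Lemma is_vec_derive_unique (c : R -> W) (t : R) (w w' : W) :
  is_vec_derive c t w -> is_vec_derive c t w' -> w = w'.
Proof.
move=> [m [x [v [cx dx ->]]]] [m' [x' [v' [cx' dx' ->]]]].
pose z (i : 'I_m + 'I_m') := match i with inl i => x i | inr i => - x' i end.
pose u (i : 'I_m + 'I_m') := match i with inl i => v i | inr i => v' i end.
have dz i : derivable (z i) t 1 by case: i => i /=; [exact: dx|exact: derivableN].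
have := @derive_relation_fin _ z u t dz; rewrite big_sumType /=.
under [X in _ + X]eq_bigr => i _ do rewrite deriveN // scaleNr.
rewrite sumrN => H; apply/eqP; rewrite -subr_eq0; apply/eqP; apply: H.
apply: filterS (filterI cx cx') => s [e e']; rewrite big_sumType /=.
under [X in _ + X]eq_bigr => i _ do rewrite scaleNr.
by rewrite sumrN -e -e' subrr.
Qed.

End VectorValuedCurves.

Section SmoothFunctions.
Variables (R : realType) (n : nat) (M : manifold R n).
Implicit Types (p q : M) (A B : set M) (V : M -> 'rV[R]_n).

(** The local form of an element of C^infty(M, L). The index type is arbitrary, so that sums and
    products of functions are represented over sums and products of index types. *)
Definition smooth_rep (W : lmodType R) (L : set W) (F : M -> W) (A : set M) (I : finType)
    (phi : I -> M -> R) (w : I -> W) : Prop :=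
  [/\ open A, forall i, smooth_on A (phi i), forall i, L (w i)
    & forall q, A q -> F q = \sum_i phi i q *: w i].

(** The coefficients phi are only smooth near p, so the calculus below is local at p. *)
Definition smooth_near (W : lmodType R) (L : set W) (F : M -> W) p : Prop :=
  exists A (m : nat) (phi : 'I_m -> M -> R) (w : 'I_m -> W), A p /\ smooth_rep L F A phi w.

Lemma smooth_intoP (W : lmodType R) (L : set W) (F : M -> W) :
  smooth_into L F <-> forall p, smooth_near L F p.
Proof.
split=> sF p; first by have [A [oA Ap [m [phi [w [? ? ?]]]]]] := sF p; exists A, m, phi, w.
by have [A [m [phi [w [Ap [? ? ? ?]]]]]] := sF p; exists A; split=> //; exists m, phi, w.
Qed.

Lemma smooth_rep_near (W : lmodType R) (L : set W) (F : M -> W) A (I : finType)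
    (phi : I -> M -> R) (w : I -> W) p : smooth_rep L F A phi w -> A p -> smooth_near L F p.
Proof.
move=> [oA sphi Lw FE] Ap.
exists A, #|I|, (fun i => phi (enum_val i)), (fun i => w (enum_val i)); split=> //.
split=> // q Aq; by rewrite FE // sum_enum_val.
Qed.

Lemma smooth_rep_sub (W : lmodType R) (L : set W) (F : M -> W) A B (I : finType)
    (phi : I -> M -> R) (w : I -> W) : open B -> B `<=` A -> smooth_rep L F A phi w ->
  smooth_rep L F B phi w.
Proof.
move=> oB BA [_ sphi Lw FE]; split=> // [i|q /BA/FE//].
exact: smooth_on_sub (sphi i).
Qed.

(** Along the flow F is a combination of the fixed vectors w i, whose coefficients have the
    derivatives vderive V (phi i) at time 0. *)
Lemma lie_derive_rep (W : lmodType R) (L : set W) (F : M -> W) V A (I : finType)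
    (phi : I -> M -> R) (w : I -> W) p : smooth_vfield V -> smooth_rep L F A phi w -> A p ->
  lie_derive V F p = \sum_i vderive V (phi i) p *: w i.
Proof.
move=> sV [oA sphi _ FE] Ap.
have H : is_vec_derive (fun t => F (flow V p t)) 0 (\sum_i vderive V (phi i) p *: w i).
  exists #|I|, (fun k => phi (enum_val k) \o flow V p), (fun k => w (enum_val k)).
  have dphi i := is_derive_flow sV oA Ap (sphi i).
  split=> [|k|].
  - have /filterS : \forall t \near (0 : R), A (flow V p t).
      by have [] := is_derive_flow sV oA Ap (smooth_on_cst A 0).
    by apply=> t At; by rewrite FE // sum_enum_val.
  - by have [_ []] := dphi (enum_val k).
  rewrite sum_enum_val; apply: eq_bigr => k _.
  by have [_ [_ ->]] := dphi (enum_val k).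
by apply: (xget_unique _ H) => w' /is_vec_derive_unique/(_ H).
Qed.

Lemma smooth_into_cst (W : lmodType R) (L : set W) (w : W) : L w ->
  smooth_into L (cst w : M -> W).
Proof.
move=> Lw; apply/smooth_intoP => p.
apply: (@smooth_rep_near _ L _ setT unit (fun _ => cst 1) (fun _ => w)) => //.
split=> // [|i|q _]; [exact: openT|exact: smooth_on_cst|].
by rewrite big_const card_unit /= addr0 scale1r.
Qed.

Lemma smooth_into0 (W : lmodType R) (L : set W) : smooth_into L (0 : M -> W).
Proof.
apply/smooth_intoP => p.
apply: (@smooth_rep_near _ L _ setT void (fun _ => cst 1) (fun _ => 0)) => //.
split=> // [|q _]; first exact: openT.
by rewrite big_pred0 // => -[].
Qed.

Lemma smooth_into_map (W W' : lmodType R) (L : set W) (L' : set W') (T : W -> W') (F : M -> W) :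
  (forall m (a : 'I_m -> R) (v : 'I_m -> W), (forall i, L (v i)) ->
     T (\sum_i a i *: v i) = \sum_i a i *: T (v i)) ->
  (forall v, L v -> L' (T v)) -> smooth_into L F ->
  smooth_into L' (T \o F) /\
  forall V, smooth_vfield V -> lie_derive V (T \o F) = T \o lie_derive V F.
Proof.
move=> Tlin TL /smooth_intoP sF.
have rep p : exists A (m : nat) (phi : 'I_m -> M -> R) (w : 'I_m -> W),
    [/\ A p, smooth_rep L F A phi w & smooth_rep L' (T \o F) A phi (T \o w)].
  have [A [m [phi [w [Ap r]]]]] := sF p; exists A, m, phi, w; split=> //.
  have [oA sphi Lw FE] := r; split=> // [i|q Aq]; first exact: TL.
  by rewrite /= FE // Tlin.
split=> [|V sV].
  by apply/smooth_intoP => p; have [A [m [phi [w [Ap _ r]]]]] := rep p; exact: smooth_rep_near r Ap.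
apply/funext => p; have [A [m [phi [w [Ap r r']]]]] := rep p.
rewrite (lie_derive_rep sV r' Ap) /= (lie_derive_rep sV r Ap) Tlin //.
by case: r.
Qed.

Lemma smooth_near_linear (W : lmodType R) (L : set W) (c : R) (F G : M -> W) p :
  smooth_near L F p -> smooth_near L G p -> smooth_near L (c *: F + G) p /\
  forall V, smooth_vfield V ->
    lie_derive V (c *: F + G) p = c *: lie_derive V F p + lie_derive V G p.
Proof.
move=> [A [m [phi [w [Ap r]]]]] [B [m' [psi [v [Bp r']]]]].
have [[oA _ _ _] [oB _ _ _]] := (r, r').
have {}r : smooth_rep L F (A `&` B) phi w by apply: smooth_rep_sub r => [|q []] //; exact: openI.
have {}r' : smooth_rep L G (A `&` B) psi v by apply: smooth_rep_sub r' => [|q []] //; exact: openI.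
have Ip : (A `&` B) p by [].
pose chi (i : 'I_m + 'I_m') :=
  match i with inl i => fun q => c * phi i q | inr i => psi i end.
pose x (i : 'I_m + 'I_m') := match i with inl i => w i | inr i => v i end.
have r'' : smooth_rep L (c *: F + G) (A `&` B) chi x.
  case: r r' => [oI sphi Lw FE] [_ spsi Lv GE]; split=> [//|[i|i]|[i|i]|q Iq]; rewrite /chi /x.
  - exact: smooth_onZ.
  - exact: spsi.
  - exact: Lw.
  - exact: Lv.
  rewrite -[LHS]/(c *: F q + G q) FE // GE // big_sumType /= scaler_sumr; congr (_ + _).
  by apply: eq_bigr => i _; rewrite scalerA.
split=> [|V sV]; first exact: smooth_rep_near r'' Ip.
rewrite (lie_derive_rep sV r'' Ip) (lie_derive_rep sV r Ip) (lie_derive_rep sV r' Ip).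
rewrite big_sumType /= scaler_sumr.
congr (_ + _); apply: eq_bigr => i _; rewrite scalerA; congr (_ *: _).
by case: r => oI sphi _ _; exact: vderiveZ (sphi i).
Qed.

Lemma smooth_near_sum (W : lmodType R) (L : set W) (I : Type) (r : seq I) (F : I -> M -> W) p :
  (forall i, smooth_near L (F i) p) -> smooth_near L (\sum_(i <- r) F i) p /\
  forall V, smooth_vfield V ->
    lie_derive V (\sum_(i <- r) F i) p = \sum_(i <- r) lie_derive V (F i) p.
Proof.
move=> sF; elim: r => [|i r [sr dr]].
  rewrite big_nil; split; first exact: (smooth_intoP _ _).1 (smooth_into0 _) p.
  move=> V sV; rewrite big_nil; have s0 := (smooth_intoP L _).1 (smooth_into0 L) p.
  have [_ /(_ V sV)] := smooth_near_linear (-1) s0 s0.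
  by rewrite scaleN1r addNr scaleN1r addNr.
rewrite big_cons -[F i]scale1r; have [s d] := smooth_near_linear 1 (sF i) sr; split=> // V sV.
by rewrite d // dr // big_cons !scale1r.
Qed.

Lemma smooth_near_eq (W : lmodType R) (L : set W) (F G : M -> W) A p :
  open A -> A p -> {in A, F =1 G} -> smooth_near L F p -> smooth_near L G p /\
  forall V, smooth_vfield V -> lie_derive V F p = lie_derive V G p.
Proof.
move=> oA Ap FG [B [m [phi [w [Bp r]]]]]; have [oB _ _ _] := r.
have Ip : (A `&` B) p by [].
have {}r : smooth_rep L F (A `&` B) phi w by apply: smooth_rep_sub r => [|q []] //; exact: openI.
have r' : smooth_rep L G (A `&` B) phi w.
  case: r => oI sphi Lw FE; split=> // q Iq; rewrite -FG ?FE // inE; by case: Iq.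
split=> [|V sV]; first exact: smooth_rep_near r' Ip.
by rewrite (lie_derive_rep sV r Ip) (lie_derive_rep sV r' Ip).
Qed.

Lemma smooth_into_linear (W : lmodType R) (L : set W) (c : R) (F G : M -> W) :
  smooth_into L F -> smooth_into L G -> smooth_into L (c *: F + G) /\
  forall V, smooth_vfield V -> lie_derive V (c *: F + G) = c *: lie_derive V F + lie_derive V G.
Proof.
move=> /smooth_intoP sF /smooth_intoP sG; split=> [|V sV].
  by apply/smooth_intoP => p; exact: (smooth_near_linear c (sF p) (sG p)).1.
by apply/funext => p; exact: (smooth_near_linear c (sF p) (sG p)).2.
Qed.

Lemma smooth_into_sum (W : lmodType R) (L : set W) (I : Type) (r : seq I) (F : I -> M -> W) :
  (forall i, smooth_into L (F i)) -> smooth_into L (\sum_(i <- r) F i).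
Proof.
move=> sF; elim: r => [|i r IHr]; first by rewrite big_nil; exact: smooth_into0.
by rewrite big_cons -[F i]scale1r; exact: (smooth_into_linear 1 (sF i) IHr).1.
Qed.

Lemma smooth_near_bilinear (W1 W2 W3 : lmodType R) (L1 : set W1) (L2 : set W2) (L3 : set W3)
    (b : W1 -> W2 -> W3) (F : M -> W1) (G : M -> W2) p :
  (forall m m' (x : 'I_m -> R) (y : 'I_m' -> R) v w, (forall i, L1 (v i)) -> (forall j, L2 (w j)) ->
     b (\sum_i x i *: v i) (\sum_j y j *: w j) = \sum_i \sum_j (x i * y j) *: b (v i) (w j)) ->
  (forall v w, L1 v -> L2 w -> L3 (b v w)) ->
  smooth_near L1 F p -> smooth_near L2 G p ->
  smooth_near L3 (fun p => b (F p) (G p)) p /\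
  forall V, smooth_vfield V -> lie_derive V (fun p => b (F p) (G p)) p =
    b (lie_derive V F p) (G p) + b (F p) (lie_derive V G p).
Proof.
move=> blin bL [A [m [phi [w [Ap r]]]]] [B [m' [psi [v [Bp r']]]]].
have [[oA _ _ _] [oB _ _ _]] := (r, r').
have {}r : smooth_rep L1 F (A `&` B) phi w by apply: smooth_rep_sub r => [|q []] //; exact: openI.
have {}r' : smooth_rep L2 G (A `&` B) psi v by apply: smooth_rep_sub r' => [|q []] //; exact: openI.
have Ip : (A `&` B) p by [].
have r'' : smooth_rep L3 (fun p => b (F p) (G p)) (A `&` B)
    (fun (ij : 'I_m * 'I_m') => phi ij.1 \* psi ij.2) (fun ij => b (w ij.1) (v ij.2)).
  case: r r' => [oI sphi Lw FE] [_ spsi Lv GE]; split=> // [ij|ij|q Iq].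
  - exact: smooth_onM.
  - exact: bL.
  by rewrite FE // GE // blin // pair_bigA /=; exact: eq_bigr.
split=> [|V sV]; first exact: smooth_rep_near r'' Ip.
rewrite (lie_derive_rep sV r'' Ip) (lie_derive_rep sV r Ip) (lie_derive_rep sV r' Ip).
case: r r' => [oI sphi Lw FE] [_ spsi Lv GE]; rewrite FE // GE // !blin //.
rewrite -big_split /= -(pair_bigA _ (fun i j => vderive V (phi i \* psi j) p *: b (w i) (v j))) /=.
apply: eq_bigr => i _; rewrite -big_split /=; apply: eq_bigr => j _.
rewrite -scalerDl; congr (_ *: _); rewrite (vderiveM V oI Ip) //.
by rewrite addrC [psi j p * _]mulrC.
Qed.

Lemma smooth_into_bilinear (W1 W2 W3 : lmodType R) (L1 : set W1) (L2 : set W2) (L3 : set W3)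
    (b : W1 -> W2 -> W3) (F : M -> W1) (G : M -> W2) :
  (forall m m' (x : 'I_m -> R) (y : 'I_m' -> R) v w, (forall i, L1 (v i)) -> (forall j, L2 (w j)) ->
     b (\sum_i x i *: v i) (\sum_j y j *: w j) = \sum_i \sum_j (x i * y j) *: b (v i) (w j)) ->
  (forall v w, L1 v -> L2 w -> L3 (b v w)) ->
  smooth_into L1 F -> smooth_into L2 G -> smooth_into L3 (fun p => b (F p) (G p)).
Proof.
move=> blin bL /smooth_intoP sF /smooth_intoP sG; apply/smooth_intoP => p.
exact: (smooth_near_bilinear blin bL (sF p) (sG p)).1.
Qed.

(** Real functions are treated as functions into the module of scalars. *)
Lemma smooth_near_scale (W : lmodType R) (L : set W) (phi : M -> R) (F : M -> W) A p :
  open A -> A p -> smooth_on A phi -> (forall (c : R) w, L w -> L (c *: w)) ->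
  smooth_near L F p ->
  smooth_near L (fun q => phi q *: F q) p /\
  forall V, smooth_vfield V -> lie_derive V (fun q => phi q *: F q) p =
    vderive V phi p *: F p + phi p *: lie_derive V F p.
Proof.
move=> oA Ap sphi LZ sF.
have r : smooth_rep setT (phi : M -> R^o) A (fun _ : unit => phi) (fun _ => 1 : R^o).
  by split=> // q Aq; rewrite big_const card_unit /= addr0 [_ *: _]mulr1.
have sphi' := smooth_rep_near r Ap.
have [||s d] := @smooth_near_bilinear R^o W W setT L L (fun c w => c *: w) phi F p _ _ sphi' sF.
- move=> m m' x y v w _ _; rewrite scaler_suml; apply: eq_bigr => i _.
  rewrite scaler_sumr; apply: eq_bigr => j _; rewrite !scalerA.
  by congr (_ *: _); rewrite [x i *: v i]/(x i * v i) mulrAC.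
- by move=> c w _; exact: LZ.
split=> // V sV; rewrite d //; congr (_ *: _ + _).
by rewrite (lie_derive_rep sV r Ap) big_const card_unit /= addr0 [_ *: _]mulr1.
Qed.

Lemma smooth_lie_derive (W : lmodType R) (L : set W) (F : M -> W) V : smooth_vfield V ->
  smooth_into L F -> smooth_into L (lie_derive V F).
Proof.
move=> sV /smooth_intoP sF; apply/smooth_intoP => p.
have [A [m [phi [w [Ap r]]]]] := sF p.
apply: (@smooth_rep_near _ _ _ A _ (fun i => vderive V (phi i)) w) => //.
case: (r) => oA sphi Lw FE; split=> // [i|q Aq]; first exact: smooth_vderive.
exact: lie_derive_rep r Aq.
Qed.

Lemma lie_derive_vfield_linear (W : lmodType R) (L : set W) (F : M -> W) (c : R) V V' :
  smooth_vfield V -> smooth_vfield V' -> smooth_into L F ->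
  lie_derive (c *: V + V') F = c *: lie_derive V F + lie_derive V' F.
Proof.
move=> sV sV' /smooth_intoP sF; apply/funext => p.
have [A [m [phi [w [Ap r]]]]] := sF p.
rewrite -[RHS]/(c *: lie_derive V F p + lie_derive V' F p).
rewrite !(lie_derive_rep _ r Ap) //; last exact: smooth_vfield_linear.
case: r => oA sphi Lw FE; rewrite scaler_sumr -big_split /=; apply: eq_bigr => i _.
by rewrite (vderive_vfield_linear _ _ _ oA Ap (sphi i)) scalerDl scalerA.
Qed.

Lemma lie_derive_jacobi (W : lmodType R) (L : set W) (F : M -> W) V V' :
  smooth_vfield V -> smooth_vfield V' -> smooth_into L F ->
  lie_derive (jacobi V V') F =
  lie_derive V (lie_derive V' F) - lie_derive V' (lie_derive V F).
Proof.
move=> sV sV' /smooth_intoP sF; apply/funext => p.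
have [A [m [phi [w [Ap r]]]]] := sF p.
have rd X : smooth_vfield X ->
    smooth_rep L (lie_derive X F) A (fun i => vderive X (phi i)) w.
  case: (r) => oA sphi Lw FE sX; split=> // [i|q Aq]; first exact: smooth_vderive.
  exact: lie_derive_rep r Aq.
rewrite -[RHS]/(lie_derive V (lie_derive V' F) p - lie_derive V' (lie_derive V F) p).
rewrite (lie_derive_rep _ r Ap); last exact: smooth_jacobi.
rewrite (lie_derive_rep sV (rd _ sV') Ap) (lie_derive_rep sV' (rd _ sV) Ap) -sumrB.
case: r => oA sphi Lw FE; apply: eq_bigr => i _.
by rewrite (vderive_jacobi oA Ap) // scalerBl.
Qed.

End SmoothFunctions.

(** * Modules over the enveloping algebra *)

(** The scalar component makes the algebra non-trivial even when V is zero. *)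
Record endo (R : realType) (V : lmodType R) := Endo {
  endo_fun : V -> V;
  endo_linear : linear endo_fun;
  endo_scalar : R
}.

Section EndoAlgebra.
Variables (R : realType) (V : lmodType R).
Implicit Types (S T : endo V).

HB.instance Definition _ := gen_eqMixin (endo V).
HB.instance Definition _ := gen_choiceMixin (endo V).

Lemma endo_eq S T : endo_fun S =1 endo_fun T -> endo_scalar S = endo_scalar T -> S = T.
Proof.
case: S T => [f lf a] [g lg b] /= /funext fg ab; move: fg ab lf lg => -> -> lf lg.
by rewrite (Prop_irrelevance lf lg).
Qed.

Let zero_linear : linear (fun _ : V => 0 : V).
Proof. by move=> c x y; rewrite scaler0 addr0. Qed.
Let opp_linear T : linear (fun x => - endo_fun T x).
Proof. by move=> c x y; rewrite endo_linear opprD scalerN. Qed.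
Let add_linear S T : linear (fun x => endo_fun S x + endo_fun T x).
Proof. by move=> c x y; rewrite !endo_linear scalerDr addrACA. Qed.
Let id_linear : linear (fun x : V => x). Proof. by []. Qed.
Let comp_linear S T : linear (fun x => endo_fun S (endo_fun T x)).
Proof. by move=> c x y; rewrite !endo_linear. Qed.
Let scale_linear (a : R) T : linear (fun x => a *: endo_fun T x).
Proof. by move=> c x y; rewrite endo_linear scalerDr !scalerA mulrC. Qed.

Definition endo_zero := Endo zero_linear 0.
Definition endo_opp T := Endo (opp_linear T) (- endo_scalar T).
Definition endo_add S T := Endo (add_linear S T) (endo_scalar S + endo_scalar T).
Definition endo_one := Endo id_linear 1.
Definition endo_mul S T := Endo (comp_linear S T) (endo_scalar S * endo_scalar T).
Definition endo_scale a T := Endo (scale_linear a T) (a * endo_scalar T).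

Let endo_addA : associative endo_add.
Proof. by move=> S T X; apply: endo_eq => [x|]; exact: addrA. Qed.
Let endo_addC : commutative endo_add.
Proof. by move=> S T; apply: endo_eq => [x|]; exact: addrC. Qed.
Let endo_add0 : left_id endo_zero endo_add.
Proof. by move=> S; apply: endo_eq => [x|]; exact: add0r. Qed.
Let endo_addN : left_inverse endo_zero endo_opp endo_add.
Proof. by move=> S; apply: endo_eq => [x|]; exact: addNr. Qed.

HB.instance Definition _ :=
  GRing.isZmodule.Build (endo V) endo_addA endo_addC endo_add0 endo_addN.

Let endo_mulA : associative endo_mul.
Proof. by move=> S T X; apply: endo_eq => [x|] //; exact: mulrA. Qed.
Let endo_mul1l : left_id endo_one endo_mul.
Proof. by move=> S; apply: endo_eq => [x|] //; exact: mul1r. Qed.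
Let endo_mul1r : right_id endo_one endo_mul.
Proof. by move=> S; apply: endo_eq => [x|] //; exact: mulr1. Qed.
Let endo_mulDl : left_distributive endo_mul +%R.
Proof. by move=> S T X; apply: endo_eq => [x|] //; exact: mulrDl. Qed.
Let endo_mulDr : right_distributive endo_mul +%R.
Proof.
move=> S T X; apply: endo_eq => [x|]; last exact: mulrDr.
by rewrite /= -[endo_fun T x]scale1r endo_linear !scale1r.
Qed.
Let endo_one_neq0 : endo_one != 0.
Proof.
apply/eqP => /(congr1 (@endo_scalar _ _)) /= /eqP; exact/negP/oner_neq0.
Qed.

HB.instance Definition _ := GRing.Zmodule_isNzRing.Build (endo V)
  endo_mulA endo_mul1l endo_mul1r endo_mulDl endo_mulDr endo_one_neq0.

Let endo_scaleA (a b : R) T : endo_scale a (endo_scale b T) = endo_scale (a * b) T.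
Proof. by apply: endo_eq => [x|] /=; [exact: scalerA|exact: mulrA]. Qed.
Let endo_scale1 : left_id 1 endo_scale.
Proof. by move=> T; apply: endo_eq => [x|] /=; [exact: scale1r|exact: mul1r]. Qed.
Let endo_scaleDr : right_distributive endo_scale +%R.
Proof. by move=> a S T; apply: endo_eq => [x|] /=; [exact: scalerDr|exact: mulrDr]. Qed.
Let endo_scaleDl T (a b : R) : endo_scale (a + b) T = endo_scale a T + endo_scale b T.
Proof. by apply: endo_eq => [x|] /=; [exact: scalerDl|exact: mulrDl]. Qed.

HB.instance Definition _ := GRing.Zmodule_isLmodule.Build R (endo V)
  endo_scaleA endo_scale1 endo_scaleDr endo_scaleDl.

Let endo_scaleAl (a : R) (S T : endo V) : a *: (S * T) = (a *: S) * T.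
Proof. by apply: endo_eq => [x|] //=; exact: mulrA. Qed.

HB.instance Definition _ := GRing.Lmodule_isLalgebra.Build R (endo V) endo_scaleAl.

Let endo_scaleAr (a : R) (S T : endo V) : a *: (S * T) = S * (a *: T).
Proof.
apply: endo_eq => [x|] /=; last exact: mulrCA.
have S0 : endo_fun S 0 = 0.
  by have := endo_linear S (-1) 0 0; rewrite !scaleN1r oppr0 add0r addNr.
by have := endo_linear S a (endo_fun T x) 0; rewrite S0 !addr0.
Qed.

HB.instance Definition _ := GRing.Lalgebra_isAlgebra.Build R (endo V) endo_scaleAr.

End EndoAlgebra.

Section Enveloping.
Variables (R : realType) (n : nat) (M : manifold R n).
Variables (g : set (M -> 'rV[R]_n)) (U : algType R) (iota : (M -> 'rV[R]_n) -> U).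
Hypothesis hU : is_enveloping g iota.

(** The universal property is applied to the algebra of endomorphisms of V. *)
Lemma enveloping_action (V : lmodType R) (rho : (M -> 'rV[R]_n) -> V -> V) :
  (forall X, g X -> linear (rho X)) ->
  (forall c X Y x, g X -> g Y -> rho (c *: X + Y) x = c *: rho X x + rho Y x) ->
  (forall X Y x, g X -> g Y -> rho (jacobi X Y) x = rho X (rho Y x) - rho Y (rho X x)) ->
  (forall (c : R) X Y, g X -> g Y -> g (c *: X + Y)) ->
  (forall X Y, g X -> g Y -> g (jacobi X Y)) ->
  exists act : U -> V -> V, [/\
    forall (c : R) u v x, act (c *: u + v) x = c *: act u x + act v x,
    forall u, linear (act u),
    forall x, act 1 x = x,
    forall u v x, act (u * v) x = act u (act v x)
    & forall X x, g X -> act (iota X) x = rho X x].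
Proof.
move=> rho_lin rho_add rho_jac gP gJ.
pose h X : endo V := if pselect (g X) is left gX then Endo (rho_lin X gX) 0 else 0.
have hE X (gX : g X) : h X = Endo (rho_lin X gX) 0.
  by rewrite /h; case: pselect => // gX'; apply: endo_eq.
have lie_h : lie_morphism g h.
  split=> [c X Y gX gY|X Y gX gY].
    rewrite (hE _ (gP c X Y gX gY)) (hE _ gX) (hE _ gY).
    by apply: endo_eq => [x|] /=; [exact: rho_add|rewrite mulr0 addr0].
  rewrite (hE _ (gJ X Y gX gY)) (hE _ gX) (hE _ gY).
  by apply: endo_eq => [x|] /=; [exact: rho_jac|rewrite mulr0 subr0].
have [H [HE _]] := hU.2 _ _ lie_h.
exists (fun u => endo_fun (H u)); split=> [c u v x|u|x|u v x|X x gX].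
- by rewrite linearP.
- exact: endo_linear.
- by rewrite rmorph1.
- by rewrite rmorphM.
- by rewrite HE // (hE _ gX).
Qed.

End Enveloping.

Record subalgebra (R : realType) (U : algType R) := Subalgebra {
  subalg_set : set U;
  subalg_closed1 : subalg_set 1;
  subalg_closedP : forall (c : R) u v, subalg_set u -> subalg_set v -> subalg_set (c *: u + v);
  subalg_closedM : forall u v, subalg_set u -> subalg_set v -> subalg_set (u * v)
}.

Section SubalgebraType.
Variables (R : realType) (U : algType R) (S : subalgebra U).

Definition subalg_pred : pred U := fun u => `[< subalg_set S u >].

Lemma subalg_predP : GRing.subsemialg_closed subalg_pred.
Proof.
apply: GRing.subalg_closed_semi.
split=> [|c u v /asboolP Su /asboolP Sv|u v /asboolP Su /asboolP Sv]; apply/asboolP.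
- exact: subalg_closed1.
- exact: subalg_closedP.
- exact: subalg_closedM.
Qed.

HB.instance Definition _ := GRing.isSubalgClosed.Build R U subalg_pred subalg_predP.

Definition subalg_type := {u : U | subalg_pred u}.
HB.instance Definition _ := [isSub of subalg_type for @sval _ _].
HB.instance Definition _ := [Choice of subalg_type by <:].
HB.instance Definition _ := [SubChoice_isSubAlgebra of subalg_type by <:].
End SubalgebraType.

Section EnvelopingInduction.
Variables (R : realType) (n : nat) (M : manifold R n).
Variables (g : set (M -> 'rV[R]_n)) (U : algType R) (iota : (M -> 'rV[R]_n) -> U).
Hypothesis hU : is_enveloping g iota.
Hypothesis gP : forall (c : R) X Y, g X -> g Y -> g (c *: X + Y).
Hypothesis gJ : forall X Y, g X -> g Y -> g (jacobi X Y).

(** The universal property yields a homomorphism U -> S that is iota on g. Its composite with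
    the inclusion S -> U is the identity, by the uniqueness part. *)
Lemma enveloping_generated (S : subalgebra U) :
  (forall X, g X -> subalg_set S (iota X)) -> forall u, subalg_set S u.
Proof.
move=> Sg.
have Sg' X : g X -> subalg_pred S (iota X) by move=> /Sg ?; apply/asboolP.
pose h X : subalg_type S :=
  if pselect (g X) is left gX then exist (fun u => subalg_pred S u) _ (Sg' X gX) else 0.
have hE X : g X -> sval (h X) = iota X by rewrite /h; case: pselect.
have lie_h : lie_morphism g h.
  split=> [c X Y gX gY|X Y gX gY]; apply: val_inj.
    rewrite /= (hE _ (gP c gX gY)) !hE //.
    by have [[-> //]] := hU.
  rewrite /= (hE _ (gJ gX gY)) !hE //.
  by have [[_ -> //]] := hU.
have [H [HE _]] := hU.2 _ _ lie_h.
have [H0 [_ H0_unique]] := hU.2 U iota hU.1.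
pose k (u : U) : U := sval (H u).
have k_linear : linear k by move=> c u v; rewrite /k linearP.
have k_mul : monoid_morphism k by split=> [|u v]; rewrite /k ?rmorph1 ?rmorphM.
pose K : {lrmorphism U -> U} := HB.pack k
  (GRing.isLinear.Build R U U _ k k_linear) (GRing.isMonoidMorphism.Build U U k k_mul).
have KE : K =1 id.
  move=> u; rewrite H0_unique => [|X gX]; first exact: esym (H0_unique idfun (fun _ _ => erefl) u).
  by rewrite /K /= /k HE // hE.
move=> u; have := KE u; rewrite /K /= /k => <-; apply/asboolP; exact: (valP (H u)).
Qed.

Lemma enveloping_ind (P : U -> Prop) : P 1 ->
  (forall (c : R) u v, P u -> P v -> P (c *: u + v)) ->
  (forall u v, P u -> P v -> P (u * v)) -> (forall X, g X -> P (iota X)) -> forall u, P u.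
Proof. by move=> P1 PP PM Pg; exact: (enveloping_generated (S := Subalgebra P1 PP PM)). Qed.

End EnvelopingInduction.

(** * Grafting and Lie series *)

Section LocalOperators.
Variable R : realType.
Implicit Types (a b x y : fseries R) (u v w : forest) (tau : otree).

(** Such an operator is determined by its values on forests, although a series is not a finite
    combination of forests. *)
Definition local_linear (T : fseries R -> fseries R) : Prop :=
  (forall (c : R) x y, T (c *: x + y) = c *: T x + T y) /\
  (forall x y w, (forall u, (fsize u <= fsize w)%N -> x u = y u) -> T x w = T y w).

Lemma local_linear0 T : local_linear T -> T 0 = 0.
Proof.
move=> [TP _]; have := TP (-1) 0 0.
by rewrite scaler0 addr0 scaleN1r addNr.
Qed.

Lemma local_linear_sum T (I : Type) (r : seq I) (c : I -> R) (x : I -> fseries R) :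
  local_linear T -> T (\sum_(i <- r) c i *: x i) = \sum_(i <- r) c i *: T (x i).
Proof.
move=> lT; elim: r => [|i r IHr]; first by rewrite !big_nil local_linear0.
by rewrite !big_cons lT.1 IHr.
Qed.

Definition forests_upto (m : nat) : seq forest := [seq w | i <- iota 0 m.+1, w <- forests i].

Lemma mem_forests_upto m w : (w \in forests_upto m) = (fsize w <= m)%N.
Proof.
apply/allpairsPdep/idP => [[i [u [+ + ->]]]|le_m].
  by rewrite mem_iota add0n ltnS mem_forests => /= le_m /eqP ->.
by exists (fsize w), w; rewrite mem_iota add0n ltnS le_m mem_forests.
Qed.

Lemma forests_upto_uniq m : uniq (forests_upto m).
Proof.
apply: allpairs_uniq_dep; first exact: iota_uniq.
  by move=> i _; exact: forests_uniq.
move=> _ _ /allpairsPdep[i1 [u1 [_ + ->]]] /allpairsPdep[i2 [u2 [_ + ->]]] /= e.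
by rewrite !mem_forests e => /eqP <- /eqP <-.
Qed.

Lemma truncation (m : nat) x w : (fsize w <= m)%N ->
  (\sum_(u <- forests_upto m) x u *: delta R u) w = x w.
Proof.
move=> le_m; rewrite fct_sumE (bigD1_seq w) ?forests_upto_uniq ?mem_forests_upto //=.
rewrite big1 => [|u nu].
  by rewrite addr0 -[_ w]/(x w * delta R w w) /delta eqxx mulr1.
by rewrite -[LHS]/(x u * delta R u w) /delta eq_sym (negbTE nu) mulr0.
Qed.

Lemma local_linear_eq T1 T2 : local_linear T1 -> local_linear T2 ->
  (forall u, T1 (delta R u) = T2 (delta R u)) -> T1 =1 T2.
Proof.
move=> l1 l2 e x; apply/funext => w.
have tr u : (fsize u <= fsize w)%N -> x u = (\sum_(u <- forests_upto (fsize w)) x u *: delta R u) u.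
  by move=> le; rewrite truncation.
rewrite (l1.2 _ _ _ tr) (l2.2 _ _ _ tr) !local_linear_sum //.
by congr (_ w); apply: eq_bigr => u _; rewrite e.
Qed.

Lemma local_linearD T1 T2 : local_linear T1 -> local_linear T2 ->
  local_linear (fun x => T1 x + T2 x).
Proof.
move=> [l1 e1] [l2 e2]; split=> [c x y|x y w xy].
  by rewrite l1 l2 scalerDr addrACA.
by rewrite -[LHS]/(T1 x w + T2 x w) (e1 _ _ _ xy) (e2 _ _ _ xy).
Qed.

Lemma local_linearN T : local_linear T -> local_linear (fun x => - T x).
Proof.
move=> [l e]; split=> [c x y|x y w xy]; first by rewrite l opprD scalerN.
by rewrite -[LHS]/(- T x w) (e _ _ _ xy).
Qed.

Lemma local_linear_comp T1 T2 : local_linear T1 -> local_linear T2 ->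
  local_linear (fun x => T1 (T2 x)).
Proof.
move=> [l1 e1] [l2 e2]; split=> [c x y|x y w xy]; first by rewrite l2 l1.
apply: e1 => u le; apply: e2 => v le'; apply: xy; exact: leq_trans le.
Qed.

Lemma concat_local a a' b b' w : (forall u, (fsize u <= fsize w)%N -> a u = a' u) ->
  (forall u, (fsize u <= fsize w)%N -> b u = b' u) -> concat a b w = concat a' b' w.
Proof.
move=> ea eb; apply: eq_bigr => i _.
have fw : fsize w = (fsize (take i w) + fsize (drop i w))%N.
  by rewrite /fsize -sumn_cat -map_cat cat_take_drop.
by rewrite ea ?eb // fw ?leq_addl // leq_addr.
Qed.

Lemma local_linear_concatr a : local_linear (concat a).
Proof.
split=> [c x y|x y w xy]; last exact: concat_local.
apply/funext => w; rewrite -[RHS]/(c * concat a x w + concat a y w) /concat mulr_sumr.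
rewrite -big_split; apply: eq_bigr => i _ /=.
by rewrite -[(c *: x + y) _]/(c * x _ + y _) mulrDr mulrCA.
Qed.

Lemma local_linear_concatl b : local_linear ((@concat R)^~ b).
Proof.
split=> [c x y|x y w xy]; last exact: concat_local.
by rewrite concatDl concatZl.
Qed.

Lemma graft_local a a' b b' w : (forall u, (fsize u <= fsize w)%N -> a u = a' u) ->
  (forall u, (fsize u <= fsize w)%N -> b u = b' u) -> graft a b w = graft a' b' w.
Proof.
move=> ea eb; apply: eq_bigr => i _; rewrite !big_seq; apply: eq_bigr => u.
rewrite mem_forests => /eqP ui; rewrite !big_seq; apply: eq_bigr => v.
rewrite mem_forests => /eqP vi; rewrite ea ?eb // ?vi ?leq_subr // ui.
by rewrite -ltnS.
Qed.

Lemma local_linear_graftr a : local_linear (graft a).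
Proof.
split=> [c x y|x y w xy]; last exact: graft_local.
apply/funext => w; rewrite -[RHS]/(c * graft a x w + graft a y w) /graft.
rewrite mulr_sumr -big_split; apply: eq_bigr => i _ /=.
rewrite mulr_sumr -big_split; apply: eq_bigr => u _ /=.
rewrite mulr_sumr -big_split; apply: eq_bigr => v _ /=.
rewrite -[(c *: x + y) _]/(c * x _ + y _); ring.
Qed.

Lemma local_linear_graftl b : local_linear ((@graft R)^~ b).
Proof.
split=> [c x y|x y w xy]; last exact: graft_local.
apply/funext => w; rewrite -[RHS]/(c * graft x b w + graft y b w) /graft.
rewrite mulr_sumr -big_split; apply: eq_bigr => i _ /=.
rewrite mulr_sumr -big_split; apply: eq_bigr => u _ /=.
rewrite mulr_sumr -big_split; apply: eq_bigr => v _ /=.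
rewrite -[(c *: x + y) _]/(c * x _ + y _); ring.
Qed.

Lemma graft_one a : graft (delta R [::]) a = a.
Proof.
have l_id : local_linear (@id (fseries R)) by split=> // x y w; apply.
apply: (local_linear_eq (local_linear_graftr _) l_id) => u; exact: graft_nil_l.
Qed.

Lemma graft_concat tau x y : graft (delta R [:: tau]) (concat x y) =
  concat (graft (delta R [:: tau]) x) y + concat x (graft (delta R [:: tau]) y).
Proof.
set G := graft (delta R [:: tau]).
have lG : local_linear G by exact: local_linear_graftr.
apply: (@local_linear_eq (fun y => G (concat x y))
  (fun y => concat (G x) y + concat x (G y))) => [||v].
- exact: local_linear_comp lG (local_linear_concatr x).
- apply: local_linearD; first exact: local_linear_concatr.
  exact: local_linear_comp (local_linear_concatr x) lG.
apply: (@local_linear_eq (fun x => G (concat x (delta R v)))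
  (fun x => concat (G x) (delta R v) + concat x (G (delta R v)))) => [||u].
- exact: local_linear_comp lG (local_linear_concatl _).
- apply: local_linearD; last exact: local_linear_concatl.
  exact: local_linear_comp (local_linear_concatl _) lG.
by rewrite concat_delta; exact: graft_cat.
Qed.

Lemma graft_cons_series tau w x : graft (delta R (tau :: w)) x =
  graft (delta R [:: tau]) (graft (delta R w) x) - graft (graft1 R tau w) x.
Proof.
apply: (@local_linear_eq (graft (delta R (tau :: w)))
  (fun x => graft (delta R [:: tau]) (graft (delta R w) x) - graft (graft1 R tau w) x)).
- exact: local_linear_graftr.
- apply: local_linearD; last by apply: local_linearN; exact: local_linear_graftr.
  by apply: local_linear_comp; exact: local_linear_graftr.
by move=> u; rewrite graft_cons (graft_delta R [:: tau] w) graft_forest1.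
Qed.

End LocalOperators.

Lemma lie_span_subspace (R : realType) (W : lmodType R) (br : W -> W -> W) (G : set W) :
  lie_subspace br (lie_span br G).
Proof.
split=> [S [[S0 _ _] _]|c x y lx ly S SS|x y lx ly S SS] //.
  by have [[_ SP _] _] := SS; apply: SP; [exact: lx|exact: ly].
by have [[_ _ SB] _] := SS; apply: SB; [exact: lx|exact: ly].
Qed.

Section LieSeries.
Variable R : realType.
Implicit Types (a b x y : fseries R) (u v w : forest) (tau : otree).
Local Notation lie := (@lie_polynomial R).

Lemma lie_subspace_lie : lie_subspace (@concat_bracket R) lie.
Proof. exact: lie_span_subspace. Qed.

Lemma lie_tree tau : lie (delta R [:: tau]).
Proof. by move=> S [_]; apply; exists tau. Qed.

Lemma lie_linear (c : R) x y : lie x -> lie y -> lie (c *: x + y).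
Proof. by have [_ lieP _] := lie_subspace_lie; exact: lieP. Qed.

Lemma lie_sum (I : eqType) (r : seq I) (c : I -> R) (x : I -> fseries R) :
  (forall i, i \in r -> c i != 0 -> lie (x i)) -> lie (\sum_(i <- r) c i *: x i).
Proof.
have [lie0 lieP _] := lie_subspace_lie.
elim: r => [|i r IHr] lx; first by rewrite big_nil.
have lr : lie (\sum_(j <- r) c j *: x j).
  by apply: IHr => j jr; apply: lx; rewrite inE jr orbT.
rewrite big_cons; have [->|ci] := eqVneq (c i) 0; first by rewrite scale0r add0r.
by apply: lieP => //; apply: lx; rewrite ?mem_head.
Qed.

Lemma supported_forest_sum n m a : supported n m a ->
  a = \sum_(u <- forests n) a u *: delta R u.
Proof.
move=> sa; apply/funext => w; rewrite fct_sumE.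
have -> : \sum_(u <- forests n) (a u *: delta R u) w = \sum_(u <- forests n) delta R w u * a u.
  apply: eq_bigr => u _; rewrite mulrC -[LHS]/(a u * delta R u w) /delta eq_sym.
  by [].
by rewrite sum_delta; case: eqP => // nw; apply/eqP; apply: contrapT => /negP/sa[].
Qed.

Lemma lie_supported n a : supported n 1 a -> lie a.
Proof.
move=> sa; rewrite (supported_forest_sum sa); apply: lie_sum => u _ /sa[_].
by case: u => [|t [|]] // _; exact: lie_tree.
Qed.

(** Grafting a tree is a derivation of the concatenation product, hence of the bracket, and it
    maps a tree to a combination of trees. *)
Lemma lie_graft_tree tau x : lie x -> lie (graft (delta R [:: tau]) x).
Proof.
move=> lx; have [lie0 lieP lieB] := lie_subspace_lie.
have lG := local_linear_graftr (delta R [:: tau]).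
pose P : set (fseries R) := [set x | lie x /\ lie (graft (delta R [:: tau]) x)].
suff [] : P x by [].
apply: (lx P); split; first split.
- by split=> //; rewrite (local_linear0 lG).
- move=> c y z [ly lgy] [lz lgz]; split; first exact: lieP.
  by rewrite /= lG.1; exact: lieP.
- move=> y z [ly lgy] [lz lgz]; split; first exact: lieB.
  set G := graft (delta R [:: tau]) in lG lgy lgz *.
  have -> : G (concat_bracket y z) = 1 *: concat_bracket (G y) z + concat_bracket y (G z).
    have -> : concat_bracket y z = (-1) *: concat z y + concat y z.
      by rewrite scaleN1r addrC.
    rewrite lG.1 /G !graft_concat scaleN1r scale1r /concat_bracket addrC opprD.
    by rewrite [- _ - _]addrC addrACA.
  by apply: lieP; exact: lieB.
move=> _ [t _ <-]; split; first exact: lie_tree.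
by rewrite graft_delta graft_forest1; exact: lie_supported (@supported_graft1 R tau [:: t]).
Qed.

(** Grafting a word with several letters reduces to grafting trees one after the other and to
    grafting words with fewer letters. *)
Lemma lie_graft_forest w x : lie x -> lie (graft (delta R w) x).
Proof.
have [k] := ubnP (size w); elim: k w x => // k IHk [|tau w] x; first by rewrite graft_one.
rewrite ltnS /= => lt_k lx; rewrite graft_cons_series addrC -scaleN1r.
apply: lie_linear; last by apply: lie_graft_tree; exact: IHk.
rewrite (supported_forest_sum (@supported_graft1 R tau w)).
rewrite (local_linear_sum _ _ _ (local_linear_graftl x)); apply: lie_sum => u _.
by move=> /(@supported_graft1 R tau w)[_ su]; apply: IHk => //; rewrite su.
Qed.

Lemma component_linear m (c : R) a b :
  component m (c *: a + b) = c *: component m a + component m b.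
Proof.
apply/funext => w; rewrite -[RHS]/(c * component m a w + component m b w) /component.
by case: ifP => // _; rewrite mulr0 addr0.
Qed.

Lemma lie_series_linear (c : R) a b : lie_series a -> lie_series b -> lie_series (c *: a + b).
Proof. by move=> la lb m; rewrite component_linear; apply: lie_linear. Qed.

Lemma component_graft m a b : component m (graft a b) =
  \sum_(i < m.+1) \sum_(u <- forests i) a u *: graft (delta R u) (component (m - i) b).
Proof.
apply/funext => w; rewrite fct_sumE.
under eq_bigr => i _ do rewrite fct_sumE.
have termE (i : nat) u : u \in forests i ->
    (a u *: graft (delta R u) (component (m - i) b)) w =
    if (i <= fsize w)%N then
      \sum_(v <- forests (fsize w - i)) a u * component (m - i) b v * graft_forest R u v w
    else 0.
  rewrite mem_forests => /eqP ui; rewrite -[LHS]/(a u * graft _ _ w) graft_l /extend ui.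
  case: ifP => _; last exact: mulr0.
  by rewrite mulr_sumr; apply: eq_bigr => v _; exact: mulrA.
rewrite /component; case: eqP => [wm|nwm].
  rewrite /graft wm; apply: eq_bigr => i _; rewrite !big_seq; apply: eq_bigr => u ui.
  rewrite termE // wm -ltnS ltn_ord !big_seq; apply: eq_bigr => v.
  by rewrite mem_forests /component => ->.
rewrite big1 // => i _; rewrite big_seq big1 // => u ui; rewrite termE //; case: ifP => // iw.
rewrite big_seq big1 // => v; rewrite mem_forests => /eqP vE; rewrite /component vE.
case: eqP => [e|]; last by rewrite mulr0 mul0r.
case: nwm; rewrite -(subnK iw) e subnK //.
by rewrite -ltnS.
Qed.

Lemma lie_series_graft a b : lie_series b -> lie_series (graft a b).
Proof.
move=> lb m; rewrite component_graft.
rewrite (_ : \sum_(i < m.+1) _ = \sum_(i < m.+1) 1 *: \sum_(u <- forests i)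
  a u *: graft (delta R u) (component (m - i) b)).
  apply: lie_sum => i _ _; apply: lie_sum => u _ _; apply: lie_graft_forest; exact: lb.
by apply: eq_bigr => i _; rewrite scale1r.
Qed.

Lemma lie_nil x : lie x -> x [::] = 0.
Proof.
move=> lx; apply: (lx [set x | x [::] = 0]); split; first split=> //=.
- move=> c y z y0 z0.
  by rewrite -[LHS]/(c * y [::] + z [::]) y0 z0 mulr0 addr0.
- move=> y z y0 z0.
  by rewrite -[LHS]/(concat y z [::] - concat z y [::]) !concat_nil y0 z0 !mul0r subrr.
by move=> _ [t _ <-].
Qed.

Lemma lie_series_nil a : lie_series a -> a [::] = 0.
Proof. by move=> /(_ 0%N)/lie_nil. Qed.

End LieSeries.

Section BilinearExtension.
Variable R : realType.
Implicit Types (a b : fseries R) (u v w : forest).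

(** The extension to series of a bilinear operation that adds the numbers of vertices. *)
Definition bilinear_ext (K : forest -> forest -> fseries R) a b : fseries R := fun w =>
  \sum_(i < (fsize w).+1) \sum_(u <- forests i) \sum_(v <- forests (fsize w - i))
    a u * b v * K u v w.

Lemma fsize_cat u v : fsize (u ++ v) = (fsize u + fsize v)%N.
Proof. by rewrite /fsize map_cat sumn_cat. Qed.

Lemma eq_cat_take u v w : (w == u ++ v) = (u == take (size u) w) && (v == drop (size u) w).
Proof.
apply/eqP/andP => [->|[/eqP eu /eqP ev]]; first by rewrite take_size_cat // drop_size_cat.
by rewrite ev {1}eu cat_take_drop.
Qed.

(** In this form concatenation and grafting are evaluated by the same computation. A forest of
    size k has k + 1 decompositions u ++ v, one for each prefix. *)
Lemma concat_bilinear_ext a b : concat a b = bilinear_ext (fun u v => delta R (u ++ v)) a b.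
Proof.
apply/funext => w.
have inner (i : nat) u : (i <= fsize w)%N -> u \in forests i ->
    \sum_(v <- forests (fsize w - i)) a u * b v * delta R (u ++ v) w =
    if u == take (size u) w then a u * b (drop (size u) w) else 0.
  move=> iw; rewrite mem_forests => /eqP ui.
  under eq_bigr => v _ do rewrite /delta eq_cat_take mulrC.
  case: eqP => [ut|_]; last by apply: big1 => v _; rewrite mul0r.
  have := sum_delta (fsize w - i) (drop (size u) w) (fun v => a u * b v).
  rewrite /delta => ->; case: eqP => // nd; case: nd.
  by rewrite -{2}(cat_take_drop (size u) w) fsize_cat -ut ui addKn.
have -> : bilinear_ext (fun u v => delta R (u ++ v)) a b w =
    \sum_(u <- forests_upto (fsize w))
      if u == take (size u) w then a u * b (drop (size u) w) else 0.
  rewrite /forests_upto big_allpairs_dep -[iota 0 _]/(index_iota 0 (fsize w).+1) big_mkord.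
  apply: eq_bigr => i _; rewrite !big_seq; apply: eq_bigr => u ui.
  by rewrite inner // -ltnS.
rewrite -big_mkcond -big_filter (perm_big [seq take j w | j <- iota 0 (size w).+1]).
  rewrite big_map -[iota 0 _]/(index_iota 0 (size w).+1) big_mkord.
  by apply: eq_bigr => j _; rewrite size_takel // -ltnS.
apply: uniq_perm; first by apply: filter_uniq; exact: forests_upto_uniq.
  rewrite map_inj_in_uniq ?iota_uniq // => j k; rewrite !mem_iota add0n !ltnS /= => jw kw e.
  by rewrite -(size_takel jw) e size_takel.
move=> u; rewrite mem_filter mem_forests_upto; apply/andP/mapP => [[/eqP -> _]|[j]].
  exists (minn (size u) (size w)); last first.
    by case: leqP => // /ltnW/take_oversize ->; rewrite take_size.
  by rewrite mem_iota add0n ltnS geq_minr.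
rewrite mem_iota add0n ltnS /= => jw ->; rewrite size_takel // eqxx; split=> //.
by rewrite -{2}(cat_take_drop j w) fsize_cat leq_addr.
Qed.

Lemma graft_bilinear_ext a b : graft a b = bilinear_ext (@graft_forest R) a b.
Proof. by []. Qed.

End BilinearExtension.

(** * Solving the substitution equation *)

Section InverseSubstitution.
Variable R : realType.
Implicit Types (a b x y : fseries R) (u v w : forest).

Lemma subst_forest_cons b u1 u2 :
  subst_forest b (Node u1 :: u2) = concat (graft (subst_forest b u1) b) (subst_forest b u2).
Proof. exact: dalg_eval_cons. Qed.

Lemma subst_forest_node b u : subst_forest b [:: Node u] = graft (subst_forest b u) b.
Proof. by rewrite subst_forest_cons concat1r. Qed.

Lemma subst_forest_bullet b : subst_forest b [:: bullet] = b.
Proof. by rewrite subst_forest_node; exact: graft_one. Qed.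

Lemma graft_nil a b : b [::] = 0 -> graft a b [::] = 0.
Proof.
move=> b0; apply: big1 => i _; apply: big1 => u _; rewrite big_seq; apply: big1 => v.
by rewrite mem_forests sub0n; case: v => [|[v] ?] //; rewrite b0 mulr0 mul0r.
Qed.

Lemma subst_forest_nil b u : b [::] = 0 -> u != [::] -> subst_forest b u [::] = 0.
Proof.
by case: u => [//|[u1] u2] b0 _; rewrite subst_forest_cons concat_nil graft_nil // mul0r.
Qed.

Section Agreement.
Variables (m : nat) (b b' : fseries R).
Hypothesis bb' : forall w, (fsize w < m)%N -> b w = b' w.

Lemma subst_forest_agree u w : (fsize w < m)%N -> subst_forest b u w = subst_forest b' u w.
Proof.
have [k] := ubnP (fsize u); elim: k u w => // k IHk [|[u1] u2] w; first by [].
rewrite fsize_cons ltnS => lt_k lt_m; rewrite !subst_forest_cons.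
apply: concat_local => v le; last first.
  by apply: IHk; [apply: leq_ltn_trans lt_k; rewrite leq_addl|exact: leq_ltn_trans lt_m].
apply: graft_local => v' le'; last by apply: bb'; apply: leq_ltn_trans lt_m; exact: leq_trans le.
apply: IHk; first by apply: leq_ltn_trans lt_k; rewrite leq_addr.
by apply: leq_ltn_trans lt_m; exact: leq_trans le.
Qed.

Hypotheses (b0 : b [::] = 0) (b'0 : b' [::] = 0).

(** Agreement in degrees < m improves by one degree: as u is not empty, neither subst_forest b u
    nor b has a constant term, so that either factor contributes at least one vertex. *)
Lemma graft_subst_agree u w : u != [::] -> (fsize w <= m)%N ->
  graft (subst_forest b u) b w = graft (subst_forest b' u) b' w.
Proof.
move=> u0 le_m; apply: eq_bigr => i _; rewrite !big_seq; apply: eq_bigr => w1.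
rewrite mem_forests => /eqP e1; rewrite !big_seq; apply: eq_bigr => w2.
rewrite mem_forests => /eqP e2; congr (_ * _).
case: w1 e1 => [|t1 w1] e1.
  by rewrite (subst_forest_nil b0 u0) (subst_forest_nil b'0 u0) !mul0r.
case: w2 e2 => [|t2 w2] e2; first by rewrite b0 b'0 !mulr0.
have i0 : (0 < i)%N by rewrite -e1; case: (t1).
have w20 : (0 < fsize w - i)%N by rewrite -e2; case: (t2).
have iw : (i < fsize w)%N by rewrite -subn_gt0.
congr (_ * _).
  by apply: subst_forest_agree; rewrite e1; exact: leq_trans le_m.
apply: bb'; rewrite e2; apply: leq_trans le_m.
by rewrite ltn_subrL i0 (leq_ltn_trans _ iw).
Qed.

End Agreement.

(** This holds of gamma_exact - bullet. Substitution into such a tree B^+(u) grafts a series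
    without constant term onto beta, so that a component of the result involves components of
    beta of lower degree only. *)
Definition higher_trees (c : fseries R) : Prop :=
  forall w, c w != 0 -> exists2 u, u != [::] & w = [:: Node u].

Lemma subst_forests_upto b (c : fseries R) w : subst b c w =
  \sum_(u <- forests_upto (fsize w)) c u * subst_forest b u w.
Proof.
rewrite big_allpairs_dep /subst.
rewrite -(big_mkord xpredT (fun i => \sum_(u <- forests i) c u * subst_forest b u w)).
by rewrite /index_iota subn0.
Qed.

Lemma substD b c c' : subst b (c + c') = subst b c + subst b c'.
Proof.
apply/funext => w; rewrite -[RHS]/(subst b c w + subst b c' w) !subst_forests_upto.
by rewrite -big_split; apply: eq_bigr => u _; exact: mulrDl.
Qed.

Lemma subst_bullet b : b [::] = 0 -> subst b (delta R [:: bullet]) = b.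
Proof.
move=> b0; apply/funext => w; rewrite /subst.
case: w => [|t w]; first by rewrite big_ord_recl big_ord0 big_seq1 mul0r addr0.
have lt1 : (1 < (fsize (t :: w)).+1)%N by case: t.
rewrite (bigD1 (Ordinal lt1)) //= [X in _ + X]big1 => [|i ni].
  by rewrite (sum_delta _ _ (fun u => subst_forest b u (t :: w))) eqxx subst_forest_bullet addr0.
rewrite (sum_delta _ _ (fun u => subst_forest b u (t :: w))); case: eqP => // e.
by case/eqP: ni; apply: val_inj; rewrite /= -e.
Qed.

Lemma subst_nil b (c : fseries R) : c [::] = 0 -> subst b c [::] = 0.
Proof. by move=> c0; rewrite /subst big_ord_recl big_ord0 big_seq1 c0 mul0r addr0. Qed.

Lemma lie_series_subst b c : lie_series b -> higher_trees c -> lie_series (subst b c).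
Proof.
move=> lb cH m.
have -> : component m (subst b c) =
    \sum_(u <- forests_upto m) c u *: component m (subst_forest b u).
  apply/funext => w; rewrite fct_sumE /component; case: eqP => [<-|nw].
    rewrite subst_forests_upto; apply: eq_bigr => u _.
    by rewrite -[RHS]/(c u * component (fsize w) _ w) /component eqxx.
  rewrite big1 // => u _; rewrite -[LHS]/(c u * component m _ w) /component.
  by case: eqP => //; rewrite mulr0.
apply: lie_sum => u _ /cH[v _ ->]; rewrite subst_forest_node.
exact: lie_series_graft.
Qed.

Section Inverse.
Variables (alpha c : fseries R).
Hypotheses (lie_alpha : lie_series alpha) (cH : higher_trees c).

Let step b : fseries R := -1 *: subst b c + alpha.

Let c0 : c [::] = 0.
Proof. by apply/eqP; apply: contrapT => /negP/cH[]. Qed.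

Let step_nil b : step b [::] = 0.
Proof.
by rewrite -[LHS]/(-1 * subst b c [::] + alpha [::]) subst_nil // lie_series_nil // mulr0 addr0.
Qed.

Let step_agree m b b' : b [::] = 0 -> b' [::] = 0 -> (forall w, (fsize w < m)%N -> b w = b' w) ->
  forall w, (fsize w <= m)%N -> step b w = step b' w.
Proof.
move=> b0 b'0 bb' w le_m.
rewrite -[LHS]/(-1 * subst b c w + alpha w) -[RHS]/(-1 * subst b' c w + alpha w).
congr (-1 * _ + _); rewrite !subst_forests_upto; apply: eq_bigr => u _.
have [->|/cH[v v0 ->]] := eqVneq (c u) 0; first by rewrite !mul0r.
by rewrite !subst_forest_node (graft_subst_agree bb').
Qed.

Let iter_nil k b : b [::] = 0 -> iter k step b [::] = 0.
Proof. by case: k => [//|k] _; exact: step_nil. Qed.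

Let iter_agree k b b' : b [::] = 0 -> b' [::] = 0 ->
  forall w, (fsize w < k)%N -> iter k step b w = iter k step b' w.
Proof.
move=> b0 b'0; elim: k => [//|k IHk] w; rewrite ltnS /=.
by apply: step_agree => //; exact: iter_nil.
Qed.

(** The components of beta are determined one degree after the other by the equation
    beta = alpha - subst beta c. The iterates remain Lie series since grafting anything onto a
    Lie series gives a Lie series. *)
Lemma subst_fixpoint : exists beta, [/\ lie_series beta, beta [::] = 0 &
  beta + subst beta c = alpha].
Proof.
pose beta w := iter (fsize w).+1 step 0 w.
have betaE k w : (fsize w < k)%N -> beta w = iter k step 0 w.
  move=> lt_k; rewrite /beta -(subnKC lt_k) iterD.
  by apply: iter_agree => //; exact: iter_nil.
have lie_step b : lie_series b -> lie_series (step b).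
  by move=> lb; apply: lie_series_linear => //; exact: lie_series_subst.
have lie_iter k : lie_series (iter k step 0).
  elim: k => [|k IHk]; last exact: lie_step.
  move=> m; have [lie0 _ _] := @lie_subspace_lie R.
  by rewrite (_ : component m 0 = 0) //; apply/funext => w; rewrite /component if_same.
have beta0 : beta [::] = 0 by exact: (step_nil 0).
exists beta; split=> //.
  move=> m; rewrite (_ : component m beta = component m (iter m.+1 step 0)).
    exact: lie_iter.
  by apply/funext => w; rewrite /component; case: eqP => // wm; rewrite (betaE m.+1) // wm.
apply/funext => w; rewrite -[LHS]/(beta w + subst beta c w).
have -> : beta w = step beta w.
  apply: (@step_agree (fsize w)) => // [|v lt]; first exact: iter_nil.
  exact/esym/betaE.
by rewrite -[step _ _]/(-1 * subst beta c w + alpha w) mulN1r addrAC addNr add0r.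
Qed.

End Inverse.

Lemma gamma_exact_supp w : gamma_exact R w != 0 -> exists u, w = [:: Node u].
Proof.
rewrite gamma_exact_fixpoint /exact_step /Yinv.
by case: w => [|[u] [|t w]] /=; rewrite ?mulr0 ?eqxx //; exists u.
Qed.

Lemma gamma_exact_bullet : gamma_exact R [:: bullet] = 1.
Proof.
rewrite gamma_exact_fixpoint /exact_step /Yinv /= /Qseries big_ord_recl big_ord0 addr0.
rewrite /Qn /= big_seq1 big_nil.
by rewrite -[X in _ * X]/((0`!%:R)^-1 * delta R [::] [::]) /delta eqxx fact0 invr1 !mulr1.
Qed.

Lemma subst_gamma_exact_inverse (alpha : fseries R) : lie_series alpha ->
  exists beta, [/\ lie_series beta, beta [::] = 0 & subst beta (gamma_exact R) = alpha].
Proof.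
move=> la; (* As subst beta bullet = beta, the equation to solve is beta + subst beta c = alpha. *)
pose c := gamma_exact R - delta R [:: bullet].
have cH : higher_trees c.
  move=> w; rewrite -[c w]/(gamma_exact R w - delta R [:: bullet] w) /delta.
  have [->|nw] := eqVneq w [:: bullet]; first by rewrite gamma_exact_bullet subrr eqxx.
  rewrite subr0 => /gamma_exact_supp[u wE]; exists u => //.
  by apply: contra_neq nw => u0; rewrite wE u0.
have [beta [lb b0 bE]] := subst_fixpoint la cH.
exists beta; split=> //.
have -> : gamma_exact R = delta R [:: bullet] + c by rewrite addrC subrK.
by rewrite substD subst_bullet.
Qed.

End InverseSubstitution.

(** * The action of the enveloping algebra on smooth functions *)

Record submodule (R : realType) (W : lmodType R) := Submodule {
  submod_set : set W;
  submod_closed0 : submod_set 0;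
  submod_closedP : forall (c : R) x y, submod_set x -> submod_set y -> submod_set (c *: x + y)
}.

Section SubmoduleType.
Variables (R : realType) (W : lmodType R) (S : submodule W).

Definition submod_pred : pred W := fun x => `[< submod_set S x >].

Lemma submod_predP : GRing.subsemimod_closed submod_pred.
Proof.
apply: GRing.submod_closed_semi; split=> [|c x y /asboolP Sx /asboolP Sy]; apply/asboolP.
- exact: submod_closed0.
- exact: submod_closedP.
Qed.

HB.instance Definition _ := GRing.isSubmodClosed.Build R W submod_pred submod_predP.

Definition submod_type := {x : W | submod_pred x}.
HB.instance Definition _ := [isSub of submod_type for @sval _ _].
HB.instance Definition _ := [Choice of submod_type by <:].
HB.instance Definition _ := [SubChoice_isSubLmodule of submod_type by <:].
End SubmoduleType.

Section SmoothAction.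
Variables (R : realType) (n : nat) (M : manifold R n).
Variables (g : set (M -> 'rV[R]_n)) (U : algType R) (iota : (M -> 'rV[R]_n) -> U).
Hypothesis hU : is_enveloping g iota.
Hypothesis g0 : g 0.
Hypothesis gP : forall (c : R) X Y, g X -> g Y -> g (c *: X + Y).
Hypothesis gJ : forall X Y, g X -> g Y -> g (jacobi X Y).
Hypothesis gS : forall X, g X -> smooth_vfield X.

(** The derivations satisfy the required identities on smooth functions only, that is on a
    submodule S of the module of all functions. *)
Lemma submodule_action (W : lmodType R) (S : submodule W) (rho : (M -> 'rV[R]_n) -> W -> W) :
  (forall X x, g X -> submod_set S x -> submod_set S (rho X x)) ->
  (forall X (c : R) x y, g X -> submod_set S x -> submod_set S y ->
     rho X (c *: x + y) = c *: rho X x + rho X y) ->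
  (forall c X Y x, g X -> g Y -> submod_set S x -> rho (c *: X + Y) x = c *: rho X x + rho Y x) ->
  (forall X Y x, g X -> g Y -> submod_set S x ->
     rho (jacobi X Y) x = rho X (rho Y x) - rho Y (rho X x)) ->
  exists act : U -> W -> W, forall x, submod_set S x -> [/\
    forall (c : R) u v, act (c *: u + v) x = c *: act u x + act v x,
    act 1 x = x,
    forall u v, act (u * v) x = act u (act v x),
    forall X, g X -> act (iota X) x = rho X x
    & forall u, submod_set S (act u x)].
Proof.
move=> rhoS rho_lin rho_add rho_jac.
have SP (x : submod_type S) : submod_set S (sval x) by apply/asboolP; exact: (valP x).
have Sb x : submod_set S x -> submod_pred S x by move=> Sx; apply/asboolP.
pose sub x (Sx : submod_set S x) : submod_type S := exist (fun x => submod_pred S x) x (Sb x Sx).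
pose r X (x : submod_type S) : submod_type S :=
  if pselect (g X) is left gX then sub _ (rhoS X _ gX (SP x)) else 0.
have rE X x : g X -> sval (r X x) = rho X (sval x) by rewrite /r; case: pselect.
have [|||||act [actD actL act1 actM actg]] := @enveloping_action _ _ _ g U iota hU _ r.
- move=> X gX c x y; apply: val_inj.
  by rewrite /= !rE //= rho_lin //; exact: SP.
- move=> c X Y x gX gY; apply: val_inj.
  by rewrite /= !rE //; [apply: rho_add => //; exact: SP|exact: gP].
- move=> X Y x gX gY; apply: val_inj.
  by rewrite /= !rE //; [apply: rho_jac => //; exact: SP|exact: gJ].
- exact: gP.
- exact: gJ.
pose a u x := if pselect (submod_set S x) is left Sx then sval (act u (sub x Sx)) else x.
have aE u x (Sx : submod_set S x) : a u x = sval (act u (sub x Sx)).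
  by rewrite /a; case: pselect => // Sx'; congr (sval (act u _)); apply: val_inj.
exists a => x Sx; split=> [c u v||u v|X gX|u].
- by rewrite !(aE _ x Sx) actD.
- by rewrite (aE _ x Sx) act1.
- rewrite !(aE _ x Sx) actM (aE u _ (SP _)).
  by congr (sval (act u _)); apply: val_inj.
- by rewrite (aE _ x Sx) actg // rE.
- by rewrite (aE _ x Sx); exact: SP.
Qed.

(** Besides U-valued functions, those with values in g are acted upon in this sense. *)
Definition is_smooth_action (W : lmodType R) (L : set W) (act : U -> (M -> W) -> (M -> W)) : Prop :=
  forall F, smooth_into L F -> [/\
    forall (c : R) u v, act (c *: u + v) F = c *: act u F + act v F,
    act 1 F = F,
    forall u v, act (u * v) F = act u (act v F),
    forall X, g X -> act (iota X) F = lie_derive X F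
    & forall u, smooth_into L (act u F)].

Lemma smooth_action_exists (W : lmodType R) (L : set W) :
  exists act : U -> (M -> W) -> (M -> W), is_smooth_action L act.
Proof.
pose S := Submodule (@smooth_into0 R n M W L) (fun c F G sF sG => (smooth_into_linear c sF sG).1).
apply: (@submodule_action _ S (fun X F => lie_derive X F)).
- by move=> X F gX; apply: smooth_lie_derive; exact: gS.
- by move=> X c F G gX sF sG; apply: (smooth_into_linear c sF sG).2; exact: gS.
- by move=> c X Y F gX gY sF; apply: (lie_derive_vfield_linear _ _ _ sF); exact: gS.
- by move=> X Y F gX gY sF; apply: (lie_derive_jacobi _ _ sF); exact: gS.
Qed.

Section Freeze.
Variables (W : lmodType R) (L : set W) (act : U -> (M -> W) -> (M -> W)).
Hypothesis act_action : is_smooth_action L act.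
Hypothesis LZ : forall (c : R) w, L w -> L (c *: w).

Lemma action_sum (m : nat) (x : 'I_m -> R) (u : 'I_m -> U) F : smooth_into L F ->
  act (\sum_i x i *: u i) F = \sum_i x i *: act (u i) F.
Proof.
move=> sF; have [actD _ _ _ _] := act_action sF.
have act0 : act 0 F = 0.
  have := actD 1 0 0; rewrite !scale1r addr0 => /eqP.
  by rewrite -subr_eq0 opprD addrA subrr sub0r oppr_eq0 => /eqP.
elim: m x u => [|m IHm] x u; first by rewrite !big_ord0.
by rewrite !big_ord_recl actD IHm.
Qed.

(** Near a point h is a sum of terms phi *: u with u constant, and for such a term the Leibniz
    rule separates the derivative of phi from that of act u k. *)
Lemma freeze_smooth (h : M -> U) (k : M -> W) :
  smooth_into setT h -> smooth_into L k ->
  smooth_into L (fun q => act (h q) k q) /\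
  forall X p, smooth_vfield X -> lie_derive X (fun q => act (h q) k q) p =
    act (lie_derive X h p) k p + lie_derive X (act (h p) k) p.
Proof.
move=> /smooth_intoP sh sk; have [_ _ _ _ act_s] := act_action sk.
have loc p : smooth_near L (fun q => act (h q) k q) p /\
    forall X, smooth_vfield X -> lie_derive X (fun q => act (h q) k q) p =
      act (lie_derive X h p) k p + lie_derive X (act (h p) k) p.
  have [A [m [phi [u [Ap r]]]]] := sh p; have [oA sphi _ hE] := r.
  have sumE (x : 'I_m -> R) q : act (\sum_i x i *: u i) k q = \sum_i x i *: act (u i) k q.
    by rewrite action_sum // fct_sumE.
  have near_u i : smooth_near L (act (u i) k) p by exact: (smooth_intoP _ _).1 (act_s _) p.
  have near_term i := smooth_near_scale oA Ap (sphi i) LZ (near_u i).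
  pose G := \sum_i (fun q => phi i q *: act (u i) k q).
  have [near_G dG] := smooth_near_sum (index_enum 'I_m) (fun i => (near_term i).1).
  have GE : {in A, G =1 (fun q => act (h q) k q)}.
    by move=> q; rewrite inE => Aq; rewrite /G fct_sumE hE // sumE.
  have [near_f df] := smooth_near_eq oA Ap GE near_G.
  split=> // X sX; rewrite -df // dG //.
  rewrite (lie_derive_rep sX r Ap) sumE (hE p Ap) action_sum //.
  have cst_term i := smooth_near_scale oA Ap (smooth_on_cst A (phi i p)) LZ (near_u i).
  have [_ dC] := smooth_near_sum (index_enum 'I_m) (fun i => (cst_term i).1).
  have -> : lie_derive X (\sum_i phi i p *: act (u i) k) p =
      \sum_i lie_derive X (fun q => cst (phi i p) q *: act (u i) k q) p by exact: dC.
  rewrite -big_split /=; apply: eq_bigr => i _.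
  rewrite (near_term i).2 //; congr (_ + _).
  by rewrite (cst_term i).2 // vderive_cst scale0r add0r.
split; first by apply/smooth_intoP => p; exact: (loc p).1.
by move=> X p; exact: (loc p).2.
Qed.

End Freeze.

Notation act := (Uact g iota).

Lemma Uact_is_action : is_action g iota act.
Proof.
have [a aP] := smooth_action_exists (setT : set U).
by apply: xgetPex; exists a => F /aP[].
Qed.

(** The axioms of an action do not mention smoothness of the result. It holds for the action of
    g, and U is generated by iota(g). *)
Lemma Uact_smooth_action : is_smooth_action (setT : set U) act.
Proof.
move=> F sF; have [aP a1 aM ag] := Uact_is_action sF; split=> //.
have H : forall u, forall F, smooth_into setT F -> smooth_into setT (act u F).
  apply: (enveloping_ind hU gP gJ) => [G sG|c u v Hu Hv G sG|u v Hu Hv G sG|X gX G sG];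
    have [bP b1 bM bg] := Uact_is_action sG.
  - by rewrite b1.
  - by rewrite bP; apply: (smooth_into_linear c (Hu _ sG) (Hv _ sG)).1.
  - by rewrite bM; apply/Hu/Hv.
  - by rewrite bg //; apply: smooth_lie_derive => //; exact: gS.
by move=> u; exact: H.
Qed.

Lemma Uact_linear u (c : R) F G : smooth_into setT F -> smooth_into setT G ->
  act u (c *: F + G) = c *: act u F + act u G.
Proof.
move=> sF sG; move: u F G sF sG.
apply: (enveloping_ind hU gP gJ) =>
  [F G sF sG|a u v Hu Hv F G sF sG|u v Hu Hv F G sF sG|X gX F G sF sG].
all: have sP := (smooth_into_linear c sF sG).1.
all: have [[aP a1 aM ag sa] [bP b1 bM bg sb]] := (Uact_smooth_action sF, Uact_smooth_action sG).
all: have [cP c1 cM cg sc] := Uact_smooth_action sP.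
- by rewrite c1 a1 b1.
- rewrite cP aP bP Hu // Hv // !scalerDr !scalerA [a * c]mulrC -!addrA.
  by congr (_ + _); rewrite addrCA.
- by rewrite cM aM bM Hv // Hu.
- by rewrite cg // ag // bg // (smooth_into_linear c sF sG).2 //; exact: gS.
Qed.

Lemma iota0 : iota 0 = 0.
Proof.
have [[iP _] _] := hU; have := iP 1 0 0 g0 g0; rewrite !scale1r addr0 => /eqP.
by rewrite -subr_eq0 opprD addrA subrr sub0r oppr_eq0 => /eqP.
Qed.

Lemma iota_sum (m : nat) (x : 'I_m -> R) (X : 'I_m -> (M -> 'rV[R]_n)) :
  (forall i, g (X i)) -> g (\sum_i x i *: X i) /\
  iota (\sum_i x i *: X i) = \sum_i x i *: iota (X i).
Proof.
move=> gX; have [[iP _] _] := hU.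
elim: m x X gX => [|m IHm] x X gX; first by rewrite !big_ord0 iota0.
have [gS' iS'] := IHm (fun i => x (lift ord0 i)) _ (fun i => gX (lift ord0 i)).
by rewrite !big_ord_recl; split; [exact: gP|rewrite iP // iS'].
Qed.

Lemma smooth_iota (F : M -> (M -> 'rV[R]_n)) : smooth_into g F ->
  smooth_into setT (iota \o F) /\
  forall X, smooth_vfield X -> lie_derive X (iota \o F) = iota \o lie_derive X F.
Proof.
apply: smooth_into_map => // m x X gX.
by have [_] := iota_sum x gX.
Qed.

Lemma smooth_into_val (F : M -> (M -> 'rV[R]_n)) p : smooth_into g F -> g (F p).
Proof.
move=> /smooth_intoP/(_ p)[A [m [phi [X [Ap [_ _ gX ->//]]]]]].
exact: (iota_sum _ gX).1.
Qed.

(** The functions with values in g carry an action of U of their own, and iota intertwines it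
    with the action on U-valued functions. Choosing preimages under iota point by point instead
    would not give a smooth function, as a preimage is not known to be unique. *)
Lemma frozen_act_vfield (h : M -> U) (F : M -> (M -> 'rV[R]_n)) :
  smooth_into setT h -> smooth_into g F ->
  exists2 G, smooth_into g G & frozen_act g iota h (iota \o F) = iota \o G.
Proof.
move=> sh sF; have [vact vactP] := smooth_action_exists g.
have gZ (c : R) X : g X -> g (c *: X) by move=> gX; rewrite -[_ *: _]addr0; exact: gP.
have [sG _] := freeze_smooth vactP gZ sh sF.
exists (fun q => vact (h q) F q) => //; apply/funext => q.
suff H : forall u, forall F, smooth_into g F -> act u (iota \o F) = iota \o vact u F.
  by rewrite /frozen_act H.
have [[iP _] _] := hU.
clear sG sF F.
apply: (enveloping_ind hU gP gJ) => [F sF|c u v Hu Hv F sF|u v Hu Hv F sF|X gX F sF].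
all: have [[aP a1 aM ag sa] [bP b1 bM bg sb]] :=
  (Uact_smooth_action (smooth_iota sF).1, vactP _ sF).
- by rewrite a1 b1.
- rewrite aP bP Hu // Hv //; apply/funext => p.
  by rewrite -[RHS]/(iota (c *: vact u F p + vact v F p)) iP //; apply: smooth_into_val.
- by rewrite aM bM Hv // Hu.
- by rewrite ag // bg //; apply: (smooth_iota sF).2; exact: gS.
Qed.

Lemma smooth_mul (h k : M -> U) : smooth_into setT h -> smooth_into setT k ->
  smooth_into setT (h * k) /\ forall X p, smooth_vfield X ->
    lie_derive X (h * k) p = lie_derive X h p * k p + h p * lie_derive X k p.
Proof.
have bil m m' (x : 'I_m -> R) (y : 'I_m' -> R) (v : 'I_m -> U) (w : 'I_m' -> U) :
    (forall i, setT (v i)) -> (forall j, setT (w j)) ->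
    (\sum_i x i *: v i) * (\sum_j y j *: w j) = \sum_i \sum_j (x i * y j) *: (v i * w j).
  move=> _ _; rewrite mulr_suml; apply: eq_bigr => i _; rewrite mulr_sumr.
  by apply: eq_bigr => j _; rewrite -scalerAl -scalerAr scalerA.
move=> sh sk; split; first exact: (smooth_into_bilinear bil).
move=> X p sX; have := smooth_near_bilinear bil (L3 := setT) (fun _ _ _ _ => I)
  ((smooth_intoP _ _).1 sh p) ((smooth_intoP _ _).1 sk p).
by move=> [_ d]; exact: d.
Qed.

Lemma frozen_act_smooth (h k : M -> U) : smooth_into setT h -> smooth_into setT k ->
  smooth_into setT (frozen_act g iota h k).
Proof. by move=> sh sk; exact: (freeze_smooth Uact_smooth_action _ sh sk).1. Qed.

Lemma frozen_act_linearl (c : R) (h h' k : M -> U) : smooth_into setT k ->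
  frozen_act g iota (c *: h + h') k = c *: frozen_act g iota h k + frozen_act g iota h' k.
Proof.
move=> sk; have [aP _ _ _ _] := Uact_smooth_action sk; apply/funext => p.
by rewrite /frozen_act -[(_ + _) p]/(c *: h p + h' p) aP.
Qed.

Lemma frozen_act_linearr (c : R) (h k k' : M -> U) : smooth_into setT k -> smooth_into setT k' ->
  frozen_act g iota h (c *: k + k') = c *: frozen_act g iota h k + frozen_act g iota h k'.
Proof. by move=> sk sk'; apply/funext => p; rewrite /frozen_act Uact_linear. Qed.

Lemma frozen_act1 (k : M -> U) : smooth_into setT k -> frozen_act g iota 1 k = k.
Proof.
move=> sk; have [_ a1 _ _ _] := Uact_smooth_action sk; apply/funext => p.
by rewrite /frozen_act a1.
Qed.

Section FrozenVectorField.
Variable F : M -> (M -> 'rV[R]_n).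
Hypothesis sF : smooth_into g F.

Let gF p : g (F p). Proof. exact: smooth_into_val. Qed.

Lemma frozen_act_iota (k : M -> U) p : smooth_into setT k ->
  frozen_act g iota (iota \o F) k p = lie_derive (F p) k p.
Proof. by move=> sk; have [_ _ _ ag _] := Uact_smooth_action sk; rewrite /frozen_act ag. Qed.

Lemma frozen_act_one : frozen_act g iota (iota \o F) 1 = 0.
Proof.
apply/funext => p; rewrite frozen_act_iota; last exact: (smooth_into_cst (w := 1 : U)).
have r : smooth_rep setT (1 : M -> U) setT (fun _ : unit => cst 1) (fun _ => 1 : U).
  split=> // [|i|q _]; [exact: openT|exact: smooth_on_cst|].
  by rewrite big_const card_unit /= addr0 scale1r.
rewrite (lie_derive_rep (gS (gF p)) r) // big1 // => i _.
by rewrite vderive_cst scale0r.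
Qed.

Lemma frozen_act_mul (h k : M -> U) : smooth_into setT h -> smooth_into setT k ->
  frozen_act g iota (iota \o F) (h * k) =
  frozen_act g iota (iota \o F) h * k + h * frozen_act g iota (iota \o F) k.
Proof.
move=> sh sk; have [shk d] := smooth_mul sh sk; apply/funext => p.
rewrite -[RHS]/(frozen_act g iota (iota \o F) h p * k p
  + h p * frozen_act g iota (iota \o F) k p).
by rewrite !frozen_act_iota // d //; exact: gS.
Qed.

(** With X for iota o F this reads X[h[k]] = (X h)[k] + X[h][k]. The value of h[k] at a point q is
    obtained by the operator h(q), which depends on q as well: when X differentiates h[k] at p,
    the first term comes from the function h(p)[k] and the second from the operator. *)
Lemma frozen_act_assoc (h k : M -> U) : smooth_into setT h -> smooth_into setT k ->
  frozen_act g iota (iota \o F) (frozen_act g iota h k) =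
  frozen_act g iota ((iota \o F) * h) k
  + frozen_act g iota (frozen_act g iota (iota \o F) h) k.
Proof.
move=> sh sk; have [_ _ aM ag sa] := Uact_smooth_action sk.
have [sf d] := freeze_smooth Uact_smooth_action (fun _ _ _ => I) sh sk.
apply/funext => p.
rewrite frozen_act_iota // (d _ _ (gS (gF p))) addrC.
rewrite -[RHS]/(act (iota (F p) * h p) k p + act (frozen_act g iota (iota \o F) h p) k p).
congr (_ + _); last by rewrite frozen_act_iota.
by rewrite aM; have [_ _ _ -> // _] := Uact_smooth_action (sa (h p)).
Qed.

End FrozenVectorField.

(** * Evaluation of series at a vector field *)

Section ElementaryDifferentials.
Variable f : M -> (M -> 'rV[R]_n).
Hypothesis sf : smooth_into g f.

Local Notation diff := (elem_diff g iota f).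
Local Notation LB := (LB_series g iota f).
Local Notation frz := (frozen_act g iota).

Lemma elem_diff_cons u w : diff (Node u :: w) = frz (diff u) (iota \o f) * diff w.
Proof. exact: dalg_eval_cons. Qed.

Lemma elem_diff_node u : diff [:: Node u] = frz (diff u) (iota \o f).
Proof. by rewrite elem_diff_cons; exact: mulr1. Qed.

Lemma elem_diff_cat u w : diff (u ++ w) = diff u * diff w.
Proof.
elim: u => [|[u] v IHv]; first by rewrite mul1r.
by rewrite cat_cons !elem_diff_cons IHv mulrA.
Qed.

Lemma elem_diff_smooth w : smooth_into setT (diff w).
Proof.
have [k] := ubnP (fsize w); elim: k w => // k IHk [_|[u] w].
  exact: (smooth_into_cst (w := 1 : U)).
rewrite fsize_cons ltnS => lt_k; rewrite elem_diff_cons.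
have su : smooth_into setT (diff u) by apply: IHk; apply: leq_ltn_trans lt_k; rewrite leq_addr.
have sw : smooth_into setT (diff w) by apply: IHk; apply: leq_ltn_trans lt_k; rewrite leq_addl.
exact: (smooth_mul (frozen_act_smooth su (smooth_iota sf).1) sw).1.
Qed.

Lemma elem_diff_tree t : exists2 X, smooth_into g X & diff [:: t] = iota \o X.
Proof.
by case: t => u; rewrite elem_diff_node; apply: frozen_act_vfield (elem_diff_smooth u) sf.
Qed.

Lemma elem_diff_sum_smooth (s : seq forest) (c : forest -> R) :
  smooth_into setT (\sum_(w <- s) c w *: diff w).
Proof.
apply: smooth_into_sum => w; rewrite -[_ *: _]addr0.
exact: (smooth_into_linear _ (elem_diff_smooth w) (smooth_into0 _)).1.
Qed.

Lemma frozen_actDl h h' k : smooth_into setT k -> frz (h + h') k = frz h k + frz h' k.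
Proof. by move=> sk; rewrite -[h]scale1r frozen_act_linearl // !scale1r. Qed.

Lemma frozen_act_suml (s : seq forest) (c : forest -> R) k : smooth_into setT k ->
  frz (\sum_(w <- s) c w *: diff w) k = \sum_(w <- s) c w *: frz (diff w) k.
Proof.
move=> sk; have f0 : frz 0 k = 0.
  by have := frozen_act_linearl (-1) 0 0 sk; rewrite scaler0 addr0 scaleN1r addNr.
elim: s => [|w s IHs]; first by rewrite !big_nil.
by rewrite !big_cons frozen_act_linearl // IHs.
Qed.

Lemma frozen_act_sumr (s : seq forest) (c : forest -> R) h :
  frz h (\sum_(w <- s) c w *: diff w) = \sum_(w <- s) c w *: frz h (diff w).
Proof.
have s0 : smooth_into setT (0 : M -> U) by exact: smooth_into0.
have f0 : frz h 0 = 0.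
  by have := frozen_act_linearr (-1) h s0 s0; rewrite scaler0 addr0 scaleN1r addNr.
elim: s => [|w s IHs]; first by rewrite !big_nil.
rewrite !big_cons frozen_act_linearr ?IHs //; first exact: elem_diff_smooth.
exact: elem_diff_sum_smooth.
Qed.

Lemma LB_linear m (c : R) a b : LB (c *: a + b) m = c *: LB a m + LB b m.
Proof.
rewrite /LB_series scaler_sumr -big_split; apply: eq_bigr => w _ /=.
by rewrite -[(_ + _) w]/(c * a w + b w) scalerDl scalerA.
Qed.

Lemma LBD m a b : LB (a + b) m = LB a m + LB b m.
Proof. by rewrite -[a]scale1r LB_linear !scale1r. Qed.

Lemma LBB m a b : LB (a - b) m = LB a m - LB b m.
Proof. by rewrite addrC -scaleN1r LB_linear scaleN1r addrC. Qed.

Lemma LB_supported n' k a m : supported n' k a -> m != n' -> LB a m = 0.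
Proof.
move=> sa mn; rewrite /LB_series big_seq big1 // => w; rewrite mem_forests => /eqP wm.
have [->|/sa[wn _]] := eqVneq (a w) 0; first by rewrite scale0r.
by rewrite -wm wn eqxx in mn.
Qed.

Lemma LB_delta w : LB (delta R w) (fsize w) = diff w.
Proof.
rewrite /LB_series (bigD1_seq w) ?forests_uniq ?mem_forests //= /delta eqxx scale1r.
by rewrite big1 ?addr0 // => u /negbTE ->; rewrite scale0r.
Qed.

Lemma LB_extend d T a m :
  LB (extend d T a) (d + m) = \sum_(w <- forests m) a w *: LB (T w) (d + m).
Proof.
rewrite /LB_series; under [RHS]eq_bigr => w _ do rewrite scaler_sumr.
rewrite exchange_big /= !big_seq; apply: eq_bigr => v; rewrite mem_forests => /eqP vm.
rewrite /extend vm leq_addr addKn scaler_suml; apply: eq_bigr => w _.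
by rewrite scalerA.
Qed.

Lemma LB_Bplus a m : LB (Bplus a) m.+1 = frz (LB a m) (iota \o f).
Proof.
rewrite -extend_bullet; apply: etrans (LB_extend 1 _ a m) _.
rewrite frozen_act_suml; last exact: (smooth_iota sf).1.
rewrite !big_seq; apply: eq_bigr => w; rewrite mem_forests => /eqP wm.
rewrite -elem_diff_node -LB_delta; congr (_ *: LB _ _).
by rewrite -wm /fsize; case: w {wm} => //= *; rewrite ?addn0.
Qed.

(** An evaluation of series is compatible with a bilinear operation as soon as it is so on
    forests, where the number of vertices identifies the degree. *)
Lemma LB_bilinear_ext (K : forest -> forest -> fseries R) (op : (M -> U) -> (M -> U) -> (M -> U))
    a b m :
  (forall (s s' : seq forest) (c c' : forest -> R),
     op (\sum_(u <- s) c u *: diff u) (\sum_(v <- s') c' v *: diff v) =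
     \sum_(u <- s) \sum_(v <- s') (c u * c' v) *: op (diff u) (diff v)) ->
  (forall u v, LB (K u v) (fsize u + fsize v) = op (diff u) (diff v)) ->
  LB (bilinear_ext K a b) m = \sum_(i < m.+1) op (LB a i) (LB b (m - i)).
Proof.
move=> op_sum opE; rewrite {1}/LB_series.
under eq_big_seq => w.
  rewrite mem_forests => /eqP wm; rewrite /bilinear_ext wm scaler_suml.
  under eq_bigr => i _.
    rewrite scaler_suml.
    under eq_bigr => u _ do rewrite scaler_suml.
    over.
  over.
rewrite exchange_big /=; apply: eq_bigr => i _.
rewrite exchange_big /= [RHS]op_sum !big_seq; apply: eq_bigr => u; rewrite mem_forests => /eqP ui.
rewrite exchange_big /= !big_seq; apply: eq_bigr => v; rewrite mem_forests => /eqP vi.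
rewrite -opE ui vi subnKC; last by rewrite -ltnS.
by rewrite /LB_series scaler_sumr; apply: eq_bigr => w _; rewrite scalerA.
Qed.

Lemma LB_concat a b m : LB (concat a b) m = \sum_(i < m.+1) LB a i * LB b (m - i).
Proof.
rewrite concat_bilinear_ext; apply: (LB_bilinear_ext (op := *%R)) => [s s' c c'|u v].
  rewrite mulr_suml; apply: eq_bigr => u _; rewrite mulr_sumr; apply: eq_bigr => v _.
  apply/funext => p; rewrite -[LHS]/((c u *: diff u p) * (c' v *: diff v p)).
  by rewrite -scalerAl -scalerAr scalerA.
by rewrite -fsize_cat LB_delta elem_diff_cat.
Qed.

Lemma LB_concat_supported n1 k1 m a b : supported n1 k1 a ->
  LB (concat a b) (n1 + m) = LB a n1 * LB b m.
Proof.
move=> sa; rewrite LB_concat.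
have lt1 : (n1 < (n1 + m).+1)%N by rewrite ltnS leq_addr.
rewrite (bigD1 (Ordinal lt1)) //= addKn big1 ?addr0 // => i ni.
by rewrite (LB_supported sa) ?mul0r.
Qed.

(** Grafting a tree is defined by the derivation rule and by its value on a tree B^+(u), and
    these two clauses correspond to the Leibniz rule and to the composition rule of the frozen
    action. *)
Lemma LB_graft1 t w : LB (graft1 R t w) (tsize t + fsize w) = frz (diff [:: t]) (diff w).
Proof.
have [X sX tX] := elem_diff_tree t.
have [k] := ubnP (fsize w); elim: k w => // k IHk [_|[u] w].
  rewrite tX (frozen_act_one sX : frz (iota \o X) (diff [::]) = 0) /LB_series big1 // => w _.
  exact: scale0r.
rewrite fsize_cons ltnS => lt_k.
have lt_u : (fsize u < k)%N by apply: leq_ltn_trans lt_k; rewrite leq_addr.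
have lt_w : (fsize w < k)%N by apply: leq_ltn_trans lt_k; rewrite leq_addl.
have sdu := elem_diff_smooth u; have sdw := elem_diff_smooth w.
have sfu : smooth_into setT (frz (diff u) (iota \o f)).
  exact: frozen_act_smooth sdu (smooth_iota sf).1.
rewrite -[graft1 R t (Node u :: w)]/(concat (Bplus (delta R (t :: u) + graft1 R t u)) (delta R w)
  + concat (delta R [:: Node u]) (graft1 R t w)) LBD elem_diff_cons.
rewrite tX (frozen_act_mul sX sfu sdw); congr (_ + _).
  have sB : supported (tsize t + fsize u).+1 1 (Bplus (delta R (t :: u) + graft1 R t u)).
    have := @supported_graft1 R t [:: Node u].
    by rewrite /graft1 /= concat1r concat0r addr0 fsize_cons addn0 addnS.
  rewrite addnS addnA -addSn (LB_concat_supported _ _ sB) LB_delta LB_Bplus LBD.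
  rewrite -[(tsize t + fsize u)%N]/(fsize (t :: u)) LB_delta.
  rewrite (elem_diff_cat [:: t] u : diff (t :: u) = _) tX.
  rewrite -[fsize _]/(tsize t + fsize u)%N IHk // tX.
  have sif := (smooth_iota sf).1.
  by rewrite (frozen_act_assoc sX sdu sif) frozen_actDl.
have -> : (tsize t + (fsize u + fsize w).+1 = fsize [:: Node u] + (tsize t + fsize w))%N.
  by rewrite fsize_cons addn0 addnS addSn addnCA.
rewrite (LB_concat_supported _ _ (@supported_delta R [:: Node u])) LB_delta elem_diff_node.
by rewrite IHk // tX.
Qed.

(** The clause for a word t :: w is the composition rule of the frozen action, solved for the
    term with the product. *)
Lemma LB_graft_rec k w w1 : size w = k ->
  LB (graft_rec R k w w1) (fsize w + fsize w1) = frz (diff w) (diff w1).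
Proof.
elim: k w => [|k IHk] [|t w] //= => [_|[sw]].
  by rewrite LB_delta (frozen_act1 (elem_diff_smooth w1)).
have [X sX tX] := elem_diff_tree t.
have [sdw sdw1] := (elem_diff_smooth w, elem_diff_smooth w1).
rewrite -[X in LB _ X]/(tsize t + fsize w + fsize w1)%N LBB.
rewrite -[RHS]/(frz (diff (t :: w)) (diff w1)).
rewrite (elem_diff_cat [:: t] w : diff (t :: w) = _) tX.
have -> : frz ((iota \o X) * diff w) (diff w1) =
    frz (iota \o X) (frz (diff w) (diff w1)) - frz (frz (iota \o X) (diff w)) (diff w1).
  by rewrite (frozen_act_assoc sX sdw sdw1) addrK.
congr (_ - _).
  rewrite -addnA LB_extend -(IHk _ sw) [in RHS]/LB_series frozen_act_sumr.
  rewrite !big_seq; apply: eq_bigr => v; rewrite mem_forests => /eqP vE.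
  by rewrite -vE LB_graft1 tX.
rewrite addnC LB_extend -tX -LB_graft1 [in RHS]/LB_series frozen_act_suml //.
rewrite !big_seq; apply: eq_bigr => v; rewrite mem_forests => /eqP vE.
have [->|/(@supported_graft1 R t w)[_ sv]] := eqVneq (graft1 R t w v) 0; first by rewrite !scale0r.
by rewrite -vE addnC IHk // sv.
Qed.

Lemma LB_graft a b m : LB (graft a b) m = \sum_(i < m.+1) frz (LB a i) (LB b (m - i)).
Proof.
rewrite graft_bilinear_ext; apply: (LB_bilinear_ext (op := frz)) => [s s' c c'|u v].
  rewrite frozen_act_suml; last exact: elem_diff_sum_smooth.
  apply: eq_bigr => u _; rewrite frozen_act_sumr scaler_sumr; apply: eq_bigr => v _.
  by rewrite scalerA.
by rewrite /graft_forest LB_graft_rec.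
Qed.

Section FormalSubstitution.
Variables (beta : fseries R) (ft : nat -> M -> (M -> 'rV[R]_n)).
Hypothesis ftE : forall m, iota \o ft m = LB beta m.

(** By LB_concat and LB_graft, B_f is a homomorphism of D-algebras from series to functions.
    Evaluation at f tilde = B_f(beta) is therefore substitution of beta followed by evaluation
    at f. *)
Lemma formal_elem_diff_subst w m : formal_elem_diff g iota ft w m = LB (subst_forest beta w) m.
Proof.
have [k] := ubnP (fsize w); elim: k w m => // k IHk [|[u] w] m.
  move=> _; rewrite -[LHS]/(formal_one U m) /formal_one.
  case: eqP => [->|/eqP m0].
    by rewrite -[0%N]/(fsize [::]) LB_delta.
  by rewrite (LB_supported (@supported_delta R [::])).
rewrite fsize_cons ltnS => lt_k.
have lt_u : (fsize u < k)%N by apply: leq_ltn_trans lt_k; rewrite leq_addr.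
have lt_w : (fsize w < k)%N by apply: leq_ltn_trans lt_k; rewrite leq_addl.
rewrite subst_forest_cons LB_concat.
rewrite -[LHS]/(\sum_(i < m.+1) (\sum_(j < i.+1) frz (formal_elem_diff g iota ft u j)
  (iota \o ft (i - j)%N)) * formal_elem_diff g iota ft w (m - i)%N).
apply: eq_bigr => i _; rewrite IHk // LB_graft; congr (_ * _).
by apply: eq_bigr => j _; rewrite IHk // ftE.
Qed.

Lemma formal_LB_subst gamma : formal_LB_series g iota ft gamma = LB (subst beta gamma).
Proof.
apply/funext => m; rewrite /formal_LB_series /LB_series.
under [RHS]eq_big_seq => v.
  rewrite mem_forests => /eqP vm; rewrite /subst vm scaler_suml.
  under eq_bigr => i _ do rewrite scaler_suml.
  over.
rewrite exchange_big /=; apply: eq_bigr => i _.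
rewrite exchange_big /=; apply: eq_bigr => w _.
rewrite formal_elem_diff_subst /LB_series scaler_sumr; apply: eq_bigr => v _.
by rewrite scalerA.
Qed.

End FormalSubstitution.

Lemma jacobi_sum (m m' : nat) (x : 'I_m -> R) (y : 'I_m' -> R)
    (X : 'I_m -> (M -> 'rV[R]_n)) (Y : 'I_m' -> (M -> 'rV[R]_n)) :
  (forall i, g (X i)) -> (forall j, g (Y j)) ->
  jacobi (\sum_i x i *: X i) (\sum_j y j *: Y j)
  = \sum_i \sum_j (x i * y j) *: jacobi (X i) (Y j).
Proof.
move=> gX gY; have sY := gS (iota_sum y gY).1.
have s0 := @smooth_vfield0 R n M.
have jl0 (Z : M -> 'rV[R]_n) : smooth_vfield Z -> jacobi 0 Z = 0.
  by move=> sZ; have := jacobi_linearl (-1) s0 s0 sZ; rewrite scaler0 addr0 scaleN1r addNr.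
have jr0 (Z : M -> 'rV[R]_n) : smooth_vfield Z -> jacobi Z 0 = 0.
  by move=> sZ; have := jacobi_linearr (-1) sZ s0 s0; rewrite scaler0 addr0 scaleN1r addNr.
have right (Z : M -> 'rV[R]_n) : smooth_vfield Z ->
    jacobi Z (\sum_j y j *: Y j) = \sum_j y j *: jacobi Z (Y j).
  move=> sZ; elim: m' y Y gY {sY} => [|m' IHm] y' Y' gY'; first by rewrite !big_ord0 jr0.
  have gY'' j : g (Y' (lift ord0 j)) by exact: gY'.
  rewrite !big_ord_recl -(IHm _ _ gY'').
  exact: jacobi_linearr sZ (gS (gY' _)) (gS (iota_sum _ gY'').1).
elim: m x X gX => [|m IHm] x X gX; first by rewrite !big_ord0 jl0.
have gX' i : g (X (lift ord0 i)) by exact: gX.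
have -> : \sum_i \sum_j (x i * y j) *: jacobi (X i) (Y j) =
    x ord0 *: jacobi (X ord0) (\sum_j y j *: Y j)
    + jacobi (\sum_i x (lift ord0 i) *: X (lift ord0 i)) (\sum_j y j *: Y j).
  rewrite big_ord_recl -(IHm _ _ gX'); congr (_ + _); rewrite (right _ (gS (gX _))) scaler_sumr.
  by apply: eq_bigr => j _; rewrite scalerA.
rewrite big_ord_recl; exact: jacobi_linearl (gS (gX _)) (gS (iota_sum _ gX').1) sY.
Qed.

(** The coefficients of a Lie polynomial combine trees by brackets, and F_f sends trees to
    vector fields and concatenation brackets to pointwise Jacobi brackets. *)
Lemma LB_lie_polynomial x m : lie_polynomial x -> exists2 X, smooth_into g X & LB x m = iota \o X.
Proof.
have [[iP iB] _] := hU.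
move=> lx; pose P : set (fseries R) :=
  [set x | forall m, exists2 X, smooth_into g X & LB x m = iota \o X].
suff : P x by exact.
have P0 k : exists2 X, smooth_into g X & (0 : M -> U) = iota \o X.
  exists 0; first exact: smooth_into0.
  by apply/funext => p; rewrite -[RHS]/(iota 0) iota0.
apply: (lx P); split; first split.
- move=> k; rewrite /LB_series big1 => [|w _]; [exact: P0|exact: scale0r].
- move=> c y z Py Pz k; have [[Y sY yE] [Z sZ zE]] := (Py k, Pz k).
  exists (c *: Y + Z); first exact: (smooth_into_linear c sY sZ).1.
  rewrite LB_linear yE zE; apply/funext => p.
  by rewrite -[RHS]/(iota (c *: Y p + Z p)) iP //; apply: smooth_into_val.
- move=> y z Py Pz k.
  pose Y i := s2val (cid2 (Py i)); pose Z i := s2val (cid2 (Pz i)).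
  have sY i : smooth_into g (Y i) by exact: (s2valP (cid2 (Py i))).
  have sZ i : smooth_into g (Z i) by exact: (s2valP (cid2 (Pz i))).
  have yE i : LB y i = iota \o Y i by exact: (s2valP' (cid2 (Py i))).
  have zE i : LB z i = iota \o Z i by exact: (s2valP' (cid2 (Pz i))).
  exists (\sum_(i < k.+1) (fun p => jacobi (Y i p) (Z (k - i)%N p))).
    by apply: smooth_into_sum => i; apply: smooth_into_bilinear jacobi_sum gJ (sY i) (sZ _).
  rewrite /concat_bracket LBB !LB_concat [X in _ - X](reindex_inj rev_ord_inj) /= -sumrB.
  apply/funext => p; rewrite fct_sumE -[RHS]/(iota ((\sum_(i < k.+1) _) p)) fct_sumE.
  have gJi (i : 'I_k.+1) : g (jacobi (Y i p) (Z (k - i)%N p)).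
    by apply: gJ; apply: smooth_into_val.
  have [_] := iota_sum (fun _ => 1) gJi.
  under eq_bigr => i _ do rewrite scale1r.
  move=> ->; apply: eq_bigr => i _; rewrite scale1r iB; [|exact: smooth_into_val..].
  rewrite subSS subKn; last by rewrite -ltnS.
  by rewrite !yE !zE.
move=> _ [t _ <-] k; have [X sX tX] := elem_diff_tree t.
have [->|nk] := eqVneq k (fsize [:: t]); first by exists X; rewrite // LB_delta.
by rewrite (LB_supported (@supported_delta R [:: t]) nk); exact: P0.
Qed.

Lemma LB_component a m : LB (component m a) m = LB a m.
Proof.
rewrite /LB_series !big_seq; apply: eq_bigr => w; rewrite mem_forests => /eqP wm.
by rewrite /component wm eqxx.
Qed.

Lemma LB_lie_series beta : lie_series beta -> exists ft : nat -> M -> (M -> 'rV[R]_n),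
  formal_vfield g ft /\ forall m, iota \o ft m = LB beta m.
Proof.
move=> lb; have ex m : exists2 X, smooth_into g X & LB beta m = iota \o X.
  by rewrite -LB_component; exact: LB_lie_polynomial.
pose X m := if m is 0%N then 0 else s2val (cid2 (ex m)).
exists X; split; first split=> // -[|m]; first exact: smooth_into0.
  exact: (s2valP (cid2 (ex m.+1))).
move=> [|m]; last by rewrite (s2valP' (cid2 (ex m.+1))).
rewrite /LB_series big_seq1 lie_series_nil // scale0r.
by apply/funext => p; rewrite -[LHS]/(iota 0) iota0.
Qed.

End ElementaryDifferentials.
End SmoothAction.

(** * The modified vector field *)

Theorem theorem3p10 (R : realType) (n : nat) (M : manifold R n)
    (d : nat) (E : 'I_d -> M -> 'rV[R]_n) (hE : is_frame E)
    (U : algType R) (iota : (M -> 'rV[R]_n) -> U)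
    (hU : is_enveloping (frame_lie E) iota)
    (f : M -> (M -> 'rV[R]_n)) (hf : smooth_into (frame_lie E) f)
    (alpha : fseries R) (halpha : lie_series alpha) :
  exists (beta : fseries R) (ftilde : nat -> M -> (M -> 'rV[R]_n)),
    [/\ lie_series beta,
        formal_vfield (frame_lie E) ftilde,
        forall m, iota \o ftilde m = LB_series (frame_lie E) iota f beta m,
        formal_LB_series (frame_lie E) iota ftilde (gamma_exact R)
          = LB_series (frame_lie E) iota f alpha
      & subst beta (gamma_exact R) = alpha].
Proof.
have [g0 gP gJ] := lie_span_subspace (@jacobi R n M) (range E).
have gS X (gX : frame_lie E X) := frame_lie_smooth hE gX.
have [beta [lie_beta _ betaE]] := subst_gamma_exact_inverse halpha.
have [ft [ft_vfield ftE]] := LB_lie_series hU g0 gP gJ gS hf lie_beta.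
exists beta, ft; split=> //.
by rewrite (formal_LB_subst hU g0 gP gJ gS hf ftE) betaE.
Qed.
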